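(* Let $k\geq 0$ be an integer, let $D$ be a $3$-strong digraph of order $n+1\geq 10$, and let $u,v$ be two arbitrary distinct vertices of $D$. Suppose that (1) either $d^+(u)+d^-(v)\geq n-k-2$, or $uv\notin A(D)$ and $d^+(u)+d^-(v)\geq n-k-4$; and (2) $d(x)\geq n+k+2$ for every vertex $x\in V(D)\setminus\{u,v\}$. Then $D$ has a Hamiltonian $(u,v)$-path.
   Context: All digraphs are finite, without loops and without multiple arcs (but both $xy$ and $yx$ may be arcs). $V(D)$ and $A(D)$ denote the vertex set and arc set of a digraph $D$; the order of $D$ is $|V(D)|$; $uv\in A(D)$ means there is an arc from $u$ to $v$. For a vertex $x$, $d^+(x)$ and $d^-(x)$ are the numbers of out-neighbours and in-neighbours of $x$ in $D$, and the degree of $x$ is $d(x)=d^+(x)+d^-(x)$. All paths are simple and directed. $D$ is strong if for every pair of distinct vertices $x,y$ there is a path from $x$ to $y$ and a path from $y$ to $x$. For $m\geq 1$, $D$ is $m$-strong if $|V(D)|\geq m+1$ and $D-A$ is strong for every subset $A\subset V(D)$ of at most $m-1$ vertices. A Hamiltonian $(u,v)$-path is a path from $u$ to $v$ that includes all vertices of $D$. *)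

(* Defs.v *)
From mathcomp Require Import all_boot.

Set Implicit Arguments.
Unset Strict Implicit.
Unset Printing Implicit Defensive.

(* A digraph is its arc relation [arc : rel V] on a finite
   vertex type [V]; multiple arcs are excluded by using a relation, loops by
   the hypothesis [irreflexive arc]. *)

Section Digraph.

Variables (V : finType) (arc : rel V).

Definition outdeg (x : V) : nat := #|[set y | arc x y]|.
Definition indeg (x : V) : nat := #|[set y | arc y x]|.
Definition deg (x : V) : nat := outdeg x + indeg x.

(* [p] lists the vertices after [x], so the path visits [x :: p]. *)
Definition dipath (x y : V) (p : seq V) : bool :=
  [&& path arc x p, last x p == y & uniq (x :: p)].

(* [x] and [y] range over ordered pairs, so both directions are covered. *)
Definition strong : Prop :=
  forall x y : V, x != y -> exists p : seq V, dipath x y p.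

Definition hamiltonian_path (x y : V) (p : seq V) : Prop :=
  dipath x y p /\ forall z : V, z \in x :: p.

End Digraph.

(* The arc relation of D - A, on the type of the vertices outside A. *)
Definition delete_vertices (V : finType) (arc : rel V) (A : {set V}) :
  rel {x : V | x \notin A} := fun x y => arc (val x) (val y).

(* Meaningful for [1 <= m]; [#|A| < m] then says [#|A| <= m - 1]. *)
Definition m_strong (V : finType) (arc : rel V) (m : nat) : Prop :=
  m + 1 <= #|V| /\
  forall A : {set V}, #|A| < m -> strong (@delete_vertices V arc A).

(* Main.v *)
(* Contract [u] and [v] to a single vertex [z] that keeps the out-arcs of [u] and
   the in-arcs of [v]. Hamiltonian (u,v)-paths become Hamiltonian cycles of a
   2-strong digraph on [n] vertices with [d(x) >= n + k] for [x <> z] and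
   [d(z) >= n - k - 4]. Suppose that it has no Hamiltonian cycle.

   A vertex of large degree can be inserted in a path or cycle, so every cycle
   through [z] misses at least [k + 2] vertices, and an extremal argument in the
   style of Bondy and Thomassen gives a cycle through all vertices except [z].
   Write such a cycle as [P ++ R] with [z :: P] a cycle too and [R] as short as
   possible. Then [R] is not adjacent to [z], [k + 2 <= |R| <= k + 4], and degree
   counting shows that [z] and the vertices of [R] use almost every slot between
   consecutive vertices of [P]: together they leave at most two slots blank.

   Unless [z] has an in-arc from [P] before an out-arc to [P], each of [z] and [R]
   first has only out-arcs to [P] and then only in-arcs from it. By
   2-strongness some arc of [P] jumps over any given inner vertex, and
   splicing [z], a path in [R] and segments of [P] along such arcs gives a cycle
   through [z] that misses too little, or a Hamiltonian cycle avoiding [z] with a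
   shorter [R]. In the remaining case [|R| = k + 2], and a segment [G] of [P]
   is exchangeable with [R]; comparing the two configurations, and treating
   [k = 0], [|G| = 3] by hand, ends the proof. *)
Require Import Defs.
From mathcomp Require Import all_boot zify.
From Stdlib Require Import Classical.

Set Implicit Arguments.
Unset Strict Implicit.
Unset Printing Implicit Defensive.

(** * Insertion into paths and cycles *)

(** The vertex [z] may have too few arcs to be inserted anywhere, so it always enters by explicit
    splicing; only the other vertices are inserted by degree. The two degree bounds balance as
    follows. With [N = size P], the contracted digraph has [N + size R + 1] vertices, and neither
    [z] nor a vertex of [R] has two arcs at one slot, so its degree to [P] is [N + 1] minus its
    blank slots. For [z] this gives: blanks plus [size R] are at most [k + 4]. A vertex of [R] has
    at most [2 * (size R - 1)] arcs inside [R], and its blanks and missing inner arcs together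
    number at most [size R - k - 2]. Hence two blanks in total, whatever the size of [R], but with
    opposite difficulties: for [size R = k + 4], [z] has no blank and [R] may be poorly connected;
    for [size R = k + 2], [R] is complete and without blanks, while [z] may switch more than once
    between out-arcs and in-arcs. *)

Ltac clia := clear; move=> *; lia.

Ltac alia :=
  repeat match goal with
  | H : is_true (leq _ _) |- _ => revert H
  | H : is_true (andb (leq _ _) (leq _ _)) |- _ => revert H
  | H : is_true (negb (@eq_op _ _ _)) |- _ => revert H
  | H : @eq nat _ _ |- _ => revert H
  end; clear; intros; lia.

(* [perm_size] and [size_rem] at the carrier of a [finType], so that [lia] sees
   syntactically equal terms. *)
Lemma perm_sizeV (V : finType) (s t : seq V) : perm_eq s t -> size s = size t.
Proof. exact: perm_size. Qed.

Lemma size_remV (V : finType) (x : V) (s : seq V) :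
  x \in s -> size (rem x s) = (size s).-1.
Proof. exact: size_rem. Qed.

Lemma uniq_catl (V : finType) (s t : seq V) : uniq (s ++ t) -> uniq s.
Proof. by rewrite cat_uniq => /and3P[]. Qed.

Lemma uniq_catr (V : finType) (s t : seq V) : uniq (s ++ t) -> uniq t.
Proof. by rewrite cat_uniq => /and3P[]. Qed.

Section Insertion.

Variables (V : finType) (e : rel V).

Definition degin (x : V) (s : seq V) : nat := count (e x) s + count (e^~ x) s.

Lemma degin_cat x s t : degin x (s ++ t) = degin x s + degin x t.
Proof. rewrite /degin !count_cat; lia. Qed.

Lemma degin_cons x y s : degin x (y :: s) = e x y + e y x + degin x s.
Proof. rewrite /degin /=; lia. Qed.

Lemma degin_perm x s t : perm_eq s t -> degin x s = degin x t.
Proof. by move=> /permP st; rewrite /degin !st. Qed.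

Lemma degin_max x s : degin x s <= 2 * size s.
Proof.
have := count_size (e x) s; have := count_size (e^~ x) s; rewrite /degin; lia.
Qed.

Lemma degin_nonadj x (s : seq V) :
  (forall y, y \in s -> ~~ e x y /\ ~~ e y x) -> degin x s = 0.
Proof.
elim: s => [//|y s IHs] nadj; rewrite degin_cons IHs; last first.
  by move=> w ws; apply: nadj; rewrite inE ws orbT.
by have [/negbTE -> /negbTE ->] := nadj y (mem_head _ _).
Qed.

(** Pigeonhole over the [size s] consecutive pairs of the path [a :: s]: [belast a s] lists their
    first members and [s] their second members. *)
Lemma insertable_slot v a s :
  size s < count (e^~ v) (belast a s) + count (e v) s ->
  exists s1 b s2, [/\ s = s1 ++ b :: s2, e (last a s1) v & e v b].
Proof.
elim: s a => [//|b s IHs] a /= lt_s.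
have [av_vb|] := boolP (e a v && e v b).
  by case/andP: av_vb => av vb; exists [::], b, s.
move=> not_ab.
have [|s1 [c [s2 [-> lc vc]]]] := IHs b.
  by move: not_ab lt_s; case: (e a v); case: (e v b) => //=; lia.
by exists (b :: s1), c, s2.
Qed.

Lemma degin_slots v a s :
  degin v (a :: s)
    = e v a + (count (e^~ v) (belast a s) + count (e v) s) + e (last a s) v.
Proof.
have : count (e^~ v) (belast a s) + e (last a s) v = count (e^~ v) (a :: s).
  by rewrite [in RHS]lastI -cats1 count_cat /= addn0.
rewrite /degin /=; lia.
Qed.

(* A block is a nonempty path; cycles are assembled from blocks by [chain]. *)
Definition block (W : seq V) : bool := (W != [::]) && sorted e W.

(** The arcs [e v (head z W)] and [e (last z W) v] serve no inner place, so they are discounted; the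
    others must exceed the [size W - 1] inner places. Keeping both ends lets [W'] replace [W] inside
    any cycle. *)
Lemma insert_block z v W :
  block W -> size W + e v (head z W) + e (last z W) v < degin v W + 1 ->
  exists W', [/\ block W', head z W' = head z W, last z W' = last z W
               & perm_eq W' (v :: W)].
Proof.
case: W => [//|a s] /= /andP[_ pas] lt_W.
have [s1 [b [s2 [es av vb]]]] : exists s1 b s2,
    [/\ s = s1 ++ b :: s2, e (last a s1) v & e v b].
  by apply: insertable_slot; move: lt_W; rewrite degin_slots; lia.
exists (a :: s1 ++ v :: b :: s2); split=> //=.
- by move: pas; rewrite es /block /= !cat_path /= av vb => /and3P[-> _ ->].
- by rewrite es !last_cat.
- rewrite es; apply/permP=> p; rewrite /= !count_cat /=; lia.
Qed.

Lemma insert_block_deg z v W :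
  block W -> size W + 1 < degin v W ->
  exists W', [/\ block W', head z W' = head z W, last z W' = last z W
               & perm_eq W' (v :: W)].
Proof. by move=> bW lt_W; apply: insert_block => //; lia. Qed.

Lemma path_block z W x l :
  block W -> path e x (W ++ l) = e x (head z W) && path e (last z W) l.
Proof. by case: W => [//|a s] /= /andP[_ /= pas]; rewrite cat_path pas. Qed.

Lemma path_block0 z W x : block W -> path e x W = e x (head z W).
Proof. by move=> bW; rewrite -[W]cats0 (path_block z) //= cats0 andbT. Qed.

Lemma cycle_block z W l :
  block W -> cycle e (W ++ l) = path e (last z W) (rcons l (head z W)).
Proof.
by case: W => [//|a s] /= /andP[_ /= pas]; rewrite rcons_cat cat_path pas.
Qed.

Lemma block_cat z A B :
  block A -> block B -> block (A ++ B) = e (last z A) (head z B).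
Proof.
case: A => [//|a s] /andP[_ /= pas] bB.
by rewrite /block /= cat_path pas /= (path_block0 z).
Qed.

Lemma cycle_blockl A B : cycle e (A ++ B) -> A != [::] -> block A.
Proof. by case: A => //= a A; rewrite rcons_cat cat_path => /andP[]. Qed.

Lemma cycle_blockr A B : cycle e (A ++ B) -> B != [::] -> block B.
Proof.
by rewrite -(rot_cycle (size A)) rot_size_cat; apply: cycle_blockl.
Qed.

Lemma block_prefix A B : block (A ++ B) -> A != [::] -> block A.
Proof. by case/andP=> _ /cat_sorted2[sA _] A0; rewrite /block A0. Qed.

Lemma block_suffix A B : block (A ++ B) -> B != [::] -> block B.
Proof. by case/andP=> _ /cat_sorted2[_ sB] B0; rewrite /block B0. Qed.

(** The four arcs at [w] are grouped into the routes from [x] to [t] and from [t] to [x] through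
    [w], each with at most one arc present. *)
Lemma degin_pair x t (s : seq V) :
  (forall w, w \in s -> e x w + e w t <= 1 /\ e t w + e w x <= 1) ->
  degin x s + degin t s <= 2 * size s.
Proof.
elim: s => [//|w s IHs] two; have [xwt twx] := two w (mem_head _ _).
rewrite !degin_cons /=; have := IHs (fun y ys => two y (mem_behead (s := w :: s) ys)).
by move=> h; lia.
Qed.

(** On a cycle no arc of [v] is wasted at an end, so [size c + 1] arcs suffice. *)
Lemma insert_cycle v c :
  cycle e c -> size c < degin v c ->
  exists c', cycle e c' /\ perm_eq c' (v :: c).
Proof.
case: c => [//|a s] /= cyc lt_c.
have [s1 [b [s2 [es av vb]]]] : exists s1 b s2,
    [/\ rcons s a = s1 ++ b :: s2, e (last a s1) v & e v b].
  apply: insertable_slot; rewrite belast_rcons size_rcons -cats1 count_cat /=.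
  by move: lt_c; rewrite /degin /=; lia.
(* The place found is either the closing arc back to [a] or an arc of the path. *)
case/lastP: s2 es => [|s2 b']; rewrite ?cats1 -?rcons_cons -?rcons_cat.
  move=> /rcons_inj[es ab]; exists (a :: rcons s1 v); split; last first.
    by rewrite es -cats1; apply/permP=> p; rewrite /= count_cat /=; lia.
  by move: cyc; rewrite es /= !rcons_path last_rcons av ab vb => /andP[-> _].
move=> /rcons_inj[es ab]; exists (a :: s1 ++ v :: b :: s2); split.
  move: cyc; rewrite es /= !rcons_cat !cat_path /= av vb.
  by case/and3P=> -> _ ->.
by rewrite es; apply/permP=> p; rewrite /= !count_cat /=; lia.
Qed.

Lemma degin_irr t (s : seq V) : irreflexive e -> t \in s -> degin t s + 2 <= 2 * size s.
Proof.
move=> irr ts; rewrite (degin_perm _ (perm_to_rem ts)) degin_cons irr.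
have := degin_max t (rem t s); rewrite size_rem //.
have : 0 < size s by case: (s) ts.
by rewrite /= => *; lia.
Qed.

(** Greedy insertion of vertices of [G] until none fits by degree; the leftovers [T] then have few
    arcs to [W']. *)
Lemma maximal_insertion z (W G : seq V) :
  block W -> exists W' T,
    [/\ block W', head z W' = head z W, last z W' = last z W,
        perm_eq (W' ++ T) (W ++ G)
      & {subset T <= G} /\ forall t, t \in T -> degin t W' <= size W' + 1].
Proof.
have [m] := ubnP (size G); elim: m W G => // m IHm W G lt_G bW.
have [/hasP[t tG lt_t]|/hasPn noG] := boolP (has (fun t => size W + 1 < degin t W) G).
  have [W1 [bW1 hW1 lW1 pW1]] := insert_block_deg z bW lt_t.
  have [|W' [T [bW' hW' lW' pW' [sT maxT]]]] := IHm W1 (rem t G) _ bW1.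
    have G0 : 0 < size G by case: (G) tG.
    by rewrite size_rem // prednK.
  exists W', T; rewrite bW' hW' lW' hW1 lW1; split=> //; last first.
    by split=> // y /sT /mem_rem.
  apply/permP=> p; have := permP pW' p; have := permP pW1 p.
  by have := permP (perm_to_rem tG) p; rewrite !count_cat /=; lia.
by exists W, G; split=> //; split=> // t /noG; rewrite -leqNgt.
Qed.

End Insertion.

(** * Vertices outside a longest cycle *)

Lemma ex_minimal (P : nat -> Prop) :
  (exists n, P n) -> exists n, P n /\ forall m, P m -> n <= m.
Proof.
case=> n; have [b] := ubnP n; elim: b n => // b IHb n lt_n Pn.
have [[m [Pm lt_mn]]|nomin] := classic (exists m, P m /\ m < n).
  by apply: (IHb m) => //; lia.
exists n; split=> // m Pm; rewrite leqNgt; apply/negP=> lt_mn.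
by apply: nomin; exists m.
Qed.

Section BondyThomassen.

Variables (V : finType) (e : rel V).
Hypothesis irr : irreflexive e.
Variables (z : V) (U S : seq V).
Hypotheses (uniqU : uniq U) (cycS : cycle e S) (uniqS : uniq S) (S0 : S != [::]).
Hypotheses (SU : {subset S <= U}) (ltS : size S < size U).
Hypothesis strongU : forall X : pred V,
  (exists2 x, x \in U & X x) -> (exists2 y, y \in U & ~~ X y) ->
  exists x y, [/\ x \in U, y \in U, X x, ~~ X y & e x y].
Hypothesis longestS : forall c,
  cycle e c -> uniq c -> {subset c <= U} -> size c <= size S.

(** [Q] leaves the cycle [G ++ W] at the last vertex of [W] and returns at its head, so that
    [W ++ Q] is a cycle that trades the segment [G] for [Q]; [O] is the rest of [U]. *)
Definition excursion (G W Q O : seq V) : Prop :=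
  [/\ perm_eq (G ++ W) S, cycle e (G ++ W), perm_eq (G ++ W ++ Q ++ O) U
    & [/\ block e W, block e Q, e (last z W) (head z Q) & e (last z Q) (head z W)]].

Lemma excursion_exists : exists G W Q O, excursion G W Q O.
Proof.
have [s sS] : exists s, s \in S by case: (S) S0 => // s ? _; exists s; rewrite inE eqxx.
have [o0 o0U o0S] : exists2 o, o \in U & o \notin S.
  apply/hasP/negPn/negP=> /hasPn allS.
  have : size U <= size S by apply: uniq_leq_size => // x /allS /negPn.
  by lia.
have [|| s1 [o [s1U oU s1S oS s1o]]] := strongU (X := mem S).
- by exists s; rewrite ?SU.
- by exists o0.
(* These arcs stay off the cycle, so an arc leaving the set reached from [o] along [e'] can only end
   on [S]. *)
pose e' x y := [&& e x y, y \in U & y \notin S].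
have e'U x y : connect e' x y -> x \in U -> x \notin S -> (y \in U) && (y \notin S).
  move=> /connectP[p pp ->]; elim: p x pp => [|a p IHp] x /=; first by move=> _ -> ->.
  by case/andP=> /and3P[_ aU aS] pp _ _; apply: IHp.
have [|| x [y [xU yU ox noy xy]]] := strongU (X := connect e' o).
- by exists o.
- exists s1 => //; apply/negP=> /e'U /(_ oU oS) /andP[_]; by rewrite (s1S : s1 \in S).
have yS : y \in S.
  apply/negPn/negP=> yS; case/negP: noy; apply: connect_trans ox _.
  by apply: connect1; rewrite /e' xy yU.
case/connectP: ox => p0 /shortenP[p pp up _] ex.
have [i B eB] := rot_to s1S.
(* The cycle is read from the successor of [s1] round to [s1], so that [W] runs from the return
   vertex [y] to [s1]; it is a single vertex if [y = s1]. *)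
have [G [W0 eG]] : exists G W0, rcons B s1 = G ++ y :: W0.
  have : y \in rcons B s1 by rewrite mem_rcons -eB mem_rot.
  by case/splitPr=> G W0; exists G, W0.
have pB : perm_eq (rcons B s1) S by rewrite perm_rcons -eB perm_rot.
have QU w : w \in o :: p -> (w \in U) && (w \notin S).
  move=> wp; apply: (@e'U o) => //; apply/connectP.
  case/splitPl: wp pp => p1 p2 <-; rewrite cat_path => /andP[pp1 _].
  by exists p1.
have cGW : cycle e (G ++ y :: W0) by rewrite -eG -rot1_cons rot_cycle -eB rot_cycle.
exists G, (y :: W0), (o :: p), (filter (predC (mem (S ++ o :: p))) U); split.
- by rewrite -eG.
- exact: cGW.
- have pGW : perm_eq (G ++ y :: W0) S by rewrite -eG.
  rewrite catA; apply: (@perm_trans _ (S ++ (o :: p) ++ [seq w <- U | w \notin S ++ o :: p])).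
    by rewrite perm_cat2r.
  rewrite catA perm_sym -(perm_filterC (mem (S ++ o :: p))) perm_cat2r.
  apply: uniq_perm; rewrite ?filter_uniq //.
    rewrite cat_uniq uniqS up andbT; apply/hasPn => w /QU /andP[_ ->] //.
  move=> w; rewrite mem_filter /=; case: (boolP (w \in S ++ o :: p)) => //=.
  by rewrite mem_cat => /orP[/SU -> //|/QU /andP[-> _]].
- split=> //=; last 1 first.
  + by rewrite -ex.
  + by apply: cycle_blockr cGW _.
  + rewrite /block /=; apply: sub_path pp => a b; by case/and3P.
  + have : last s1 (G ++ y :: W0) = s1 by rewrite -eG last_rcons.
    by rewrite last_cat /= => ->.
Qed.

(** A path that starts like [Q] but returns at a vertex [t] of [G] bypasses only the part of [G]
    before [t]. *)
Lemma excursion_forward G1 t G2 W Q O Q' O' :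
  excursion (G1 ++ t :: G2) W Q O -> block e Q' -> head z Q' = head z Q ->
  e (last z Q') t -> perm_eq (Q' ++ O') (Q ++ O) ->
  excursion G1 (t :: G2 ++ W) Q' O'.
Proof.
case=> pS cyc pU [bW bQ WQ QW] bQ' hQ' lQ' pQ'.
have cyc1 : cycle e (G1 ++ t :: G2 ++ W) by move: cyc; rewrite -catA.
split=> //.
- by move: pS; rewrite -catA.
- apply: perm_trans pU; rewrite -!catA perm_cat2l /= perm_cons.
  by rewrite -!catA !perm_cat2l.
- split=> //=.
  + by apply: cycle_blockr cyc1 _.
  + by move: WQ; rewrite hQ' last_cat; case: (W) bW.
Qed.

(** Leaving the cycle at [t] instead of the last vertex of [W] bypasses only the part of [G] after
    [t]. *)
Lemma excursion_backward G1 t G2 W Q O Q' O' :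
  excursion (G1 ++ t :: G2) W Q O -> block e Q' -> last z Q' = last z Q ->
  e t (head z Q') -> perm_eq (Q' ++ O') (Q ++ O) ->
  excursion G2 (W ++ rcons G1 t) Q' O'.
Proof.
case=> pS cyc pU [bW bQ WQ QW] bQ' lQ' hQ' pQ'.
have cyc1 : cycle e (G2 ++ W ++ rcons G1 t).
  by move: cyc; rewrite -cat_rcons -catA -rot_size_cat rot_cycle -catA.
split=> //.
- by apply: perm_trans pS; apply/permP=> p; rewrite -cats1 !count_cat /=; clia.
- apply: perm_trans pU; apply/permP=> p; have := permP pQ' p.
  by rewrite -cats1 !count_cat /=; clia.
- split=> //=.
  + by apply: cycle_blockr cyc1 _; case: (W) bW.
  + by rewrite last_cat last_rcons.
  + by move: QW; rewrite lQ'; case: (W) bW.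
Qed.

Lemma rcons_block_path (A : seq V) x :
  block e A -> block e (rcons A x) = e (last z A) x.
Proof. by move=> bA; rewrite -cats1 (block_cat z). Qed.

Section Minimal.

Variables (G W Q O : seq V).
Hypothesis exc : excursion G W Q O.
Hypothesis minG : forall G' W' Q' O', excursion G' W' Q' O' -> size G <= size G'.

Lemma gap_forward Q' O' t :
  block e Q' -> head z Q' = head z Q -> perm_eq (Q' ++ O') (Q ++ O) ->
  t \in G -> ~~ e (last z Q') t.
Proof.
move=> bQ' hQ' pQ' tG; apply/negP=> lt; move: exc minG.
case/splitPr: tG => G1 G2 exc' min'.
have /min' := excursion_forward exc' bQ' hQ' lt pQ'.
by rewrite size_cat /=; lia.
Qed.

Lemma gap_backward Q' O' t :
  block e Q' -> last z Q' = last z Q -> perm_eq (Q' ++ O') (Q ++ O) ->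
  t \in G -> ~~ e t (head z Q').
Proof.
move=> bQ' lQ' pQ' tG; apply/negP=> lt; move: exc minG.
case/splitPr: tG => G1 G2 exc' min'.
have /min' := excursion_backward exc' bQ' lQ' lt pQ'.
by rewrite size_cat /=; lia.
Qed.

(** Cutting [Q] at [x] gives a prefix that could return at [t] and a suffix that [t] could enter;
    either would shorten [G]. *)
Lemma QG_nonadjacent x t : x \in Q -> t \in G -> ~~ e x t /\ ~~ e t x.
Proof.
move=> xQ tG; case: exc => _ _ _ [_ bQ _ _].
have [q1 [q2 eQ]] : exists q1 q2, Q = q1 ++ x :: q2.
  by case/splitPr: xQ => q1 q2; exists q1, q2.
have b1 : block e (rcons q1 x).
  by move: bQ; rewrite eQ -cat_rcons => /block_prefix; apply; case: (q1).
have b2 : block e (x :: q2) by move: bQ; rewrite eQ => /block_suffix; apply.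
split.
  have := @gap_forward _ (q2 ++ O) t b1; rewrite last_rcons; apply => //.
    by rewrite eQ; case: (q1).
  by rewrite eQ -cat_rcons -catA.
have := @gap_backward _ (q1 ++ O) t b2; apply => //.
  by rewrite eQ last_cat.
by rewrite eQ -catA perm_catCA.
Qed.

(** A vertex [w] of [Q] is not adjacent to [t]. For [w] in [O], either a prefix of [Q] extended by
    [w] would return at [t], or [t] would enter a suffix of [Q] through [w], and [G] would
    shrink. *)
Lemma gap_two_paths x t w : x \in Q -> t \in G -> w \in Q ++ O ->
  e x w + e w t <= 1 /\ e t w + e w x <= 1.
Proof.
move=> xQ tG; case: exc => _ _ _ [_ bQ _ _].
rewrite mem_cat => /orP[wQ|wO].
  have [/negbTE -> /negbTE ->] := QG_nonadjacent wQ tG.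
  by rewrite addn0 add0n !leq_b1.
have [q1 [q2 eQ]] : exists q1 q2, Q = q1 ++ x :: q2.
  by case/splitPr: xQ => q1 q2; exists q1, q2.
have b1 : block e (rcons q1 x).
  by move: bQ; rewrite eQ -cat_rcons => /block_prefix; apply; case: (q1).
have b2 : block e (x :: q2) by move: bQ; rewrite eQ => /block_suffix; apply.
split.
  have [xw|//] := boolP (e x w); last by rewrite add0n leq_b1.
  have := @gap_forward (rcons (rcons q1 x) w) (q2 ++ rem w O) t.
  rewrite last_rcons => /(_ _ _ _ tG)/negbTE -> //.
  - by rewrite rcons_block_path // last_rcons.
  - by rewrite eQ; case: (q1).
  - rewrite eQ; apply/permP=> p; have := permP (perm_to_rem wO) p.
    by rewrite -!cats1 !count_cat /= => ->; clia.
have [wx|//] := boolP (e w x); last by rewrite addn0 leq_b1.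
have := @gap_backward (w :: x :: q2) (q1 ++ rem w O) t.
move=> /(_ _ _ _ tG)/negbTE -> //.
- by move: b2; rewrite /block /= wx.
- by rewrite eQ last_cat.
- rewrite eQ; apply/permP=> p; have := permP (perm_to_rem wO) p.
  by rewrite !count_cat /= => ->; clia.
Qed.

(** The bound adds up these estimates: no arcs between [x] and [G]; at most [size W + 1] between [x]
    and [W], since [x] cannot enlarge the longest cycle; at most [size W' + 1] between [t] and [W'],
    by maximal insertion; at most [2 * size T - 2] between [t] and [T]; and [2 * size (Q ++ O) - 2]
    for [x] and [t] together on [Q ++ O]. If [T] were empty, [W' ++ Q] would be longer than [S]. *)
Lemma gap_degree_bound : exists W' T,
  [/\ block e W', head z W' = head z W, last z W' = last z W,
      perm_eq (W' ++ T) (W ++ G)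
    & [/\ {subset T <= G}, T != [::] & forall x t, x \in Q -> t \in T ->
       degin e x U + degin e t U + size G + 2 <= 2 * size U + size T]].
Proof.
case: (exc) => pS cyc pU [bW bQ WQ QW].
have [W' [T [bW' hW' lW' pW' [TG maxT]]]] := maximal_insertion z G bW.
exists W', T; split=> //; split=> //.
  apply/eqP=> T0; move: pW'; rewrite T0 cats0 => pW'.
  have szW' := perm_sizeV pW'.
  have pSQ : perm_eq (W' ++ Q ++ O) U.
    apply: perm_trans pU; apply/permP=> p; have := permP pW' p.
    by rewrite !count_cat; clia.
  have := @longestS (W' ++ Q); rewrite (cycle_block z) // hW' lW'.
  rewrite -(cats1 Q) (path_block z) //= WQ QW.
  have u1 : uniq ((W' ++ Q) ++ O) by rewrite -catA (perm_uniq pSQ).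
  move=> /(_ isT); rewrite cat_uniq in u1; case/andP: u1 => -> _ /(_ isT).
  have sub : {subset W' ++ Q <= U}.
    by move=> w; rewrite -(perm_mem pSQ) catA => wc; rewrite mem_cat wc.
  move=> /(_ sub); rewrite -(perm_sizeV pS) !size_cat in szW' *.
  by case: (Q) bQ => // a q _ /=; clear -szW'; move=> *; lia.
move=> x t xQ tT; have tG := TG t tT.
have [/negbTE xt /negbTE tx] := QG_nonadjacent xQ tG.
have xOut : x \in Q ++ O by rewrite mem_cat xQ.
have dOut : degin e x (Q ++ O) + degin e t (Q ++ O) + 2 <= 2 * size (Q ++ O).
  rewrite !(degin_perm e _ (perm_to_rem xOut)) !degin_cons xt tx !irr.
  have := @degin_pair _ e x t (rem x (Q ++ O)).
  move=> /(_ (fun w hw => gap_two_paths xQ tG (mem_rem hw))).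
  rewrite size_remV //; have : 0 < size (Q ++ O) by case: (Q ++ O) xOut.
  by clia.
have dxG : degin e x G = 0.
  by apply: degin_nonadj => y yG; apply: QG_nonadjacent.
have dxW : degin e x W <= size W + 1.
  rewrite leqNgt; apply/negP=> lt.
  have [W1 [bW1 hW1 lW1 pW1]] := insert_block_deg z bW lt.
  have p1 : perm_eq (W1 ++ G ++ rem x (Q ++ O)) U.
    apply: perm_trans pU; apply/permP=> p; have := permP pW1 p.
    by have := permP (perm_to_rem xOut) p; rewrite !count_cat /=; clia.
  have := @longestS (W1 ++ G); rewrite (cycle_block z) // hW1 lW1.
  rewrite -(cycle_block z) // -(rot_cycle (size W)) rot_size_cat cyc => /(_ isT).
  have u1 : uniq ((W1 ++ G) ++ rem x (Q ++ O)) by rewrite -catA (perm_uniq p1).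
  rewrite cat_uniq in u1; case/andP: u1 => -> _ /(_ isT).
  have sub : {subset W1 ++ G <= U}.
    by move=> w; rewrite -(perm_mem p1) catA => wc; rewrite mem_cat wc.
  move=> /(_ sub); by rewrite -(perm_sizeV pS) !size_cat (perm_sizeV pW1) /=; clia.
have dtW := maxT t tT.
have dtT := degin_irr irr tT.
have eU v : degin e v U = degin e v W' + degin e v T + degin e v (Q ++ O).
  rewrite -!degin_cat; apply: degin_perm; rewrite perm_sym; apply: perm_trans pU.
  by apply/permP=> p; have := permP pW' p; rewrite !count_cat; clia.
have eUx : degin e x U = degin e x G + degin e x W + degin e x (Q ++ O).
  by rewrite -!degin_cat; apply: degin_perm; rewrite perm_sym -catA.
have szU := perm_sizeV pU; have szW := perm_sizeV pW'.
rewrite eUx eU; rewrite !size_cat in szU szW dOut.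
by clear -dOut dxG dxW dtW dtT szU szW; lia.
Qed.

End Minimal.

Lemma bondy_thomassen : exists G W Q O W' T,
  [/\ excursion G W Q O, block e W', head z W' = head z W, last z W' = last z W
    & [/\ perm_eq (W' ++ T) (W ++ G), {subset T <= G}, T != [::]
       & forall x t, x \in Q -> t \in T ->
         degin e x U + degin e t U + size G + 2 <= 2 * size U + size T]].
Proof.
pose P g := exists G W Q O, size G = g /\ excursion G W Q O.
have [|g [[G [W [Q [O [<- exc]]]]] minG]] := @ex_minimal P.
  by have [G [W [Q [O exc]]]] := excursion_exists; exists (size G), G, W, Q, O.
have [|W' [T [bW' hW' lW' pW' [TG T0 bnd]]]] := gap_degree_bound exc.
  by move=> G1 W1 Q1 O1 exc1; apply: minG; exists G1, W1, Q1, O1.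
by exists G, W, Q, O, W', T.
Qed.

End BondyThomassen.

(** * Cycles of a counterexample *)

Definition nverts (V : finType) : nat := #|V|.

(* Deleting [a] leaves no set of vertices without leaving arcs. *)
Definition two_strong (V : finType) (e : rel V) : Prop :=
  forall (a : V) (X : pred V), (exists2 x, X x & x != a) ->
    (exists2 y, ~~ X y & y != a) ->
  exists x y, [/\ X x, ~~ X y, x != a, y != a & e x y].

(* [z] stands for the contraction of [u] and [v]; the bound on its degree is lower. *)
Record counterexample (V : finType) (e : rel V) (z : V) (k : nat) : Prop := {
  ce_irr : irreflexive e;
  ce_cut : two_strong e;
  ce_deg : forall x, x != z -> nverts V + k <= degin e x (enum V);
  ce_degz : nverts V <= degin e z (enum V) + k + 4;
  ce_size : 9 <= nverts V;
  ce_nonham : forall c, cycle e c -> perm_eq c (enum V) -> False }.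

Section Counterexample.

Variables (V : finType) (e : rel V) (z : V) (k : nat).
Hypothesis ce : counterexample e z k.
Let irr := ce_irr ce.

Lemma size_enum : size (enum V) = nverts V.
Proof. by rewrite /nverts cardE. Qed.

(** As [z] stays on the cycle, each missing vertex has the large degree. If at most [k + 1] are
    missing, one of them has at most [2 * (size M - 1)] arcs inside [M], hence more than [size c] to
    the cycle, and is inserted; repeating this ends in a Hamiltonian cycle. *)
Lemma missing_many c M : cycle e c -> z \in c -> perm_eq (c ++ M) (enum V) ->
  k + 2 <= size M.
Proof.
have [m] := ubnP (size M); elim: m c M => // m IHm c M lt_M cyc zc pM.
case: M => [|t M] in lt_M pM *.
  by case: (ce_nonham ce cyc); rewrite cats0 in pM.
rewrite leqNgt; apply/negP=> lt.
have uM : uniq (c ++ t :: M) by rewrite (perm_uniq pM) enum_uniq.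
have tz : t != z.
  apply/eqP=> tz; move: uM; rewrite tz cat_uniq => /and3P[_ /hasPn/(_ z)].
  by rewrite mem_head zc => /(_ isT).
have := ce_deg ce tz; rewrite -(degin_perm e t pM) degin_cat => dt.
have dM : degin e t (t :: M) + 2 <= 2 * size (t :: M).
  by apply: (degin_irr irr); rewrite mem_head.
have szM := perm_sizeV pM; rewrite size_cat size_enum in szM.
have [|c' [cyc' pc']] := @insert_cycle V e t c cyc; first by clear -dt dM szM lt; lia.
have := IHm c' M; rewrite (perm_mem pc') inE zc orbT; move=> /(_ lt_M cyc' isT).
have -> : perm_eq (c' ++ M) (enum V).
  apply: perm_trans pM; apply/permP=> p; have := permP pc' p.
  by rewrite !count_cat /=; lia.
by move=> /(_ isT); move: lt; rewrite /=; clia.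
Qed.

Definition longest_cycle (S : seq V) : Prop :=
  [/\ cycle e S, uniq S, S != [::] & forall c, cycle e c -> uniq c -> size c <= size S].

Lemma uniq_size_le (s : seq V) : uniq s -> size s <= nverts V.
Proof.
by move=> us; rewrite -size_enum uniq_leq_size // => x _; rewrite mem_enum.
Qed.

(** A nonempty cycle is needed to start: a vertex other than [z] has degree at least the number of
    vertices, so it forms a cycle of length two with some neighbour. *)
Lemma longest_cycle_exists : exists S, longest_cycle S.
Proof.
have [c0 [cyc0 u0 n0]] : exists c, [/\ cycle e c, uniq c & c != [::]].
  have [x xz] : exists x, x != z.
    have [/hasP[x _ xz]|/hasPn allz] := boolP (has (predC1 z) (enum V)); first by exists x.
    have : size (enum V) <= size [:: z].
      by rewrite uniq_leq_size ?enum_uniq // => x /allz /negPn; rewrite inE.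
    by have := ce_size ce; rewrite size_enum /=; clia.
  have [/hasP[y _ /andP[xy yx]]|/hasPn nox] := boolP (has (fun y => e x y && e y x) (enum V)).
    exists [:: x; y]; rewrite /= xy yx !inE !andbT; split=> //.
    by apply/eqP=> exy; move: xy; rewrite exy (irr y).
  have := ce_deg ce xz.
  have xV : x \in enum V by rewrite mem_enum.
  have bnd (s : seq V) : (forall y, y \in s -> ~~ (e x y && e y x)) -> degin e x s <= size s.
    elim: s => // y s IHs hs; rewrite degin_cons /=.
    have := hs y (mem_head _ _); have /IHs : forall w, w \in s -> ~~ (e x w && e w x).
      by move=> w ws; apply: hs; rewrite inE ws orbT.
    by case: (e x y); case: (e y x) => //=; clia.
  rewrite (degin_perm _ _ (perm_to_rem xV)) degin_cons !irr.
  have := bnd (rem x (enum V)) (fun y hy => nox y (mem_rem hy)).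
  by rewrite size_remV // size_enum; have := ce_size ce; clia.
have [|m [[S [cyc uS nS szS]] maxS]] := @ex_minimal (fun m => exists c,
    [/\ cycle e c, uniq c, c != [::] & size c + m = nverts V]).
  by exists (nverts V - size c0), c0; split=> //; rewrite subnKC // uniq_size_le.
exists S; split=> // c cyc1 uc; have [->//|c1] := eqVneq c [::].
have le_c := uniq_size_le uc.
have le_m : m <= nverts V - size c by apply: maxS; exists c; split=> //; rewrite subnKC.
by move: szS le_m le_c; clia.
Qed.

(** If [z] is on a longest cycle, it is not on [Q], and a vertex of [T] other than [z] would bring
    two large degrees into the bound of [bondy_thomassen]. So [T] is [z] alone, and [W' ++ Q] avoids
    [z] without being shorter. *)
Lemma longest_cycle_avoiding : exists2 S, longest_cycle S & z \notin S.
Proof.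
have [S longS] := longest_cycle_exists; case: (longS) => cyc uS nS maxS.
have [zS|] := boolP (z \in S); last by exists S.
have ltS : size S < size (enum V).
  rewrite size_enum ltn_neqAle uniq_size_le // andbT; apply/eqP=> szS.
  apply: (ce_nonham ce cyc); apply: uniq_perm; rewrite ?enum_uniq //.
  have [] := uniq_min_size uS (_ : {subset S <= enum V}) _.
  - by move=> x _; rewrite mem_enum.
  - by rewrite size_enum szS.
  - by [].
have [|||G [W [Q [O [W' [T [exc bW' hW' lW' [pW' TG T0 bnd]]]]]]]] :=
  @bondy_thomassen V e irr z (enum V) S (enum_uniq _) cyc uS nS _ ltS.
- by move=> x _; rewrite mem_enum.
- move=> X [x _ Xx] [y _ Xy].
  have [a /andP[xa ya]] : exists a, (x != a) && (y != a).
    have [/hasP[a _ h]|/hasPn none] := boolP (has (fun a => (x != a) && (y != a)) (enum V)).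
      by exists a.
    have : size (enum V) <= size [:: x; y].
      rewrite uniq_leq_size ?enum_uniq // => w /none.
      by rewrite negb_and !negbK !inE ![w == _]eq_sym.
    by have := ce_size ce; rewrite size_enum /=; clia.
  have [|| x' [y' [Xx' Xy' _ _ xy]]] := ce_cut ce (a := a) (X := X).
  - by exists x.
  - by exists y.
  - by exists x', y'; rewrite !mem_enum.
- by move=> c cc uc _; apply: maxS.
case: exc => pS cycGW pU [bW bQ WQ QW].
have uU : uniq (G ++ W ++ Q ++ O) by rewrite (perm_uniq pU) enum_uniq.
have uWT : uniq (W' ++ T).
  rewrite (perm_uniq pW') uniq_catC.
  by move: uU; rewrite catA; apply: uniq_catl.
have uT : uniq T by apply: uniq_catr uWT.
have leTG : size T <= size G by rewrite uniq_leq_size.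
have [q0 q0Q] : exists q0, q0 \in Q by case: (Q) bQ => // q0 ? _; exists q0; rewrite mem_head.
have QS x : x \in Q -> x \notin S.
  move=> xQ; rewrite -(perm_mem pS); move: uU; rewrite catA cat_uniq => /and3P[_ /hasPn h _].
  by apply: h; rewrite mem_cat xQ.
have Tz t : t \in T -> t = z.
  move=> tT; apply/eqP/negPn/negP=> tz; have := bnd _ _ q0Q tT.
  have q0z : q0 != z by apply: contraNneq (QS _ q0Q) => ->.
  have := ce_deg ce tz; have := ce_deg ce q0z; rewrite size_enum.
  by move: leTG; clia.
have eT : T = [:: z].
  case: (T) T0 uT Tz => // t [|t' T1] _ /=; first by move=> _ /(_ t (mem_head _ _)) ->.
  move=> /andP[tT1 _] Tz'; move: tT1; rewrite inE (Tz' t (mem_head _ _)).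
  by rewrite (Tz' t') ?eqxx // !inE eqxx orbT.
have pA : perm_eq (z :: (W' ++ Q) ++ O) (enum V).
  apply: perm_trans pU; apply/permP=> p; have := permP pW' p.
  by rewrite eT /= !count_cat /=; clia.
have uA : uniq (z :: (W' ++ Q) ++ O) by rewrite (perm_uniq pA) enum_uniq.
have cycA : cycle e (W' ++ Q).
  by rewrite (cycle_block z) // hW' lW' -cats1 (path_block z) //= WQ QW.
have uWQ : uniq (W' ++ Q) by move: uA; rewrite /= cat_uniq => /and4P[].
have szA := maxS _ cycA uWQ.
have szW := perm_sizeV pW'; have szS := perm_sizeV pS.
exists (W' ++ Q).
  split=> //; first by case: (W') bW'.
  move=> c cc uc; apply: leq_trans (maxS c cc uc) _.
  have : 0 < size Q by case: (Q) bQ.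
  by move: szW szS; rewrite eT !size_cat /=; clia.
by move: uA; rewrite /= mem_cat => /andP[/norP[]].
Qed.

(** Without [z], degrees drop by the arcs to [z]. If the longest cycle missed a vertex, the bound of
    [bondy_thomassen] would force [size T = size G] and all four arcs between [z] and the vertices
    [x], [t]; then [head z Q], [z], [G], [W] form a longer cycle. *)
Lemma hamiltonian_avoiding : exists2 C, cycle e C & perm_eq (z :: C) (enum V).
Proof.
have [S [cyc uS nS maxS] zS] := longest_cycle_avoiding.
have zV : z \in enum V by rewrite mem_enum.
set U := rem z (enum V).
have uU : uniq U by rewrite rem_uniq ?enum_uniq.
have memU x : (x \in U) = (x != z).
  by rewrite mem_rem_uniq ?enum_uniq // inE mem_enum andbT.
have SU : {subset S <= U}.
  by move=> x xS; rewrite memU; apply: contraNneq zS => <-.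
have szU : size U = (nverts V).-1 by rewrite size_remV // size_enum.
have leS : size S <= size U by rewrite uniq_leq_size.
have [ltS|geS] := ltnP (size S) (size U); last first.
  exists S => //; rewrite perm_sym; apply: perm_trans (perm_to_rem zV) _.
  rewrite perm_cons perm_sym; apply: uniq_perm => //.
  by have [_] := uniq_min_size uS SU geS.
have [|| G [W [Q [O [W' [T [exc bW' hW' lW' [pW' TG T0 bnd]]]]]]]] :=
  @bondy_thomassen V e irr z U S uU cyc uS nS SU ltS.
- move=> X [x xU Xx] [y yU Xy].
  have [|| x' [y' [Xx' Xy' x'z y'z xy]]] := ce_cut ce (a := z) (X := X).
  - by exists x; rewrite // -memU.
  - by exists y; rewrite // -memU.
  - by exists x', y'; rewrite !memU.
- by move=> c cc uc _; apply: maxS.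
case: exc => pS cycGW pU [bW bQ WQ QW].
have uA : uniq (G ++ W ++ Q ++ O) by rewrite (perm_uniq pU).
have uT : uniq T.
  have : uniq (W' ++ T).
    rewrite (perm_uniq pW') uniq_catC.
    by move: uA; rewrite catA; apply: uniq_catl.
  exact: uniq_catr.
have leTG : size T <= size G by rewrite uniq_leq_size.
have GU : {subset G <= U} by move=> x xG; rewrite -(perm_mem pU) mem_cat xG.
have QU : {subset Q <= U} by move=> x xG; rewrite -(perm_mem pU) !mem_cat xG !orbT.
have degU x : x \in U -> nverts V + k <= degin e x U + e x z + e z x.
  rewrite memU => xz; have := ce_deg ce xz.
  by rewrite (degin_perm _ _ (perm_to_rem zV)) degin_cons -/U; clia.
have key x t : x \in Q -> t \in T -> [/\ size T = size G, e x z & e z t].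
  move=> xQ tT; have := bnd _ _ xQ tT; have := degU _ (QU _ xQ).
  have := degU _ (GU _ (TG _ tT)); rewrite szU; have := ce_size ce; move: leTG.
  move=> h1 h2 h3 h4 h5.
  move: h1 h2 h3 h4 h5; move: nverts V (degin e x U) (degin e t U) (size T) (size G).
  move: (e x z) (e z x) (e z t) (e t z); clear.
  by move=> [] [] [] [] * /=; split=> //; lia.
have [t0 t0T] : exists t0, t0 \in T by case: (T) T0 => // t0 ? _; exists t0; rewrite mem_head.
have hQ : head z Q \in Q by case: (Q) bQ => // ? ? _; rewrite mem_head.
have [szT xz _] := key _ _ hQ t0T.
have [_ memT] := uniq_min_size uT TG (eq_leq (esym szT)).
have G0 : G != [::] by apply/eqP=> G0; move: (TG _ t0T); rewrite G0.
have hG : head z G \in T by rewrite memT; case: (G) G0 => // ? ? _; rewrite mem_head.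
have [_ _ zt] := key _ _ hQ hG.
have := maxS ([:: head z Q; z] ++ G ++ W); rewrite catA.
have bG : block e G by apply: cycle_blockl cycGW G0.
have -> : cycle e (([:: head z Q; z] ++ G) ++ W).
  rewrite -catA /= xz rcons_cat (path_block z _ _ bG) zt /= -cats1.
  rewrite (path_block z _ _ bW) /= WQ andbT.
  by move: cycGW; rewrite (cycle_block z _ bG) -cats1 (path_block z _ _ bW) andbT => /andP[].
have uz : uniq (z :: G ++ W ++ Q ++ O).
  rewrite /= uA andbT; apply/negP; rewrite (perm_mem pU) memU eqxx //.
rewrite -[_ ++ W]/(head z Q :: z :: G ++ W) cons_uniq.
have -> : uniq (z :: G ++ W) by move: uz; rewrite catA -cat_cons; apply: uniq_catl.
have -> : head z Q \notin z :: G ++ W.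
  move: uz; rewrite catA -cat_cons cat_uniq => /and3P[_ /hasPn h _].
  by apply: h; rewrite mem_cat hQ.
by move=> /(_ isT isT); rewrite /= -(perm_sizeV pS); clia.
Qed.

End Counterexample.

(** * The extremal configuration *)

Lemma counterexample_rev (V : finType) (e : rel V) (z : V) (k : nat) :
  counterexample e z k -> counterexample (fun x y => e y x) z k.
Proof.
move=> ce; have degr x s : degin (fun x y => e y x) x s = degin e x s.
  by rewrite /degin addnC.
split.
- exact: ce_irr ce.
- move=> a X [x Xx xa] [y Xy ya].
  have [|| x' [y' [Xx' /negPn Xy' x'a y'a xy]]] := ce_cut ce (a := a) (X := fun w => ~~ X w).
  + by exists y.
  + by exists x; rewrite ?negbK.
  + by exists y', x'.
- by move=> x xz; rewrite degr; apply: (ce_deg ce).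
- by rewrite degr; apply: (ce_degz ce).
- exact: ce_size ce.
- move=> c; rewrite -rev_cycle => cyc pc; apply: (ce_nonham ce cyc).
  by rewrite perm_rev.
Qed.

Section Segments.

Variables (V : finType) (e : rel V) (z : V) (P : seq V).

Definition seg i j : seq V := drop i (take j P).

Lemma size_seg i j : j <= size P -> size (seg i j) = j - i.
Proof. by move=> jN; rewrite size_drop size_takel. Qed.

Lemma seg_cat i j l : i <= j -> j <= l -> l <= size P -> seg i j ++ seg j l = seg i l.
Proof.
move=> ij jl lN; rewrite /seg -[in RHS](cat_take_drop j (take l P)) take_takel //.
rewrite drop_cat size_takel ?(leq_trans jl) //; case: ltngtP ij => // -> _.
by rewrite subnn drop0 drop_oversize ?size_takel // (leq_trans jl).
Qed.

Lemma seg_full : seg 0 (size P) = P.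
Proof. by rewrite /seg take_size drop0. Qed.

Lemma seg_neq0 i j : i < j -> j <= size P -> seg i j != [::].
Proof. by move=> ij jN; rewrite -size_eq0 size_seg //; alia. Qed.

Lemma nth_seg i j s : s < j - i -> j <= size P -> nth z (seg i j) s = nth z P (i + s).
Proof. by move=> sj jN; rewrite nth_drop nth_take //; alia. Qed.

Lemma head_seg i j : i < j -> j <= size P -> head z (seg i j) = nth z P i.
Proof. by move=> ij jN; rewrite -nth0 nth_seg ?addn0 //; alia. Qed.

Lemma last_seg i j : i < j -> j <= size P -> last z (seg i j) = nth z P j.-1.
Proof.
move=> ij jN; rewrite -nth_last size_seg // nth_seg //; last by alia.
by congr nth; alia.
Qed.

Lemma block_seg i j : sorted e P -> i < j -> j <= size P -> block e (seg i j).
Proof.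
move=> sP ij jN; rewrite /block seg_neq0 //=.
have : sorted e (take j P).
  by move: sP; rewrite -{1}(cat_take_drop j P) => /cat_sorted2[].
by rewrite /seg -{1}(cat_take_drop i (take j P)) => /cat_sorted2[].
Qed.

Lemma seg1 i : i < size P -> seg i i.+1 = [:: nth z P i].
Proof.
move=> iN; rewrite /seg (take_nth z) // -cats1 drop_size_cat // size_takel //.
exact: ltnW.
Qed.

Lemma mem_seg i j s : i <= s -> s < j -> j <= size P -> nth z P s \in seg i j.
Proof.
move=> si sj jN; have -> : nth z P s = nth z (seg i j) (s - i).
  by rewrite nth_seg //; [congr nth|]; alia.
by rewrite mem_nth // size_seg //; alia.
Qed.

End Segments.

(* The gap [R] is a shortest segment bypassed by [z] in a Hamiltonian cycle
   avoiding [z]. *)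
Record config (V : finType) (e : rel V) (z : V) (P R : seq V) : Prop := {
  cf_perm : perm_eq (z :: P ++ R) (enum V);
  cf_cycle : cycle e (P ++ R);
  cf_cyclez : cycle e (z :: P);
  cf_min : forall W G, perm_eq (z :: W ++ G) (enum V) -> cycle e (W ++ G) ->
     cycle e (z :: W) -> size R <= size G }.

Lemma config_rev (V : finType) (e : rel V) (z : V) (P R : seq V) :
  config e z P R -> config (fun x y => e y x) z (rev P) (rev R).
Proof.
have cycz (f : rel V) W : cycle f (z :: W) = cycle f (rcons W z).
  by rewrite -rot1_cons rot_cycle.
have cyc2 (f : rel V) (A B : seq V) : cycle f (A ++ B) = cycle f (B ++ A).
  by rewrite -rot_size_cat rot_cycle.
move=> cf; split.
- apply: perm_trans (cf_perm cf).
  by rewrite perm_cons; apply/permP=> p; rewrite !count_cat !count_rev.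
- by rewrite cyc2 -rev_cat rev_cycle; apply: (cf_cycle cf).
- by rewrite cycz -rev_cons rev_cycle; apply: (cf_cyclez cf).
move=> W G pWG cWG cW; rewrite size_rev -(size_rev G).
apply: (@cf_min _ _ _ _ _ cf (rev W)).
- apply: perm_trans pWG.
  by rewrite perm_cons; apply/permP=> p; rewrite !count_cat !count_rev.
- by rewrite cyc2 -rev_cat rev_cycle.
- by rewrite cycz -rev_cons rev_cycle.
Qed.

(** By 2-strongness [z] has an out-neighbour [b] and an in-neighbour [a]; the Hamiltonian cycle
    avoiding [z], read from [b] and cut after [a], is a candidate, and one with shortest gap is
    chosen. *)
Lemma config_exists (V : finType) (e : rel V) (z : V) (k : nat) :
  counterexample e z k -> exists P R, config e z P R.
Proof.
move=> ce; have irr := ce_irr ce.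
have [C cycC pC] := hamiltonian_avoiding ce.
have other : exists w, w != z.
  have [/hasP[x _ xz]|/hasPn allz] := boolP (has (predC1 z) (enum V)); first by exists x.
  have : size (enum V) <= size [:: z].
    by rewrite uniq_leq_size ?enum_uniq // => x /allz /negPn; rewrite inE.
  by have := ce_size ce; rewrite size_enum /=; clia.
have [w wz] := other.
have [b [zb bz]] : exists b, e z b /\ b != z.
  have [u /andP[uz uw]] : exists u, (u != z) && (u != w).
    have [/hasP[u _ h]|/hasPn none] :=
      boolP (has (fun u => (u != z) && (u != w)) (enum V)); first by exists u.
    have : size (enum V) <= size [:: z; w].
      rewrite uniq_leq_size ?enum_uniq // => x /none.
      by rewrite negb_and !negbK !inE.
    by have := ce_size ce; rewrite size_enum /=; clia.
  have [|| x [y [/eqP -> yz _ _ zy]]] := ce_cut ce (a := u) (X := pred1 z).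
  - by exists z; rewrite /= ?eqxx 1?eq_sym.
  - by exists w; rewrite // eq_sym.
  - by exists y.
have [a [az anz]] : exists a, e a z /\ a != z.
  have [u /andP[uz uw]] : exists u, (u != z) && (u != w).
    have [/hasP[u _ h]|/hasPn none] :=
      boolP (has (fun u => (u != z) && (u != w)) (enum V)); first by exists u.
    have : size (enum V) <= size [:: z; w].
      rewrite uniq_leq_size ?enum_uniq // => x /none.
      by rewrite negb_and !negbK !inE.
    by have := ce_size ce; rewrite size_enum /=; clia.
  have [|| x [y [xz /negPn/eqP -> _ _ zy]]] := ce_cut ce (a := u) (X := predC1 z).
  - by exists w; rewrite // eq_sym.
  - by exists z; rewrite /= ?eqxx 1?eq_sym.
  - by exists x.
have inC x : x != z -> x \in C.
  move=> xz; have : x \in z :: C by rewrite (perm_mem pC) mem_enum.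
  by rewrite inE (negPf xz).
have [i C' eC] := rot_to (inC b bz).
have pC' : perm_eq (b :: C') C by rewrite -eC perm_rot.
have [W0 [G eWG]] : exists W0 G, b :: C' = W0 ++ a :: G.
  have : a \in b :: C' by rewrite (perm_mem pC') inC.
  by case/splitPr=> W0 G; exists W0, G.
have base : exists g W G, [/\ size G = g, perm_eq (z :: W ++ G) (enum V),
    cycle e (W ++ G) & cycle e (z :: W)].
  exists (size G), (rcons W0 a), G; rewrite cat_rcons -eWG; split=> //.
  - by apply: perm_trans pC; rewrite perm_cons.
  - by rewrite -eC rot_cycle.
  - have : sorted e (rcons W0 a ++ G).
      by rewrite cat_rcons -eWG /=; move: cycC; rewrite -(rot_cycle i) eC /= rcons_path => /andP[].
    case/cat_sorted2=> sW _; have bW : block e (rcons W0 a).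
      by rewrite /block sW -size_eq0 size_rcons.
    rewrite /= -cats1 (path_block z) // last_rcons /= az !andbT.
    by move: eWG; case: (W0) => [|w0 W1] /= [<-].
have [g [[P' [R' [<- p1 p2 p3]]] minR]] := ex_minimal base.
exists P', R'; split=> // W2 G2 pWG cWG cW.
by apply: minR; exists W2, G2.
Qed.

Section Slots.

Variables (V : finType) (e : rel V) (z : V) (P : seq V).

(* A path [P] of [N] vertices has [N + 1] slots: slot [s] lies just before
   [nth z P s] and just after [nth z P s.-1]. *)
Definition outs (x : V) (s : nat) : bool := (s < size P) && e x (nth z P s).
Definition ins (x : V) (s : nat) : bool := (0 < s <= size P) && e (nth z P s.-1) x.

Lemma degin_outs_ins x :
  degin e x P = count (outs x) (iota 0 (size P).+1) + count (ins x) (iota 0 (size P).+1).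
Proof.
have cnt (a : pred V) : count a P = count (fun s => a (nth z P s)) (iota 0 (size P)).
  by rewrite -{1}(mkseq_nth z P) count_map.
congr addn; rewrite cnt.
  rewrite -addn1 iotaD count_cat /= /outs ltnn !addn0.
  by apply: eq_in_count => s; rewrite mem_iota add0n /= => ->.
rewrite /= -[1]addn0 iotaDl count_map add0n.
by apply: eq_in_count => s; rewrite mem_iota /ins /= add1n => ->.
Qed.

(** Each of the [size P + 1] slots carries at most one arc of [x], and those in [l] carry none. *)
Lemma blanks_le x (l : seq nat) :
  (forall s, outs x s -> ~~ ins x s) -> uniq l ->
  (forall s, s \in l -> [/\ s <= size P, ~~ outs x s & ~~ ins x s]) ->
  degin e x P + size l <= (size P).+1.
Proof.
move=> excl ul bl; rewrite degin_outs_ins.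
have -> : size l = count (mem l) (iota 0 (size P).+1).
  rewrite -size_filter; apply: perm_size; apply: uniq_perm; rewrite ?filter_uniq ?iota_uniq //.
  move=> s; rewrite mem_filter mem_iota /= add0n ltnS.
  by case sl: (s \in l) => //=; have [-> _ _] := bl s sl.
rewrite -[X in _ <= X](size_iota 0); elim: (iota _ _) => //= s t IHt.
suff : outs x s + ins x s + (s \in l) <= 1 by move: IHt; rewrite /=; clia.
case sl : (s \in l); first by have [_ /negPf-> /negPf->] := bl s sl.
by have := excl s; case: (outs x s) => // [/(_ isT)/negPf->|_]; case: (ins x s).
Qed.

Lemma outs_lt x s : outs x s -> s < size P. Proof. by case/andP. Qed.
Lemma ins_gt x s : ins x s -> 0 < s <= size P. Proof. by case/andP. Qed.

End Slots.

(** Reversal maps slot [s] to slot [size P - s] and exchanges in-arcs with out-arcs; mirror cases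
    are reduced through it. *)
Lemma outs_rev (V : finType) (e : rel V) z P x s : s <= size P ->
  outs (fun x y => e y x) z (rev P) x s = ins e z P x (size P - s).
Proof.
move=> sN; rewrite /outs /ins size_rev subn_gt0 leq_subr andbT.
by case: ltnP => //= lt; rewrite nth_rev // subnS.
Qed.

Lemma ins_rev (V : finType) (e : rel V) z P x s : s <= size P ->
  ins (fun x y => e y x) z (rev P) x s = outs e z P x (size P - s).
Proof.
move=> sN; rewrite /outs /ins size_rev sN andbT.
case: s sN => [|s] sN /=; first by rewrite subn0 ltnn.
by rewrite nth_rev // (_ : size P - s.+1 < size P) //; alia.
Qed.

Section Chains.

Variables (V : finType) (e : rel V) (z : V).

Fixpoint chain (x : V) (bs : seq (seq V)) (y : V) : bool :=
  if bs is B :: bs' then e x (head z B) && chain (last z B) bs' y else e x y.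

Lemma path_chain x bs y :
  all (block e) bs -> path e x (rcons (flatten bs) y) = chain x bs y.
Proof.
elim: bs x => [|B bs IHbs] x /=; first by rewrite andbT.
by case/andP=> bB /IHbs IH; rewrite rcons_cat (path_block z _ _ bB) IH.
Qed.

Lemma cycle_chain B bs : block e B -> all (block e) bs ->
  cycle e (B ++ flatten bs) = chain (last z B) bs (head z B).
Proof. by move=> bB bbs; rewrite (cycle_block z _ bB) path_chain. Qed.

End Chains.

Section Config.

Variables (V : finType) (e : rel V) (z : V) (k : nat) (P R : seq V).
Hypothesis ce : counterexample e z k.
Hypothesis cf : config e z P R.

Let irr := ce_irr ce.
Notation N := (size P).
Notation p := (nth z P).
Notation S := (seg P).

Lemma chain_missing bs M : all (block e) bs -> chain e z z bs z ->
  perm_eq (z :: flatten bs ++ M) (enum V) -> k + 2 <= size M.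
Proof.
move=> bbs ch pM; apply: (missing_many ce (c := z :: flatten bs)) => //.
- by rewrite /= (path_chain z).
- by rewrite mem_head.
Qed.

(** The working form of [cf_min]: the blocks [B :: bs] close through [z], and they also close
    without [z] once [gs] is appended, so [gs] competes with [R] as a gap. *)
Lemma chain_minimal B bs gs : block e B -> all (block e) (bs ++ gs) ->
  chain e z z (B :: bs) z -> chain e z (last z B) (bs ++ gs) (head z B) ->
  perm_eq (z :: B ++ flatten (bs ++ gs)) (enum V) -> size R <= size (flatten gs).
Proof.
move=> bB bbg ch chG pV; apply: (cf_min cf (W := B ++ flatten bs)).
- by rewrite -catA -flatten_cat.
- by rewrite -catA -flatten_cat (cycle_chain z).
- rewrite /= -[B ++ _]/(flatten (B :: bs)) (path_chain z) //= bB.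
  by move: bbg; rewrite all_cat => /andP[].
Qed.

Lemma size_config : nverts V = N + size R + 1.
Proof.
have : size (z :: P ++ R) = size (enum V) by apply: perm_size (cf_perm cf).
rewrite /= size_cat size_enum; clia.
Qed.

Lemma uniq_config : uniq (z :: P ++ R).
Proof. by rewrite (perm_uniq (cf_perm cf)) enum_uniq. Qed.

Lemma P_neq0 : P != [::].
Proof.
apply/eqP=> P0; have := cf_cyclez cf; rewrite P0 /= andbT.
by rewrite irr.
Qed.

Lemma R_large : k + 2 <= size R.
Proof.
apply: (missing_many ce (cf_cyclez cf)); first by rewrite mem_head.
exact: cf_perm cf.
Qed.

Lemma R_neq0 : R != [::].
Proof. by have := R_large; case: (R); rewrite //= addn2. Qed.

Lemma block_P : block e P.
Proof. exact: cycle_blockl (cf_cycle cf) P_neq0. Qed.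

Lemma block_R : block e R.
Proof. exact: cycle_blockr (cf_cycle cf) R_neq0. Qed.

Lemma sorted_P : sorted e P. Proof. by case/andP: block_P. Qed.

Lemma N_gt0 : 0 < N. Proof. by rewrite lt0n size_eq0 P_neq0. Qed.

Lemma head_P : head z P = p 0. Proof. by rewrite nth0. Qed.
Lemma last_P : last z P = p N.-1. Proof. by rewrite nth_last. Qed.

Lemma zP0 : e z (p 0) /\ e (p N.-1) z.
Proof.
have := cf_cyclez cf; rewrite /= -cats1 (path_block z _ _ block_P) /= andbT.
by rewrite head_P last_P => /andP[].
Qed.

Lemma PR_links : e (p N.-1) (head z R) /\ e (last z R) (p 0).
Proof.
have := cf_cycle cf; rewrite (cycle_block z _ block_P) -cats1.
by rewrite (path_block z _ _ block_R) /= andbT head_P last_P => /andP[].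
Qed.

Lemma path_P i : i.+1 < N -> e (p i) (p i.+1).
Proof. by move=> iN; have /sortedP-> := sorted_P. Qed.

Lemma bseg i j : i < j -> j <= N -> block e (S i j).
Proof. exact: block_seg sorted_P. Qed.

Lemma count_seg (q : pred V) i j l : i <= j -> j <= l -> l <= N ->
  count q (S i j) + count q (S j l) = count q (S i l).
Proof. by move=> ij jl lN; rewrite -count_cat seg_cat. Qed.

Lemma count_config (q : pred V) : count q (enum V) = q z + (count q (S 0 N) + count q R).
Proof. by rewrite -(permP (cf_perm cf)) /= count_cat seg_full. Qed.

Lemma mem_P i : i < N -> p i \in P. Proof. exact: mem_nth. Qed.

Lemma z_notin_P : z \notin P.
Proof. by have := uniq_config; rewrite /= mem_cat negb_or => /andP[/andP[]]. Qed.

Lemma z_notin_R : z \notin R.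
Proof. by have := uniq_config; rewrite /= mem_cat negb_or => /andP[/andP[]]. Qed.

Lemma uniq_P : uniq P. Proof. by have /andP[_ /uniq_catl] := uniq_config. Qed.
Lemma uniq_R : uniq R. Proof. by have /andP[_ /uniq_catr] := uniq_config. Qed.

Lemma PR_disj x : x \in R -> x \notin P.
Proof.
by have := uniq_config; rewrite /= cat_uniq => /and4P[_ _ /hasPn h _] /h.
Qed.

Lemma R_neq_z y : y \in R -> y != z.
Proof. by move=> yR; apply: contraNneq z_notin_R => <-. Qed.

Lemma p_neq_z i : i < N -> p i != z.
Proof. by move=> iN; apply: contraNneq z_notin_P => <-; apply: mem_nth. Qed.

(** An arc from [z] to [y] would let the cycle through [z] absorb the part of [R] from [y] on, an
    arc from [y] to [z] the part up to [y]; the remaining gap would be shorter. *)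
Lemma z_nonadjacent y : y \in R -> ~~ e z y /\ ~~ e y z.
Proof.
move=> yR; have [R1 [R2 eR]] : exists R1 R2, R = R1 ++ y :: R2.
  by case/splitPr: yR => R1 R2; exists R1, R2.
have bR := block_R; rewrite eR in bR; have bP := block_P.
have [zp pz] := zP0; have [pR Rp] := PR_links.
split; apply/negP=> zy.
  have b2 : block e (y :: R2) by apply: block_suffix bR _.
  have : size R <= size R1.
    apply: (cf_min cf (W := (y :: R2) ++ P)).
    - apply: perm_trans (cf_perm cf); rewrite perm_cons eR.
      by apply/permP=> q; rewrite /= !count_cat /=; clia.
    - have := cf_cycle cf; rewrite eR -(rot_cycle (size (P ++ R1))) catA rot_size_cat.
      by rewrite catA.
    - rewrite /= zy /= rcons_cat -cats1.
      move: b2; rewrite /block /= cat_path => -> /=.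
      rewrite (path_block z _ _ bP) head_P last_P /= pz !andbT.
      by move: Rp; rewrite eR last_cat.
  by rewrite eR size_cat /=; clia.
have b1 : block e (rcons R1 y).
  by move: bR; rewrite -cat_rcons => /block_prefix; apply; case: (R1).
have : size R <= size R2.
  apply: (cf_min cf (W := P ++ rcons R1 y)).
  - apply: perm_trans (cf_perm cf); rewrite perm_cons eR.
    by apply/permP=> q; rewrite -cats1 /= !count_cat /=; clia.
  - by have := cf_cycle cf; rewrite eR -cat_rcons catA.
  - rewrite /= -cats1 -catA (path_block z _ _ bP) (path_block z _ _ b1) /= last_rcons zy.
    rewrite head_P zp last_P /= !andbT.
    by move: pR; rewrite eR; case: (R1).
by rewrite eR size_cat /=; clia.
Qed.

End Config.

(** * Nearly closed cycles through [z] *)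

Lemma closest_switch (I O : pred nat) a b :
  I a -> O b -> a < b -> (forall s, a < s < b -> O s -> ~~ I s) ->
  exists c d, [/\ a <= c, c < d, d <= b, I c & O d /\
    forall s, c < s < d -> ~~ I s /\ ~~ O s].
Proof.
have [m] := ubnP (b - a); elim: m a b => // m IHm a b lt_m Ia Ob ab excl.
have [/hasP[s]|/hasPn none] := boolP (has (fun s => I s || O s) (iota a.+1 (b - a).-1)).
  rewrite mem_iota => sab /orP[Is|Os].
    have [|||c [d [ac cd db Ic Od]]] := IHm s b _ Is Ob; try alia.
    - by move=> t tsb; apply: excl; alia.
    - by exists c, d; split=> //; alia.
  have [|||c [d [ac cd db Ic Od]]] := IHm a s _ Ia Os; try alia.
  - by move=> t tsb; apply: excl; alia.
  - by exists c, d; split=> //; alia.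
exists a, b; split=> //; split=> // s sab; apply/andP; rewrite -negb_or none //.
by rewrite mem_iota; alia.
Qed.

Section Complete.

Variables (V : finType) (e : rel V).
Hypothesis irr : irreflexive e.

(** The pair [t], [t'] is counted apart, so that a degree close to the maximum forces the arcs
    between them. *)
Lemma degin_missing t t' (s : seq V) : t \in s -> t' \in s -> t != t' ->
  degin e t s + 4 <= 2 * size s + (e t t' + e t' t).
Proof.
move=> ts t's tt'; have tr : t \in rem t' s.
  have := ts; rewrite (perm_mem (perm_to_rem t's)) inE (negPf tt') //.
rewrite (degin_perm e t (perm_to_rem t's)) degin_cons.
have := degin_irr irr tr; have : 0 < size s by case: (s) ts.
by rewrite size_remV //; clia.
Qed.

Lemma complete_block (M : seq V) : uniq M -> M != [::] ->
  (forall t t', t \in M -> t' \in M -> t != t' -> e t t') -> block e M.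
Proof.
move=> uM M0 full; rewrite /block M0 /=; elim: M uM full {M0} => //= a [|b M] IHM //=.
move=> /andP[ab uM] full; rewrite full ?inE ?eqxx ?orbT //=; last first.
  by apply: contra ab => /eqP->; rewrite inE eqxx.
by apply: IHM => // t t' tM t'M; apply: full; rewrite inE ?tM ?t'M orbT.
Qed.

End Complete.

Section Config.

Variables (V : finType) (e : rel V) (z : V) (k : nat) (P R : seq V).
Hypothesis ce : counterexample e z k.
Hypothesis cf : config e z P R.

Let irr := ce_irr ce.
Notation N := (size P).
Notation p := (nth z P).
Notation S := (seg P).
Let bseg := bseg ce cf.
Let bR := block_R ce cf.
Let cnt := count_config cf.
Let cseg := @count_seg V P.

Lemma R_links : e (p N.-1) (head z R) /\ e (last z R) (p 0).
Proof. exact: (PR_links ce cf). Qed.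

(** With both arcs at slot [s], the cycle [P ++ R] could be opened there to receive [z]. *)
Lemma z_excl s : outs e z P z s -> ~~ ins e z P z s.
Proof.
move=> /andP[sN zs]; apply/negP=> /andP[/andP[s0 _] sz].
have [pR Rp] := R_links.
have : k + 2 <= size ([::] : seq V).
  apply: (@chain_missing V e z k ce [:: S s N; R; S 0 s]).
  - by rewrite /= bR !bseg //; alia.
  - rewrite /= !head_seg ?last_seg //; try alia.
    by rewrite zs pR Rp sz.
  - apply/permP=> q; rewrite cnt -(@cseg q 0 s N) //; last by alia.
    by rewrite /= !count_cat /=; clia.
by rewrite addn2.
Qed.

Lemma degin_z : degin e z (enum V) = degin e z P.
Proof.
rewrite -(degin_perm e z (cf_perm cf)) degin_cons degin_cat irr.
rewrite (@degin_nonadj _ _ _ R) ?addn0 // => y yR.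
by have [zy yz] := z_nonadjacent ce cf yR.
Qed.

Lemma blanks_z (l : seq nat) : uniq l ->
  (forall s, s \in l -> [/\ s <= N, ~~ outs e z P z s & ~~ ins e z P z s]) ->
  size l + size R <= k + 4.
Proof.
move=> ul bl; have := blanks_le z_excl ul bl.
have := ce_degz ce; rewrite degin_z (size_config cf); clia.
Qed.

Lemma degin_R y : y \in R -> N + size R + 1 + k <= degin e y P + degin e y R.
Proof.
move=> yR; have := ce_deg ce (R_neq_z cf yR).
rewrite -(degin_perm e y (cf_perm cf)) degin_cons degin_cat (size_config cf).
have [/negPf-> /negPf->] := z_nonadjacent ce cf yR; clia.
Qed.

Lemma degin_p i : i < N ->
  N + size R + 1 + k <= e (p i) z + e z (p i) + degin e (p i) P + degin e (p i) R.
Proof.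
move=> iN; have := ce_deg ce (p_neq_z cf iN).
by rewrite -(degin_perm e _ (cf_perm cf)) degin_cons degin_cat (size_config cf); clia.
Qed.

(* A cycle through [z] that misses exactly [k + 2] vertices, none of them adjacent to
   [z]: every degree bound is then an equality. *)
Section Perfect.

Variables W M : seq V.
Hypotheses (cW : cycle e (z :: W)) (pWM : perm_eq (z :: W ++ M) (enum V)).
Hypothesis szM : size M = k + 2.
Hypothesis nadj : forall t, t \in M -> ~~ e z t /\ ~~ e t z.

Lemma perfect_W_neq0 : W != [::].
Proof. by apply/eqP=> W0; move: cW; rewrite W0 /= irr. Qed.

Lemma perfect_block : block e W.
Proof. by apply: (@cycle_blockr _ _ [:: z] W cW); apply: perfect_W_neq0. Qed.

Let uWM : uniq (z :: W ++ M). Proof. by rewrite (perm_uniq pWM) enum_uniq. Qed.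

Lemma perfect_no_insertion t W' : t \in M -> block e W' ->
  head z W' = head z W -> last z W' = last z W -> perm_eq W' (t :: W) -> False.
Proof.
move=> tM bW' hW' lW' pW'.
have : k + 2 <= size (rem t M).
  apply: (missing_many ce (c := z :: W')); rewrite ?mem_head //.
    move: cW; rewrite /= -!cats1 !(path_block z) ?perfect_block //= hW' lW' //.
  apply: perm_trans pWM; apply/permP=> q; have := permP pW' q.
  by have := permP (perm_to_rem tM) q; rewrite /= !count_cat /=; clia.
have : 0 < size M by case: (M) tM.
by rewrite size_remV // szM; clia.
Qed.

(** At most [size W + 1] arcs avoid insertion and at most [2 * (k + 1)] lie inside [M]; their sum is
    exactly the required degree, the number of vertices plus [k]. *)
Lemma perfect_degree t : t \in M ->
  degin e t W + degin e t M = size W + 1 + 2 * (k + 1) /\ degin e t W <= size W + 1.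
Proof.
move=> tM; have bW := perfect_block.
have leW : degin e t W <= size W + 1.
  rewrite leqNgt; apply/negP=> lt.
  have [W' [bW' hW' lW' pW']] := insert_block_deg z bW lt.
  exact: perfect_no_insertion tM bW' hW' lW' pW'.
have leM := degin_irr irr tM.
have tz : t != z by apply: contraTneq uWM => <-; rewrite /= mem_cat tM orbT.
have := ce_deg ce tz; rewrite -(degin_perm e t pWM) degin_cons degin_cat.
have [/negPf-> /negPf->] := nadj tM.
have : size (z :: W ++ M) = size (enum V) by apply: perm_size pWM.
rewrite /= size_cat size_enum => <- h.
by split=> //; move: h leW leM; rewrite szM; clia.
Qed.

(** There are [size W + 1] arcs between [t] and [W] but only [size W - 1] inner places, none of
    which may hold two, so both end arcs are present. *)
Lemma perfect_ends t : t \in M -> e t (head z W) /\ e (last z W) t.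
Proof.
move=> tM; have bW := perfect_block; have [dW leW] := perfect_degree tM.
have leM := degin_irr irr tM; rewrite szM in leM.
have [h|h] := ltnP (size W + e t (head z W) + e (last z W) t) (degin e t W + 1).
  have [W' [bW' hW' lW' pW']] := insert_block bW h.
  by case: (perfect_no_insertion tM bW' hW' lW' pW').
move: h leM dW; clear; case: (e t _); case: (e _ t) => //= *; lia.
Qed.

Lemma perfect_complete t t' : t \in M -> t' \in M -> t != t' -> e t t'.
Proof.
move=> tM t'M tt'; have [dW leW] := perfect_degree tM.
have := degin_missing irr tM t'M tt'; rewrite szM.
by move: dW leW; clear; case: (e t t'); case: (e t' t) => //= *; lia.
Qed.

(** As [t] fits into neither half, the inner places of both halves and the two outer ends hold at
    most [size W] of its [size W + 1] arcs; the last one is at the cut. *)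
Lemma perfect_split t W1 W2 : W = W1 ++ W2 -> W1 != [::] -> W2 != [::] -> t \in M ->
  e (last z W1) t || e t (head z W2).
Proof.
move=> eW W10 W20 tM; have bW := perfect_block.
have b1 : block e W1 by apply: (@block_prefix _ _ W1 W2); rewrite -?eW.
have b2 : block e W2 by apply: (@block_suffix _ _ W1 W2); rewrite -?eW.
have l12 : e (last z W1) (head z W2) by move: bW; rewrite eW (block_cat z).
have [dW leW] := perfect_degree tM; have leM := degin_irr irr tM; rewrite szM in leM.
have [h1|h1] := ltnP (size W1 + e t (head z W1) + e (last z W1) t) (degin e t W1 + 1).
  have [W' [bW' hW' lW' pW']] := insert_block b1 h1.
  case: (@perfect_no_insertion t (W' ++ W2) tM).
  - by rewrite (block_cat z) // lW'.
  - rewrite eW; case: (W') (W1) bW' W10 hW' => [|a s] [|b s'] //= _ _ _ _.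
  - by rewrite eW !last_cat; case: (W2) W20.
  - by rewrite eW -cat_cons perm_cat2r.
have [h2|h2] := ltnP (size W2 + e t (head z W2) + e (last z W2) t) (degin e t W2 + 1).
  have [W' [bW' hW' lW' pW']] := insert_block b2 h2.
  case: (@perfect_no_insertion t (W1 ++ W') tM).
  - by rewrite (block_cat z) // hW'.
  - by rewrite eW; case: (W1) W10.
  - by rewrite eW !last_cat; case: (W2) (W') W20 bW' lW' => [|a s] [|b s'] //=.
  - rewrite eW; apply/permP=> q; have := permP pW' q.
    by rewrite /= !count_cat /=; clia.
have eD : degin e t W = degin e t W1 + degin e t W2 by rewrite eW degin_cat.
have eS : size W = size W1 + size W2 by rewrite eW size_cat.
move: dW leW leM h1 h2; rewrite eD eS; clear.
by case: (e (last z W1) t); case: (e t (head z W2)); case: (e t (head z W1));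
  case: (e (last z W2) t) => //= *; lia.
Qed.

(** [M] is complete and joined to both ends of [W], so it is itself a gap. *)
Lemma perfect_minimal : size R <= k + 2.
Proof.
have bW := perfect_block.
have M0 : M != [::] by apply/eqP=> M0; move: szM; rewrite M0 addn2.
have bM : block e M.
  apply: complete_block => //; last exact: perfect_complete.
  by move: uWM; rewrite /= => /andP[_ /uniq_catr].
rewrite -szM; apply: (cf_min cf (W := W)) => //.
rewrite (cycle_block z _ bW) -cats1 (path_block z _ _ bM) /= andbT.
have hM : head z M \in M by case: (M) M0 => // ? ? _; rewrite mem_head.
have lM : last z M \in M by case: (M) M0 => // ? ? _; rewrite /= mem_last.
by have [_ ->] := perfect_ends hM; have [->] := perfect_ends lM.
Qed.

End Perfect.

(** If [R] is larger than [k + 2], missing exactly [k + 2] vertices not adjacent to [z] would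
    contradict [perfect_minimal], so one more is missed. *)
Lemma missing_nonadjacent bs M : all (block e) bs -> chain e z z bs z ->
  perm_eq (z :: flatten bs ++ M) (enum V) ->
  (forall t, t \in M -> ~~ e z t /\ ~~ e t z) ->
  k + 2 + (k + 2 < size R) <= size M.
Proof.
move=> bbs ch pM nadj; have le := chain_missing ce bbs ch pM.
case: ltnP => [lt|_]; last by rewrite addn0.
rewrite addn1 ltn_neqAle le andbT; apply/eqP=> szM.
have : size R <= k + 2.
  by apply: (perfect_minimal _ pM) => //; rewrite /= (path_chain z).
by alia.
Qed.

(** Take an in-slot [c] followed by an out-slot [d] with only blanks between. The segment from [c]
    to [d] is a competing gap, so [size R <= d - c], whereas the blanks give
    [d - c <= k + 5 - size R]. *)
Lemma z_switch s t : k + 2 < size R -> ins e z P z s -> outs e z P z t -> t < s.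
Proof.
move=> rk zs zt; rewrite ltnNge; apply/negP=> st.
have ne : s != t by apply: contraTneq zs => ->; apply: z_excl.
have [|c [d [sc cd dt zc [zd bl]]]] := closest_switch zs zt _ (fun w _ => @z_excl w).
  by alia.
have [/andP[c0 cN] zc'] := andP zc; have [dN zd'] := andP zd.
have bnd : (d - c).-1 + size R <= k + 4.
  rewrite -(size_iota c.+1 (d - c).-1); apply: blanks_z; rewrite ?iota_uniq // => w.
  by rewrite mem_iota => h; have [] := bl w; [alia|split=> //; alia].
have [pR Rp] := R_links.
have : size R <= size (flatten [:: S c d]).
  apply: (@chain_minimal V e z P R cf (S d N) [:: R; S 0 c]).
  - by rewrite bseg.
  - by rewrite /= bR !bseg //; alia.
  - rewrite /= !head_seg ?last_seg //; try alia.
    by rewrite zd' pR Rp zc'.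
  - rewrite /= !head_seg ?last_seg //; try alia.
    rewrite pR Rp /= -{2}(prednK c0) -{2}(ltn_predK cd) !(path_P ce cf) //; alia.
  - apply/permP=> q; rewrite cnt -(@cseg q 0 c N) // -(@cseg q c d N) //; try alia.
    by rewrite /= !count_cat /=; clia.
rewrite /= cats0 size_seg; last by alia.
by alia.
Qed.

End Config.

Lemma head_mem (V : finType) (z : V) (W : seq V) : W != [::] -> head z W \in W.
Proof. by case: W => // a s _; rewrite mem_head. Qed.

Lemma last_mem (V : finType) (z : V) (W : seq V) : W != [::] -> last z W \in W.
Proof. by case: W => // a s _; rewrite /= mem_last. Qed.

Section Config.

Variables (V : finType) (e : rel V) (z : V) (k : nat) (P R : seq V).
Hypothesis ce : counterexample e z k.
Hypothesis cf : config e z P R.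

Let irr := ce_irr ce.
Notation N := (size P).
Notation p := (nth z P).
Notation S := (seg P).
Let R_large := R_large ce cf.
Let N_gt0 := N_gt0 ce cf.
Let bseg := bseg ce cf.
Let cnt := count_config cf.
Let cseg := @count_seg V P.

Lemma R_small : size R <= k + 4.
Proof. by have := @blanks_z V e z k P R ce cf [::] isT; rewrite add0n; apply. Qed.

Lemma cycle_missing c M : cycle e c -> z \in c -> perm_eq (c ++ M) (enum V) ->
  (forall t, t \in M -> ~~ e z t /\ ~~ e t z) -> k + 2 + (k + 2 < size R) <= size M.
Proof.
move=> cyc zc pM nadj; have [i c' ec] := rot_to zc.
have cyc' : cycle e (z :: c') by rewrite -ec rot_cycle.
have c'0 : c' != [::] by apply/eqP=> c0; move: cyc'; rewrite c0 /= irr.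
have b' : block e c' by apply: (@cycle_blockr _ _ [:: z]).
apply: (@missing_nonadjacent V e z k P R ce cf [:: c']) => //.
- by rewrite /= b'.
- by move: cyc'; rewrite /= -cats1 (path_block z _ _ b') /= andbT.
- apply: perm_trans pM; rewrite /= cats0 -cat_cons perm_cat2r -ec.
  by rewrite perm_rot.
Qed.

Lemma nonadj_R (M : seq V) : {subset M <= R} -> forall t, t \in M -> ~~ e z t /\ ~~ e t z.
Proof. by move=> MR t /MR; apply: z_nonadjacent ce cf _. Qed.

(** Deleting the last vertex of [P], which provides the in-slot [N], must leave another arc into
    [z]. *)
Lemma z_in2 : exists2 t, ins e z P z t & t < N.
Proof.
have [_ pz] := zP0 ce cf.
have [w wz wp] : exists2 w, w != z & w != p N.-1.
  have : exists w, w \in R by have := R_neq0 ce cf; case: (R) => // y; exists y; rewrite mem_head.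
  case=> w wR; exists w; first exact: (R_neq_z cf wR).
  apply/eqP=> ew; move: (PR_disj cf wR); rewrite ew mem_nth // prednK //.
have [|| x [y [xz /negPn/eqP -> xp _ exz]]] := ce_cut ce (a := p N.-1) (X := predC1 z).
- by exists w.
- exists z; rewrite /= ?eqxx // eq_sym (p_neq_z cf) // prednK //.
have : x \in enum V by rewrite mem_enum.
rewrite -(perm_mem (cf_perm cf)) inE mem_cat => /or3P[xz'|xP|xR].
- by move: xz; rewrite /= xz'.
- have ix := nth_index z xP; exists (index x P).+1.
    by rewrite /ins /= index_mem xP ix exz.
  have : index x P < N by rewrite index_mem.
  rewrite leq_eqVlt => /orP[/eqP eN|//].
  by move: xp; rewrite -eN /= ix eqxx.
-
  by have [_] := z_nonadjacent ce cf xR; rewrite exz.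
Qed.

(** Inserting [R1] at slot [s] misses only [R2], which is not adjacent to [z]; [missing_nonadjacent]
    and [R_small] leave this one possibility. *)
Lemma insertion_size R1 R2 s : block e R1 -> perm_eq (R1 ++ R2) R ->
  ins e z P (head z R1) s -> outs e z P (last z R1) s ->
  size R1 = 1 /\ size R = k + 4.
Proof.
move=> b1 pR /andP[/andP[s0 sN] i1] /andP[sN' o1].
have [zp pz] := zP0 ce cf.
have R2R : {subset R2 <= R} by move=> y y2; rewrite -(perm_mem pR) mem_cat y2 orbT.
have := @missing_nonadjacent V e z k P R ce cf [:: S 0 s; R1; S s N] R2.
rewrite /= b1 !bseg // !head_seg ?last_seg // zp i1 o1 pz.
have -> : perm_eq (z :: (S 0 s ++ R1 ++ S s N ++ [::]) ++ R2) (enum V).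
  apply/permP=> q; rewrite cnt -(@cseg q 0 s N) // -(permP pR).
  by rewrite /= !count_cat /=; clia.
move=> /(_ isT isT isT (nonadj_R R2R)).
have : size R1 + size R2 = size R by rewrite -size_cat (perm_sizeV pR).
have : 0 < size R1 by case: (R1) b1.
by have := R_small; have := R_large; case: ltnP; clia.
Qed.

(* Having no arcs to or from [R], the vertices of [K1] have degree large enough to be
   inserted back into the cycle. *)
Lemma free_skip R1 R2 W K1 K2 :
  block e R1 -> perm_eq (R1 ++ R2) R -> cycle e (R1 ++ W) -> z \in W ->
  perm_eq (W ++ K1 ++ K2) (z :: P) ->
  (forall t y, t \in K1 -> y \in R -> ~~ e t y /\ ~~ e y t) ->
  size K1 + size K2 <= size R + k ->
  exists W', [/\ cycle e (R1 ++ W'), z \in W' & perm_eq (W' ++ K2) (z :: P)].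
Proof.
elim: K1 W => [|t K1 IHK] W b1 pR cyc zW pW nadj szK; first by exists W.
have pV : perm_eq ((W ++ t :: K1 ++ K2) ++ R) (enum V).
  by apply: perm_trans (cf_perm cf); rewrite -[z :: P ++ R]cat_cons perm_cat2r.
have W0 : W != [::] by apply: contraTneq zW => ->.
have bW : block e W by apply: cycle_blockr cyc W0.
have tz : t != z.
  have : uniq (W ++ t :: K1 ++ K2).
    by rewrite (perm_uniq pW); have := uniq_config cf; rewrite -cat_cons => /uniq_catl.
  rewrite cat_uniq => /and3P[_ /hasPn/(_ t (mem_head _ _)) tW _].
  by apply: contraNneq tW => ->.
have dtR : degin e t R = 0.
  by apply: degin_nonadj => y yR; apply: nadj; rewrite ?mem_head.
have dtK : degin e t (t :: K1 ++ K2) + 2 <= 2 * size (t :: K1 ++ K2).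
  by apply: degin_irr => //; rewrite mem_head.
have := ce_deg ce tz; rewrite -(degin_perm e t pV) !degin_cat dtR (size_config cf) => dt.
have szW : size W + size (t :: K1 ++ K2) = N.+1.
  by rewrite -size_cat; apply: (perm_size pW).
have lt : size W + 1 < degin e t W.
  move: dt dtK szW szK; rewrite /= size_cat; clia.
have [W1 [bW1 hW1 lW1 pW1]] := insert_block_deg z bW lt.
apply: (IHK W1) => //.
- rewrite (cycle_block z _ b1) -cats1 (path_block z _ _ bW1) hW1 lW1.
  by rewrite -(path_block z _ _ bW) cats1 -(cycle_block z _ b1).
- by rewrite (perm_mem pW1) inE zW orbT.
- apply: perm_trans pW; apply/permP=> q; have := permP pW1 q.
  by rewrite /= !count_cat /= ?count_cat; clia.
- by move=> t' y t'K; apply: nadj; rewrite inE t'K orbT.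
- by move: szK; rewrite /=; clia.
Qed.

End Config.

(** * A vertex of the gap that fits into the path *)

Section SingleInsertion.

Variables (V : finType) (e : rel V) (z : V) (k : nat) (P R : seq V).
Hypothesis ce : counterexample e z k.
Hypothesis cf : config e z P R.

Let irr := ce_irr ce.
Notation N := (size P).
Notation p := (nth z P).
Notation S := (seg P).
Let N_gt0 := N_gt0 ce cf.
Let bseg := bseg ce cf.
Let cnt := count_config cf.
Let cseg := @count_seg V P.

Variables (w : V) (R2 : seq V) (s : nat).
Hypothesis pR : perm_eq (w :: R2) R.
Hypothesis szR : size R = k + 4.
Hypotheses (wi : ins e z P w s) (wo : outs e z P w s).

(** With [w] moved into the path, the rest [R2] of the gap has [k + 3] vertices, one fewer than
    minimality of [R] allows for a gap. *)
Let P' := S 0 s ++ w :: S s N.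
Let pl := p N.-1.

Let s0 : 0 < s. Proof. by have /andP[/andP[]] := wi. Qed.
Let sN : s < N. Proof. by have /andP[] := wo. Qed.

Lemma si_subset : {subset R2 <= R}.
Proof. by move=> y y2; rewrite -(perm_mem pR) inE y2 orbT. Qed.

Lemma si_size : size R2 = k + 3.
Proof. by have := perm_sizeV pR; rewrite szR /=; clia. Qed.

Lemma si_sizeP : size P' = N.+1.
Proof.
by rewrite size_cat /= !size_seg //; [alia|exact: ltnW].
Qed.

Lemma si_link : e (p s.-1) w /\ e w (p s).
Proof. by have /andP[_ ->] := wi; have /andP[_ ->] := wo. Qed.

Lemma si_blocks : block e (S 0 s) /\ block e (w :: S s N).
Proof.
have b2 : block e (S s N) by apply: bseg.
have [_ ws] := si_link; split; first by apply: bseg => //; apply: ltnW.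
by rewrite /block /= (path_block0 z _ b2) head_seg.
Qed.

Lemma si_blockP : block e P'.
Proof.
have [b1 b2] := si_blocks; rewrite (block_cat z) // last_seg //; last exact: ltnW.
by have [-> _] := si_link.
Qed.

Lemma si_head : head z P' = p 0.
Proof.
have := @head_seg V z P 0 s s0 (ltnW sN); rewrite /P'.
by have [b1 _] := si_blocks; case: (S 0 s) b1.
Qed.

Lemma si_last : last z P' = pl.
Proof.
rewrite last_cat /= /pl -(@last_seg V z P s N) //.
by case: (S s N) (bseg sN (leqnn N)).
Qed.

Lemma si_perm : perm_eq (z :: P' ++ R2) (enum V).
Proof.
apply/permP=> q; rewrite cnt -(permP pR) -(@cseg q 0 s N) //; last exact: ltnW.
by rewrite /= !count_cat /=; clia.
Qed.

(** Only [T], at most [k + 2] vertices, would be missed, against the [k + 3] required by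
    [missing_nonadjacent]. *)
Lemma si_no_insertion Q T W1 W2 : block e Q -> perm_eq (Q ++ T) R2 ->
  P' = W1 ++ W2 -> W1 != [::] -> W2 != [::] ->
  e (last z W1) (head z Q) -> e (last z Q) (head z W2) -> False.
Proof.
move=> bQ pQ eP' W10 W20 l1 l2; have bP' := si_blockP; rewrite eP' in bP'.
have b1 := block_prefix bP' W10; have b2 := block_suffix bP' W20.
have [zp pz] := zP0 ce cf.
have hW : head z W1 = p 0 by rewrite -si_head eP'; case: (W1) W10.
have lW : last z W2 = pl by rewrite -si_last eP' last_cat; case: (W2) W20.
have := @missing_nonadjacent V e z k P R ce cf [:: W1; Q; W2] T.
rewrite /= b1 bQ b2 hW zp l1 l2 lW pz cats0.
have -> : perm_eq (z :: (W1 ++ Q ++ W2) ++ T) (enum V).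
  apply: perm_trans si_perm; rewrite perm_cons eP'; apply/permP=> q.
  by have := permP pQ q; rewrite !count_cat; clia.
have TR : {subset T <= R}.
  by move=> y yT; apply: si_subset; rewrite -(perm_mem pQ) mem_cat yT orbT.
move=> /(_ isT isT isT (nonadj_R ce cf TR)).
have : size Q + size T = size R2 by rewrite -size_cat (perm_sizeV pQ).
rewrite si_size szR; have : 0 < size Q by case: (Q) bQ.
by case: ltnP; clia.
Qed.

Lemma si_no_single y W1 W2 : y \in R2 -> P' = W1 ++ W2 -> W1 != [::] -> W2 != [::] ->
  e (last z W1) y -> ~~ e y (head z W2).
Proof.
move=> yR eP' W10 W20 l1; apply/negP=> l2.
by apply: (@si_no_insertion [:: y] (rem y R2) W1 W2) => //; rewrite perm_sym perm_to_rem.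
Qed.

Lemma si_part y W1 W2 W3 : y \in R2 -> P' = W1 ++ W2 ++ W3 -> W2 != [::] ->
  degin e y W2 + 1 <= size W2 + e y (head z W2) + e (last z W2) y.
Proof.
move=> yR eP' W20; have bP' := si_blockP; rewrite eP' in bP'.
have b23 : block e (W2 ++ W3) by apply: block_suffix bP' _; case: (W2) W20.
have b2 : block e W2 by apply: block_prefix b23 W20.
have [//|h] := leqP (degin e y W2 + 1) (size W2 + e y (head z W2) + e (last z W2) y).
have : exists A b B, [/\ W2 = A ++ b :: B, A != [::], e (last z A) y & e y b].
  case: (W2) W20 h => // a t _; rewrite degin_slots /= => h.
  have [|s1 [b [s2 [-> av vb]]]] := @insertable_slot V e y a t.
    by move: h; clia.
  by exists (a :: s1), b, s2.
case=> A [b [B [eW2 A0 Ay yb]]].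
have := @si_no_single y (W1 ++ A) (b :: B ++ W3) yR.
rewrite eP' eW2 -!catA /= last_cat yb => /(_ erefl) h'.
suff : ~~ true by []; apply: h' => //; first by case: (W1) (A) A0 => [|a l] [].
by case: (A) A0 Ay.
Qed.

Lemma si_degree y : y \in R2 -> N + 2 * k + 5 <= degin e y P' + degin e y R2.
Proof.
move=> yR; have yR' := si_subset yR.
have := ce_deg ce (R_neq_z cf yR').
rewrite -(degin_perm e y si_perm) degin_cons degin_cat (size_config cf) szR.
by have [/negPf-> /negPf->] := z_nonadjacent ce cf yR'; clia.
Qed.

Lemma si_bound y : y \in R2 ->
  degin e y P' <= N + e y (p 0) + e pl y /\
  2 * k + 5 <= e y (p 0) + e pl y + degin e y R2.
Proof.
move=> yR; have := @si_part y [::] P' [::] yR; rewrite cats0 => /(_ erefl).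
rewrite si_head si_last si_sizeP; have -> : P' != [::] by have /andP[] := si_blockP.
by move=> /(_ isT) h; split; move: h (si_degree yR); clia.
Qed.

(** A vertex [t] not yet on the path has at most two arcs to each other such vertex, so by
    [si_bound] enough of its arcs go to [Q], [pl] and [p 0] to insert it between these two ends; the
    path grows until it covers [R2]. *)
Lemma si_extend Q T : block e Q -> perm_eq (Q ++ T) R2 ->
  e pl (head z Q) -> e (last z Q) (p 0) ->
  exists Q', [/\ block e Q', perm_eq Q' R2, e pl (head z Q') & e (last z Q') (p 0)].
Proof.
elim: T Q => [|t T IHT] Q bQ pQ eh el.
  by exists Q; split=> //; rewrite cats0 in pQ.
pose Q0 := pl :: rcons Q (p 0).
have bQ0 : block e Q0 by rewrite /block /Q0 /= -cats1 (path_block z _ _ bQ) /= eh el.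
have tR : t \in R2 by rewrite -(perm_mem pQ) mem_cat mem_head orbT.
have [_ bt] := si_bound tR.
have dQ : degin e t R2 = degin e t Q + degin e t (t :: T).
  by rewrite -degin_cat; apply: degin_perm; rewrite perm_sym.
have dT : degin e t (t :: T) + 2 <= 2 * size (t :: T).
  by apply: degin_irr => //; rewrite mem_head.
have szQ : size Q + size (t :: T) = k + 3 by rewrite -size_cat (perm_sizeV pQ) si_size.
have Q1 : 0 < size Q by case: (Q) bQ.
have dQ0 : degin e t Q0 = e t pl + e pl t + (degin e t Q + (e t (p 0) + e (p 0) t)).
  by rewrite /Q0 -cats1 degin_cons degin_cat degin_cons /degin /= !addn0.
have [|W' [bW' hW' lW' pW']] := @insert_block V e z t Q0 bQ0.
  rewrite dQ0 /Q0 /= last_rcons size_rcons; rewrite dQ in bt.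
  by move: bt dT szQ Q1; clia.
have [Q' eW'] : exists Q', W' = pl :: rcons Q' (p 0).
  have szW' := perm_sizeV pW'.
  case: (W') szW' hW' lW' => // a l /= + ->.
  rewrite /= last_rcons; case/lastP: l => [|l b] /=; first by rewrite size_rcons.
  by rewrite last_rcons => _ ->; exists l.
have pQ' : perm_eq Q' (t :: Q).
  apply/permP=> q; have := permP pW' q.
  by rewrite eW' /Q0 -!cats1 /= !count_cat /=; clia.
have Q'0 : Q' != [::].
  by rewrite -size_eq0 (perm_sizeV pQ').
have bQ' : block e Q'.
  move: bW'; rewrite eW' -cats1 => bW'.
  by apply: (@block_prefix _ _ Q' [:: p 0]) => //; apply: (@block_suffix _ _ [:: pl]) bW' _; case: (Q').
apply: (IHT Q') => //.
- apply: perm_trans pQ; apply/permP=> q; have := permP pQ' q.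
  by rewrite !count_cat /=; clia.
- by move: bW'; rewrite eW' /block /= -cats1 (path_block z _ _ bQ') => /andP[].
- by move: bW'; rewrite eW' /block /= -cats1 (path_block z _ _ bQ') /= andbT => /andP[].
Qed.

(** By [si_bound], [2 * k + 5] arcs are needed and only [2 * (k + 2)] fit inside [R2]: exactly one
    end arc is present, and every other estimate is an equality. *)
Lemma si_complete y : y \in R2 -> e y (p 0) + e pl y <= 1 ->
  [/\ e y (p 0) + e pl y = 1, degin e y P' = N.+1
    & forall y', y' \in R2 -> y != y' -> e y y' && e y' y].
Proof.
move=> yR le1; have [b1 b2] := si_bound yR; have b3 := si_degree yR.
have b4 := degin_irr irr yR; rewrite si_size in b4.
split; try by move: le1 b1 b2 b3 b4; clia.
move=> y' y'R yy'; have := degin_missing irr yR y'R yy'; rewrite si_size.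
by move: le1 b2; clear; case: (e y y'); case: (e y' y) => //= *; lia.
Qed.

(** These arcs lead to a path through all of [R2] from [pl] to [p 0]; then [R2] is a gap for [P'],
    shorter than [R]. *)
Lemma si_not_closed a b : a \in R2 -> b \in R2 -> e pl a -> e b (p 0) -> False.
Proof.
move=> aR bR2 pa bp.
have [Q [T [bQ pQ hQ lQ]]] : exists Q T,
    [/\ block e Q, perm_eq (Q ++ T) R2, e pl (head z Q) & e (last z Q) (p 0)].
  have [ap|nap] := boolP (e a (p 0)).
    by exists [:: a], (rem a R2); split; rewrite //= perm_sym perm_to_rem.
  have ab : a != b by apply: contraNneq nap => ->.
  have [|_ _ full] := si_complete aR; first by rewrite (negPf nap) leq_b1.
  have /andP[eab _] := full b bR2 ab.
  exists [:: a; b], (rem b (rem a R2)); split=> //; first by rewrite /block /= eab.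
  have br : b \in rem a R2.
    by have := bR2; rewrite (perm_mem (perm_to_rem aR)) inE eq_sym (negPf ab).
  apply/permP=> q; have := permP (perm_to_rem aR) q; have := permP (perm_to_rem br) q.
  by rewrite /=; clia.
have [Q' [bQ' pQ' hQ' lQ']] := si_extend bQ pQ hQ lQ.
have [zp pz] := zP0 ce cf.
have : size R <= size (flatten [:: Q']).
  apply: (@chain_minimal V e z P R cf P' [::]).
  - exact: si_blockP.
  - by rewrite /= bQ'.
  - by rewrite /= si_head si_last zp pz.
  - by rewrite /= si_head si_last hQ' lQ'.
  - rewrite /= cats0; apply: perm_trans si_perm.
    by rewrite perm_cons perm_cat2l.
by rewrite /= cats0 (perm_sizeV pQ') si_size szR; alia.
Qed.

(** * No arc from the last vertex of [P] to the rest of the gap *)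

Section OpenEnd.

Hypothesis w_R2 : e w (head z R2).
Hypothesis open_end : forall y, y \in R2 -> ~~ e pl y.

Let R20 : R2 != [::].
Proof. by rewrite -size_eq0 si_size addn3. Qed.

Lemma so_complete y : y \in R2 -> e y (p 0) /\ degin e y P' = N.+1.
Proof.
move=> yR; have [|h1 h2 _] := si_complete yR.
  by rewrite (negPf (open_end yR)) addn0 leq_b1.
by move: h1; rewrite (negPf (open_end yR)) addn0; case: (e y _).
Qed.

Lemma so_arc y y' : y \in R2 -> y' \in R2 -> y != y' -> e y y'.
Proof.
move=> yR y'R yy'; have [|_ _ full] := si_complete yR.
  by rewrite (negPf (open_end yR)) addn0 leq_b1.
by have /andP[] := full y' y'R yy'.
Qed.

Lemma so_uniq : uniq R2.
Proof. by have := uniq_R cf; rewrite -(perm_uniq pR) => /andP[]. Qed.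

Lemma so_slot y W1 W2 : y \in R2 -> P' = W1 ++ W2 -> W1 != [::] -> W2 != [::] ->
  e (last z W1) y || e y (head z W2).
Proof.
move=> yR eP' W10 W20; have [yp dy] := so_complete yR.
have h1 := @si_part y [::] W1 W2 yR eP' W10.
have := @si_part y W1 W2 [::] yR; rewrite cats0 => /(_ eP' W20) h2.
have hW : head z W1 = p 0 by rewrite -si_head eP'; case: (W1) W10.
have lW : last z W2 = pl by rewrite -si_last eP' last_cat; case: (W2) W20.
move: h1 h2 dy si_sizeP; rewrite hW lW yp (negPf (open_end yR)) eP' degin_cat size_cat.
by clear; case: (e _ y); case: (e y _) => //= *; lia.
Qed.

(** Otherwise [so_slot] gives [y'] the out-arc at this slot, and the path [y], [y'] fits there. *)
Lemma so_uniform y y' W1 W2 : y \in R2 -> y' \in R2 -> P' = W1 ++ W2 ->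
  W1 != [::] -> W2 != [::] -> e (last z W1) y -> e (last z W1) y'.
Proof.
move=> yR y'R eP' W10 W20 l1; have [<-//|yy'] := eqVneq y y'.
have /orP[//|l2] := so_slot y'R eP' W10 W20.
have y'r : y' \in rem y R2.
  by have := y'R; rewrite (perm_mem (perm_to_rem yR)) inE eq_sym (negPf yy').
case: (@si_no_insertion [:: y; y'] (rem y' (rem y R2)) W1 W2) => //.
  by rewrite /block /= so_arc.
apply/permP=> q; have := permP (perm_to_rem yR) q; have := permP (perm_to_rem y'r) q.
by rewrite /=; clia.
Qed.

(** Otherwise [y] has an arc to the vertex after [v], and a path through all of [R2] ending in [y]
    replaces [v]; the cycle would miss [v] alone. *)
Lemma so_step v y W1 W2 : y \in R2 -> P' = W1 ++ v :: W2 -> W1 != [::] -> W2 != [::] ->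
  e (last z W1) (head z R2) -> e v y.
Proof.
move=> yR eP' W10 W20 l1; have hR := head_mem z R20.
have eP2 : P' = rcons W1 v ++ W2 by rewrite cat_rcons.
have := so_slot yR eP2; rewrite last_rcons => /(_ _ W20)/orP[|//|l2].
  by case: (W1).
pose Q := rcons (rem y R2) y.
have pQ : perm_eq Q R2 by rewrite perm_rcons perm_sym perm_to_rem.
have bP' := si_blockP; rewrite eP' in bP'.
have b1 := block_prefix bP' W10.
have b2 : block e W2 by apply: (@block_suffix _ _ [:: v]) W20; apply: block_suffix bP' _.
have bQ : block e Q.
  apply: complete_block.
  - by rewrite (perm_uniq pQ) so_uniq.
  - by rewrite /Q -size_eq0 size_rcons.
  - by move=> t t'; rewrite !(perm_mem pQ); apply: so_arc.
have Q0 : Q != [::] by rewrite /Q -size_eq0 size_rcons.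
have hQ : head z Q \in R2 by rewrite -(perm_mem pQ) head_mem.
have l1' : e (last z W1) (head z Q) by apply: so_uniform hR hQ eP' W10 _ l1.
have [zp pz] := zP0 ce cf.
have hW : head z W1 = p 0 by rewrite -si_head eP'; case: (W1) W10.
have lW : last z W2 = pl by rewrite -si_last eP' last_cat; case: (W2) W20.
have : k + 2 <= size [:: v].
  apply: (@chain_missing V e z k ce [:: W1; Q; W2]).
  - by rewrite /= b1 bQ b2.
  - by rewrite /= hW zp l1' /Q last_rcons l2 lW pz.
  - apply: perm_trans si_perm; rewrite perm_cons eP'; apply/permP=> q.
    by have := permP pQ q; rewrite /= !count_cat /=; clia.
by rewrite addn2.
Qed.

Lemma so_forward W1 A B y : P' = (W1 ++ A) ++ B -> W1 != [::] -> B != [::] ->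
  e (last z W1) (head z R2) -> y \in R2 -> e (last z (W1 ++ A)) y.
Proof.
have hR := head_mem z R20; elim/last_ind: A B y => [|A v IHA] B y.
  by rewrite cats0 => eP' W10 B0 l1 yR; apply: so_uniform hR yR eP' W10 B0 l1.
rewrite -rcons_cat cat_rcons last_rcons => eP' W10 B0 l1 yR.
apply: (so_step yR eP') => //; first by case: (W1) W10.
exact: IHA eP' W10 _ l1 hR.
Qed.

(** For [size R = k + 4] the vertex [z] has no blank slot, and slot [N.-1] is not before an in-slot,
    hence an in-slot itself. *)
Lemma so_z_last : 1 < N /\ e (p N.-2) z.
Proof.
have [t zt tN] := z_in2 ce cf.
have zs u : outs e z P z u -> u < t by apply: (z_switch ce cf) zt; rewrite szR; clia.
have [/andP[tz _] _] := andP zt; have N1 : 1 < N by alia.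
split=> //; have [//|nz] := boolP (e (p N.-2) z).
have : size [:: N.-1] + size R <= k + 4.
  apply: (blanks_z ce cf) => // u; rewrite inE => /eqP->; split; first by alia.
    by apply/negP=> /zs; alia.
  by rewrite /ins (negPf nz) andbF.
by rewrite szR /=; clia.
Qed.

Lemma so_minimal X : block e X -> head z X = p 0 -> last z X = p N.-2 ->
  perm_eq X P' -> (forall y, y \in R2 -> e (p N.-2) y) -> False.
Proof.
move=> bX hX lX pX inR2; have [N1 pz] := so_z_last; have [zp _] := zP0 ce cf.
have bR2 : block e R2 by apply: complete_block so_uniq R20 so_arc.
have : size R <= size (flatten [:: R2]).
  apply: (@chain_minimal V e z P R cf X [::]) => //.
  - by rewrite /= bR2.
  - by rewrite /= hX lX zp pz.
  - rewrite /= lX hX inR2 ?head_mem //.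
    by have [-> _] := so_complete (last_mem z R20).
  - rewrite /= cats0; apply: perm_trans si_perm.
    by rewrite perm_cons perm_cat2r.
by rewrite /= cats0 si_size szR; clia.
Qed.

Lemma so_last_slot X : P' = rcons X pl -> X != [::] ->
  (forall y, y \in R2 -> e (last z X) y) -> N + 2 * k + 3 <= degin e pl X.
Proof.
move=> eP' X0 inX.
have dR2 : degin e pl R2 = 0.
  apply: degin_nonadj => y yR; split; first exact: open_end.
  by apply: (@si_no_single y X [:: pl]); rewrite ?cats1 // inX.
have pz : pl != z by apply: (p_neq_z cf); rewrite prednK.
have := ce_deg ce pz; rewrite -(degin_perm e _ si_perm) degin_cons degin_cat dR2.
rewrite (size_config cf) szR eP' -cats1 degin_cat degin_cons irr /= /degin /=.
by have := leq_b1 (e pl z); have := leq_b1 (e z pl); clia.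
Qed.

(** The aim is a path from [p 0] to [p N.-2] through all of [P'], as [so_minimal] forbids. Having no
    arcs with [R2], [pl] has enough arcs to be moved inside; if [w] is just before [pl], it must be
    moved inside as well. *)
Lemma so_false : False.
Proof.
have [N1 pz] := so_z_last.
have wR : w \in R by rewrite -(perm_mem pR) mem_head.
have w2 : w \notin R2 by have := uniq_R cf; rewrite -(perm_uniq pR) => /andP[].
have segl : S N.-1 N = [:: pl].
  by have := @seg1 V z P N.-1; rewrite prednK //; apply.
have [sN1|sN1] := ltnP s N.-1.
  pose X := S 0 s ++ w :: S s N.-1.
  have eP' : P' = rcons X pl.
    rewrite /X rcons_cat rcons_cons /P'; congr (_ ++ _ :: _).
    rewrite -cats1 -(@seg_cat V P s N.-1 N) //; try alia.
    by rewrite segl.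
  have X0 : X != [::] by rewrite /X; case: (S 0 s).
  have bX : block e X by have := si_blockP; rewrite eP' -cats1 => /block_prefix; apply.
  have lX : last z X = p N.-2.
    rewrite /X last_cat /= -(@last_seg V z P s N.-1) //; try alia.
    by case: (S s N.-1) (@seg_neq0 V P s N.-1 sN1 (leq_pred N)).
  have hX : head z X = p 0 by rewrite -si_head eP'; case: (X) X0.
  have inX y : y \in R2 -> e (last z X) y.
    move=> yR; rewrite /X -cat_rcons.
    apply: (@so_forward (rcons (S 0 s) w) (S s N.-1) [:: pl]) => //.
    - by rewrite cat_rcons -/X cats1.
    - by case: (S 0 s).
    - by rewrite last_rcons.
  have [|X' [bX' hX' lX' pX']] := @insert_block_deg V e z pl X bX.
    have := so_last_slot eP' X0 inX; have := si_sizeP.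
    by rewrite eP' size_rcons; clia.
  apply: (so_minimal bX'); rewrite ?hX' ?lX' //.
    by apply: perm_trans pX' _; rewrite eP' perm_sym perm_rcons.
  by move=> y yR; rewrite -lX inX.
have es : s = N.-1 by alia.
pose X := S 0 N.-1.
have eP' : P' = X ++ [:: w; pl].
  by rewrite /P' es segl.
have X0 : X != [::] by apply: seg_neq0; alia.
have bX : block e X by apply: bseg; alia.
have lX : last z X = p N.-2 by rewrite last_seg //; alia.
have hX : head z X = p 0 by rewrite head_seg //; alia.
have inW y : y \in R2 -> e w y.
  have eP2 : P' = rcons X w ++ [:: pl] by rewrite cat_rcons.
  move=> yR; have := so_uniform (head_mem z R20) yR eP2; rewrite last_rcons.
  by apply=> //; case: (X).
(* If [p N.-2] misses some vertex of [R2], then by [so_forward] no vertex of [X] has an arc into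
   [R2], and deleting [w] would leave no arc into [R2]. *)
have [allin|] := boolP (all (e (p N.-2)) R2); last first.
  rewrite -has_predC => /hasP[y0 y0R /= ny0].
  have [|| x [y [xR2 /negPn yR2 xw _ exy]]] := ce_cut ce (a := w) (X := fun x => x \notin R2).
  - exists z; last by rewrite eq_sym (R_neq_z cf wR).
    by apply: contra (z_notin_R cf); apply: si_subset.
  - exists (head z R2); first by rewrite negbK head_mem.
    by apply: contraNneq w2 => <-; rewrite head_mem.
  have : x \in enum V by rewrite mem_enum.
  rewrite -(perm_mem si_perm) inE mem_cat (negPf xR2) orbF => /orP[/eqP ez|].
    by have [/negPf] := z_nonadjacent ce cf (si_subset yR2); rewrite -ez exy.
  rewrite eP' mem_cat !inE (negPf xw) /= => /orP[xX|/eqP ex]; last first.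
    by have := open_end yR2; rewrite -ex exy.
  case/negP: ny0; have [A [B eX]] : exists A B, X = rcons A x ++ B.
    by case/splitPr: xX => A B; exists A, B; rewrite cat_rcons.
  have A0 : rcons A x != [::] by rewrite -size_eq0 size_rcons.
  have eP2 : P' = rcons A x ++ (B ++ [:: w; pl]) by rewrite eP' eX catA.
  rewrite -lX eX; apply: (@so_forward (rcons A x) B [:: w; pl]) => //.
    by rewrite -catA.
  apply: (so_uniform yR2 (head_mem z R20) eP2) => //; last by rewrite last_rcons.
  by case: (B).
have all_in y : y \in R2 -> e (p N.-2) y by move/allP: allin; apply.
have nyw y : y \in R2 -> ~~ e y w.
  by move=> yR; apply: (@si_no_single y X [:: w; pl]); rewrite // lX all_in.
have dpl : N + 2 * k + 3 <= degin e pl X + 2.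
  have eP2 : P' = rcons (rcons X w) pl by rewrite -!cats1 -catA eP'.
  have := so_last_slot eP2; rewrite last_rcons -[rcons X w]cats1 degin_cat degin_cons.
  rewrite [degin e pl [::]]/degin /= addn0 => h.
  have := h (_ : X ++ [:: w] != [::]) inW; case: (X) X0 {h} => // a l _ /(_ isT).
  by have := leq_b1 (e pl w); have := leq_b1 (e w pl); clia.
have szX : size X = N.-1 by rewrite size_seg ?subn0 // leq_pred.
have [|X1 [bX1 hX1 lX1 pX1]] := @insert_block_deg V e z pl X bX.
  by move: dpl; rewrite szX; have := N_gt0; clia.
have dw : N + k + 2 <= degin e w X1.
  have := ce_deg ce (R_neq_z cf wR).
  rewrite -(degin_perm e w si_perm) degin_cons degin_cat (size_config cf) szR.
  have [/negPf-> /negPf->] := z_nonadjacent ce cf wR.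
  have -> : degin e w P' = degin e w X1.
    rewrite (degin_perm e w pX1) eP' degin_cat !degin_cons irr.
    by rewrite [degin e w [::]]/degin /=; clia.
  have : degin e w R2 <= size R2.
    rewrite /degin (_ : count (e^~ w) R2 = 0) ?addn0 ?count_size //.
    by apply/eqP; rewrite -leqn0 leqNgt -has_count; apply/hasPn=> y /nyw.
  by rewrite si_size; clia.
have [|X2 [bX2 hX2 lX2 pX2]] := @insert_block_deg V e z w X1 bX1.
  by move: dw; rewrite (perm_sizeV pX1) /= szX; have := N_gt0; clia.
apply: (so_minimal bX2); rewrite ?hX2 ?hX1 ?lX2 ?lX1 //.
rewrite eP'; apply/permP=> q; have := permP pX2 q; have := permP pX1 q.
by rewrite /= count_cat /=; clia.
Qed.

End OpenEnd.

End SingleInsertion.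

(** * Paths inside the gap *)

(** By [insertion_size] a single vertex [w] is in question. If [R2] has both an arc from the last
    and an arc to the first vertex of [P], [si_not_closed] applies. Otherwise [w] is the first or
    the last vertex of [R], and [so_false] applies, in the latter case after reversal. *)
Lemma no_insertion (V : finType) (e : rel V) (z : V) (k : nat) (P R R1 R2 : seq V) (s : nat) :
  counterexample e z k -> config e z P R -> block e R1 -> perm_eq (R1 ++ R2) R ->
  ins e z P (head z R1) s -> outs e z P (last z R1) s -> False.
Proof.
move=> ce cf b1 pR i1 o1.
have [sz1 szR] := insertion_size ce cf b1 pR i1 o1.
case: R1 sz1 b1 pR i1 o1 => [|w [|]] //= _ _ pR i1 o1.
have w2 : w \notin R2.
  by have := uniq_R cf; rewrite -(perm_uniq pR) => /andP[].
have in2 y : y \in R -> y != w -> y \in R2.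
  by rewrite -(perm_mem pR) inE => /orP[->|].
have [hN h0] := PR_links ce cf.
have bR := block_R ce cf.
have [/hasP[a aR pa]|/hasPn openN] := boolP (has (e (nth z P (size P).-1)) R2).
  have [/hasP[b bR2 pb]|/hasPn open0] := boolP (has (e^~ (nth z P 0)) R2).
    exact: (@si_not_closed V e z k P R ce cf w R2 s pR szR i1 o1 a b).
  case/lastP: R pR in2 szR hN h0 bR cf => // R' w' pR in2 szR hN h0 bR cf.
  have ew : w' = w.
    apply/eqP/negPn/negP=> nw; move: h0; rewrite last_rcons.
    by apply/negP/open0/in2 => //; rewrite mem_rcons mem_head.
  rewrite {w'}ew in pR in2 szR hN h0 bR cf *.
  have pR' : perm_eq R' R2.
    by move: pR; rewrite perm_sym perm_rcons perm_cons.
  have sN := outs_lt o1.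
  apply: (@so_false V (fun x y => e y x) z k (rev P) (rev (rcons R' w))
            (counterexample_rev ce) (config_rev cf) w (rev R') (size P - s)).
  - by rewrite rev_rcons.
  - by rewrite size_rev.
  - by rewrite ins_rev ?leq_subr // subKn // ltnW.
  - by rewrite outs_rev ?leq_subr // subKn // ltnW.
  - have R'0 : R' != [::].
      by apply/eqP=> R'0; move: szR; rewrite R'0 /=; clia.
    rewrite -[head z _]nth0 nth_rev ?lt0n ?size_eq0 // subn1 nth_last.
    have b' : block e R' by apply: (@block_prefix _ _ R' [:: w]); rewrite ?cats1.
    by move: bR; rewrite -cats1 (block_cat z).
  - move=> y; rewrite mem_rev (perm_mem pR') => /open0.
    rewrite nth_rev size_rev ?prednK //; try exact: (N_gt0 ce cf).
    by rewrite subnn.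
case: R pR in2 szR hN h0 bR cf => // w' R' pR in2 szR hN h0 bR cf.
have ew : w' = w.
  apply/eqP/negPn/negP=> nw; move: hN => /=.
  by apply/negP/openN/in2 => //; rewrite mem_head.
rewrite {w'}ew in pR in2 szR hN h0 bR cf *.
have pR' : perm_eq R' R2 by move: pR; rewrite perm_sym perm_cons.
apply: (@so_false V e z k P (w :: R') ce cf w R' s) => //.
- have R'0 : R' != [::] by apply/eqP=> R'0; move: szR; rewrite R'0 /=; clia.
  have b' : block e R' by apply: (@block_suffix _ _ [:: w]).
  by move: bR; rewrite -cat1s (block_cat z).
- by move=> y; rewrite (perm_mem pR') => /openN.
Qed.

Lemma four_true (a b c d : bool) : 4 <= a + b + c + d -> [/\ a, b, c & d].
Proof. by case: a; case: b; case: c; case: d. Qed.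

Section Config.

Variables (V : finType) (e : rel V) (z : V) (k : nat) (P R : seq V).
Hypothesis ce : counterexample e z k.
Hypothesis cf : config e z P R.

Let irr := ce_irr ce.
Notation N := (size P).
Notation p := (nth z P).
Let R_small := R_small ce cf.

Lemma R_excl y s : y \in R -> outs e z P y s -> ~~ ins e z P y s.
Proof.
move=> yR o; apply/negP=> i.
by apply: (@no_insertion V e z k P R [:: y] (rem y R) s) => //; rewrite perm_sym perm_to_rem.
Qed.

(* Every blank slot of a vertex of [R], like every missing arc inside [R], uses
   up one unit of [size R - k - 2]. *)
Lemma R_budget y (l : seq nat) : y \in R -> uniq l ->
  (forall s, s \in l -> [/\ s <= N, ~~ outs e z P y s & ~~ ins e z P y s]) ->
  size l + size R + k <= degin e y R.
Proof.
move=> yR ul bl; have := blanks_le (fun s => @R_excl y s yR) ul bl.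
by have := degin_R ce cf yR; clia.
Qed.

Lemma R_budget0 y : y \in R -> size R + k <= degin e y R.
Proof. by move=> yR; have := @R_budget y [::] yR isT; rewrite add0n; apply. Qed.

(** Two vertices are demanded because a splicing must take at least two out of the gap to contradict
    [cycle_missing]. *)
Definition R_path (w w' : V) : Prop := exists Q T,
  [/\ block e Q, perm_eq (Q ++ T) R, head z Q = w, last z Q = w' & 2 <= size Q].

(* The only way for [R] not to be connected by paths with two vertices: two pairs,
   with all arcs from the first to the second and none back. *)
Definition R_split : Prop := exists x x' y y',
  [/\ perm_eq [:: x; x'; y; y'] R, k = 0,
     (forall a b, a \in R -> b \in R -> a != b ->
        e a b = ~~ ((a \in [:: y; y']) && (b \in [:: x; x'])))
   & forall a s, a \in R -> s <= N -> outs e z P a s || ins e z P a s].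

Lemma R_path2 w w' : w \in R -> w' \in R -> w != w' -> e w w' -> R_path w w'.
Proof.
move=> wR w'R ww' eww'; exists [:: w; w'], (rem w' (rem w R)); split=> //.
  by rewrite /block /= eww'.
have w'r : w' \in rem w R.
  by have := w'R; rewrite (perm_mem (perm_to_rem wR)) inE eq_sym (negPf ww').
apply/permP=> q; have := permP (perm_to_rem wR) q; have := permP (perm_to_rem w'r) q.
by rewrite /=; clia.
Qed.

(** Each vertex has at least four of the six possible arcs inside [R], so [w] lacks only the arcs to
    [w'] and [a], and [w'] only those from [w] and [b]. The arc from [b] to [a] decides between the
    path [w], [b], [a], [w'] and the split into the pairs [a], [w'] and [w], [b]. *)
Lemma R_path_or_split4 w w' a b : k = 0 -> perm_eq [:: w; w'; a; b] R ->
  ~~ e w w' -> ~~ e w a -> ~~ e b w' -> R_path w w' \/ R_split.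
Proof.
move=> k0 pR /negPf nww' /negPf nwa /negPf nbw'.
have bud v : v \in R -> 4 <= degin e v [:: w; w'; a; b].
  move=> vR; rewrite (degin_perm e v pR); have := R_budget0 vR.
  by rewrite -(perm_sizeV pR) k0.
have memR v : v \in [:: w; w'; a; b] -> v \in R by rewrite (perm_mem pR).
have := bud w (memR _ _); rewrite !inE eqxx !degin_cons /degin /= !irr nww' nwa.
rewrite !(addn0, add0n, addnA) => /(_ isT)/four_true[w'w aw wb bw].
have := bud w' (memR _ _); rewrite !inE eqxx orbT !degin_cons /degin /= !irr nww' nbw'.
rewrite !(addn0, add0n, addnA) => /(_ isT)/four_true[_ w'a aw' w'b].
have [ba|/negPf nba] := boolP (e b a); last first.
  have := bud a (memR _ _); rewrite !inE eqxx !orbT !degin_cons /degin /= !irr nwa nba.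
  rewrite !(addn0, add0n, addnA) => /(_ isT)/four_true[_ _ _ ab].
  have uR : uniq [:: w; w'; a; b] by rewrite (perm_uniq pR) (uniq_R cf).
  right; exists a, w', w, b; split=> //.
  - apply: perm_trans pR; apply/permP=> q; rewrite /=; clia.
  - move=> c d; rewrite -!(perm_mem pR); move: uR; rewrite /= !inE !negb_or.
    case/and4P=> /and3P[w1 w2 w3] /andP[w4 w5] w6 _.
    have [w1' w2' w3'] : [/\ w' != w, a != w & b != w] by rewrite ![_ == w]eq_sym.
    have [w4' w5' w6'] : [/\ a != w', b != w' & b != a] by rewrite ![_ == w']eq_sym [b == a]eq_sym.
    move=> /or4P[]/eqP-> /or4P[]/eqP->; rewrite ?eqxx //= => _;
    by rewrite ?(negPf w1, negPf w2, negPf w3, negPf w4, negPf w5, negPf w6, negPf w1',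
       negPf w2', negPf w3', negPf w4', negPf w5', negPf w6') ?eqxx ?orbT //=.
  - move=> v s vR sN; apply/negPn/negP; rewrite negb_or => /andP[no ni].
    have : size [:: s] + size R + k <= degin e v R.
      by apply: R_budget => // t; rewrite inE => /eqP->.
    rewrite -(degin_perm e v pR) -(perm_sizeV pR) k0.
    have := vR; rewrite -(perm_mem pR) !inE => /or4P[]/eqP->;
    by rewrite !degin_cons /degin /= !irr ?(nww', nwa, nbw', nba) /=;
      repeat match goal with |- context [nat_of_bool ?b] => have := leq_b1 b; generalize (nat_of_bool b) end; clia.
left; exists [:: w; b; a; w'], [::]; split=> //; first by rewrite /block /= wb ba aw'.
by apply: perm_trans pR; apply/permP=> q; rewrite /=; clia.
Qed.

(** Without an arc or a path of three vertices from [w] to [w'], the out-arcs of [w] and the in-arcs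
    of [w'] at the other vertices number at most [size R - 2] together; the budgets [size R + k] of
    both then leave only [k = 0] and [size R = 4]. *)
Lemma R_path_or_split w w' : w \in R -> w' \in R -> w != w' -> R_path w w' \/ R_split.
Proof.
move=> wR w'R ww'; have [h|nww'] := boolP (e w w'); first by left; apply: R_path2.
have w'r : w' \in rem w R.
  by have := w'R; rewrite (perm_mem (perm_to_rem wR)) inE eq_sym (negPf ww').
have [U pU] : exists U : seq V, perm_eq [:: w, w' & U] R.
  exists (rem w' (rem w R)); apply/permP=> q.
  have := permP (perm_to_rem wR) q; have := permP (perm_to_rem w'r) q.
  by rewrite /=; clia.
have uU : uniq [:: w, w' & U] by rewrite (perm_uniq pU) (uniq_R cf).
have UR u : u \in U -> [/\ u \in R, u != w & u != w'].
  move=> uU'; split; first by rewrite -(perm_mem pU) !inE uU' !orbT.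
    by apply: contraTneq uU => <-; rewrite /= !inE uU' orbT.
  by apply: contraTneq uU => <-; rewrite /= uU' andbF.
have [/hasP[u uU' /andP[wu uw']]|/hasPn nou] := boolP (has (fun u => e w u && e u w') U).
  left; exists [:: w; u; w'], (rem u U); split=> //; first by rewrite /block /= wu uw'.
  apply/permP=> q; have := permP (perm_to_rem uU') q; have := permP pU q.
  by rewrite /=; clia.
have szU : size R = (size U).+2 by rewrite -(perm_sizeV pU).
have dw : degin e w R = e w' w + degin e w U.
  by rewrite -(degin_perm e w pU) !degin_cons irr (negPf nww').
have dw' : degin e w' R = e w' w + degin e w' U.
  by rewrite -(degin_perm e w' pU) !degin_cons irr (negPf nww'); clia.
have c1 : degin e w U = count (e w) U + count (e^~ w) U by [].
have c2 : degin e w' U = count (e w') U + count (e^~ w') U by [].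
have c3 : count (e w) U + count (e^~ w') U <= size U.
  rewrite -count_predUI [X in _ + X](_ : _ = 0) ?addn0 ?count_size //.
  by apply/eqP; rewrite -leqn0 leqNgt -has_count; apply/hasPn => u /nou.
have b1 := R_budget0 wR; have b2 := R_budget0 w'R.
have l1 := count_size (e^~ w) U; have l2 := count_size (e w') U.
have l3 := leq_b1 (e w' w).
have [k0 sU] : k = 0 /\ size U = 2.
  by move: dw dw' c1 c2 c3 b1 b2 l1 l2 l3 R_small; rewrite szU; clia.
have szR : size R = 4 by rewrite szU sU.
case: {uU c1 c2}U sU nou pU dw dw' {UR szU c3 l1 l2} => [|a [|b []]] // _ nou pU dw dw'.
rewrite dw /degin /= !addn0 szR k0 in b1; rewrite dw' /degin /= !addn0 szR k0 in b2.
have [na nb] : ~~ (e w a && e a w') /\ ~~ (e w b && e b w').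
  by split; apply: nou; rewrite !inE eqxx ?orbT.
have [/andP[nwa nbw']|h] := boolP (~~ e w a && ~~ e b w').
  exact: R_path_or_split4 k0 pU nww' nwa nbw'.
have pU' : perm_eq [:: w; w'; b; a] R.
  by apply: perm_trans pU; apply/permP=> q; rewrite /=; clia.
have [nwb naw'] : ~~ e w b /\ ~~ e a w'.
  move: b1 b2 na nb h l3.
  by case: (e w a); case: (e w b); case: (e a w'); case: (e b w') => //=;
    have := leq_b1 (e a w); have := leq_b1 (e b w); have := leq_b1 (e w' a);
    have := leq_b1 (e w' b); clia.
exact: R_path_or_split4 k0 pU' nww' nwb naw'.
Qed.

End Config.

(** * Crossing slots *)

(* [x] and [y] stand for [z] and [R], [xo]/[xi] for the slots at which [x] has an
   out-arc/in-arc, and [jmp u v] for an arc from the vertex before slot [u] to the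
   vertex after slot [v]. Each of the last fields is a splicing that cannot exist; in
   [cross_xy] and [cross_yx], one blank vertex may be skipped at either end. *)
Record crossing_free (N : nat) (xo xi yo yi : pred nat) (jmp : rel nat) : Prop := {
  xo0 : xo 0; yo0 : yo 0; xiN : xi N; yiN : yi N;
  xo_lt : forall s, xo s -> s < N;
  yo_lt : forall s, yo s -> s < N;
  xi_gt : forall s, xi s -> 0 < s <= N;
  yi_gt : forall s, yi s -> 0 < s <= N;
  x_switch : forall s t, xi s -> xo t -> t < s;
  y_switch : forall s t, yi s -> yo t -> t < s;
  xo2 : exists2 t, xo t & 0 < t;
  yo2 : exists2 t, yo t & 0 < t;
  xi2 : exists2 t, xi t & t < N;
  yi2 : exists2 t, yi t & t < N;
  blank2 : forall lx ly : seq nat, uniq lx -> uniq ly ->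
    (forall s, s \in lx -> [/\ s <= N, ~~ xo s & ~~ xi s]) ->
    (forall s, s \in ly -> [/\ s <= N, ~~ yo s & ~~ yi s]) ->
    size lx + size ly <= 2;
  cut_jump : forall c, 0 < c -> c.+1 < N ->
    exists u v, [/\ 0 < u, u <= c, c < v, v < N & jmp u v];
  blank_size : forall a b, a < N -> b < N -> ~~ xo a -> ~~ xi a.+1 ->
    ~~ yo b -> ~~ yi b.+1 -> N != 4;
  cross_xy : forall u0 u v v0, 0 < u0 -> u0 <= u <= u0.+1 -> u < v ->
    v <= v0 <= v.+1 -> v0 < N -> jmp u0 v0 -> xo u -> yi v ->
    (u0 < u -> ~~ xo u0 && ~~ xi u0) -> (v < v0 -> ~~ yo v0 && ~~ yi v0) -> False;
  cross_yx : forall u0 u v v0, 0 < u0 -> u0 <= u <= u0.+1 -> u < v ->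
    v <= v0 <= v.+1 -> v0 < N -> jmp u0 v0 -> yo u -> xi v ->
    (u0 < u -> ~~ yo u0 && ~~ yi u0) -> (v < v0 -> ~~ xo v0 && ~~ xi v0) -> False;
  twin_x : forall u c v, 0 < u -> u < c -> c < v -> v < N ->
    jmp u c -> jmp c v -> xo u -> xi v -> False;
  twin_y : forall u c v, 0 < u -> u < c -> c < v -> v < N ->
    jmp u c -> jmp c v -> yo u -> yi v -> False;
  triple_xy : forall u m v, 0 < u -> u < m -> m.+1 < v -> v < N ->
    jmp m m.+1 -> jmp u m -> jmp m.+1 v -> xo u -> yi v -> False;
  triple_yx : forall u m v, 0 < u -> u < m -> m.+1 < v -> v < N ->
    jmp m m.+1 -> jmp u m -> jmp m.+1 v -> yo u -> xi v -> False }.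

Lemma crossing_free_swap N xo xi yo yi jmp :
  crossing_free N xo xi yo yi jmp -> crossing_free N yo yi xo xi jmp.
Proof.
move=> cf; case: (cf) => *; split; try assumption.
- by move=> lx ly ux uy hx hy; rewrite addnC; apply: (blank2 cf).
- by move=> a b aN bN *; apply: (@blank_size _ _ _ _ _ _ cf b a).
Qed.

Section Crossing.

Variables (N : nat) (xo xi yo yi : pred nat) (jmp : rel nat).
Hypothesis cf : crossing_free N xo xi yo yi jmp.

Lemma cross u v : 0 < u -> u < v -> v < N -> jmp u v -> xo u -> yi v -> False.
Proof.
move=> u0 uv vN j xu yv; apply: (cross_xy cf u0 _ uv _ vN j xu yv);
  by rewrite ?ltnn ?leqnn ?leqnSn.
Qed.

Lemma cross_low u v : 0 < u -> u.+1 < v -> v < N -> jmp u v ->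
  ~~ xo u -> ~~ xi u -> xo u.+1 -> yi v -> False.
Proof.
move=> u0 uv vN j nxu nxu' xu yv; apply: (cross_xy cf u0 _ uv _ vN j xu yv);
  by rewrite ?ltnn ?leqnn ?leqnSn ?nxu.
Qed.

Lemma cross_high u v : 0 < u -> u < v.-1 -> v < N -> jmp u v ->
  xo u -> yi v.-1 -> ~~ yo v -> ~~ yi v -> False.
Proof.
move=> u0 uv vN j xu yv nyv nyv'.
apply: (cross_xy cf u0 _ uv _ vN j xu yv); rewrite ?ltnn ?leqnn ?leqnSn ?nyv //.
by alia.
Qed.

Lemma cross' u v : 0 < u -> u < v -> v < N -> jmp u v -> yo u -> xi v -> False.
Proof.
move=> u0 uv vN j xu yv; apply: (cross_yx cf u0 _ uv _ vN j xu yv);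
  by rewrite ?ltnn ?leqnn ?leqnSn.
Qed.

Lemma first_out u c : u <= c -> xo c ->
  exists w, [/\ u <= w <= c, xo w & forall s, u <= s < w -> ~~ xo s].
Proof.
move=> uc xc; have [|w /andP[uw xw] minw] := @ex_minnP (fun w => (u <= w) && xo w).
  by exists c; rewrite uc.
exists w; split=> //; first by rewrite uw minw // uc.
by move=> s /andP[us sw]; apply/negP=> xs; have := minw s; rewrite us xs; alia.
Qed.

Lemma last_in v c : c <= v -> yi c ->
  exists w, [/\ c <= w <= v, yi w & forall s, w < s <= v -> ~~ yi s].
Proof.
move=> cv yc; have [||w /andP[wv yw] maxw] := @ex_maxnP (fun w => (w <= v) && yi w) v.
- by exists c; rewrite cv.
- by move=> s /andP[].
exists w; split=> //; first by rewrite wv maxw // cv.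
by move=> s /andP[ws sv]; apply/negP=> ys; have := maxw s; rewrite sv ys; alia.
Qed.

Lemma xi_ge s t : xo t -> s <= t -> ~~ xi s.
Proof. by move=> xt st; apply/negP=> xs; have := x_switch cf xs xt; alia. Qed.

Lemma yo_ge s t : yi s -> s <= t -> ~~ yo t.
Proof. by move=> ys st; apply/negP=> yt; have := y_switch cf ys yt; alia. Qed.

Lemma exhaust lx ly s : uniq lx -> uniq ly -> size lx + size ly = 2 ->
  (forall s, s \in lx -> [/\ s <= N, ~~ xo s & ~~ xi s]) ->
  (forall s, s \in ly -> [/\ s <= N, ~~ yo s & ~~ yi s]) ->
  s <= N -> (s \notin lx -> xo s || xi s) /\ (s \notin ly -> yo s || yi s).
Proof.
move=> ux uy sz hx hy sN; split=> sl; apply/negPn/negP; rewrite negb_or => /andP[no ni].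
  suff : size (s :: lx) + size ly <= 2 by rewrite addSn sz.
  apply: (blank2 cf) => //=; first by rewrite sl.
  by move=> t; rewrite inE => /orP[/eqP->|/hx].
suff : size lx + size (s :: ly) <= 2 by rewrite addnS sz.
apply: (blank2 cf) => //=; first by rewrite sl.
by move=> t; rewrite inE => /orP[/eqP->|/hy].
Qed.

Lemma crossing_bounds c : xo c -> yi c.+1 -> 0 < c /\ c.+1 < N.
Proof.
move=> xc yc; have [t yt t0] := yo2 cf; have [t' xt' t'N] := xi2 cf.
by have := y_switch cf yc yt; have := x_switch cf xt' xc; alia.
Qed.

(** The two blanks of [x] exhaust the allowance, so [y] has none. A jump over the last out-slot of
    [x] must again start at [u0]. It crosses if [u0] is an out-slot of [y]; if [u0] is an in-slot of
    [y], a jump over [u0.-1] crosses. *)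
Lemma two_low_blanks c u0 v0 : xo c -> yi c.+1 -> 0 < u0 -> u0 <= c -> c < v0 ->
  v0 < N -> jmp u0 v0 -> ~~ xo u0 -> ~~ xo u0.+1 -> u0.+1 < c -> False.
Proof.
move=> xc yc u00 u0c cv0 v0N juv nxu nxu1 u1c.
have hx s : s \in [:: u0; u0.+1] -> [/\ s <= N, ~~ xo s & ~~ xi s].
  by rewrite !inE => /orP[]/eqP->; split=> //; try alia; apply: (xi_ge xc); alia.
have hy s : s \in ([::] : seq nat) -> [/\ s <= N, ~~ yo s & ~~ yi s] by [].
have u2 : uniq [:: u0; u0.+1] by rewrite /= inE; alia.
have exh s := exhaust u2 (isT : uniq [::]) (erefl 2) hx hy (s := s).
have yin s : c < s -> s <= N -> yi s.
  move=> cs sN; have [_ /(_ isT)/orP[ys|//]] := exh s sN.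
  by move: (yo_ge yc cs); rewrite ys.
have [f fmax] : exists f, [/\ xo f, c <= f & forall s, xo s -> s <= f].
  have [||f xf maxf] := @ex_maxnP xo N; first by exists c.
    by move=> s /(xo_lt cf) /ltnW.
  by exists f; split=> //; apply: maxf.
case: fmax => xf cf' fmax.
have [f0 fN] := crossing_bounds xf (yin f.+1 ltac:(alia) ltac:(have := xo_lt cf xf; alia)).
have [u [v [u_0 uf fv vN jmp_uv]]] := cut_jump cf f0 fN.
have yv : yi v by apply: yin; alia.
have xu : ~~ xo u.
  by apply/negP=> xu; apply: (@cross u v) => //; alia.
have uf' : u < f by rewrite ltn_neqAle uf andbT; apply: contraNneq xu => ->.
have nxi_u : ~~ xi u by apply: xi_ge xf _.
have xu1 : ~~ xo u.+1.
  by apply/negP=> xu1; apply: (@cross_low u v) => //; alia.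
have uf2 : u.+1 < f by rewrite ltn_neqAle uf' andbT; apply: contraNneq xu1 => ->.
have eu : u = u0.
  have [h _] := exh u ltac:(alia); have [h1 _] := exh u.+1 ltac:(alia).
  have : u \in [:: u0; u0.+1].
    by apply/negPn/negP=> /h; rewrite (negPf xu) (negPf nxi_u).
  have : u.+1 \in [:: u0; u0.+1].
    by apply/negPn/negP=> /h1; rewrite (negPf xu1) (negPf (xi_ge xf uf')).
  by rewrite !inE; alia.
rewrite eu {u eu u_0 xu nxi_u xu1} in uf jmp_uv uf' uf2 *.
have xiv : xi v.
  have [h _] := exh v ltac:(alia); have /orP[/fmax|//] : xo v || xi v; last by alia.
  by apply: h; rewrite !inE; alia.
have [_ /(_ isT)/orP[yu0|yiu0]] := exh u0 ltac:(alia).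
  by apply: (@cross' u0 v) => //; alia.
have [t yt t0] := yo2 cf; have tu0 := y_switch cf yiu0 yt.
have [||u' [v' [u'0 u'u0 u0v' v'N jmp']]] := cut_jump cf (c := u0.-1); try alia.
have xu' : xo u'.
  have [h _] := exh u' ltac:(alia); have /orP[//|xiu'] : xo u' || xi u'.
    by apply: h; rewrite !inE; alia.
  by have := x_switch cf xiu' xf; alia.
have yv' : yi v'.
  have [_ /(_ isT)/orP[yv'|//]] := exh v' ltac:(alia).
  by have := y_switch cf yiu0 yv'; alia.
by apply: (@cross u' v') => //; alia.
Qed.

(** Mirror image of [two_low_blanks], with the first in-slot of [y] for the last out-slot of [x]. *)
Lemma two_high_blanks c u0 v0 : xo c -> yi c.+1 -> 0 < u0 -> u0 <= c -> c < v0 ->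
  v0 < N -> jmp u0 v0 -> ~~ yi v0 -> ~~ yi v0.-1 -> c.+1 < v0.-1 -> False.
Proof.
move=> xc yc u00 u0c cv0 v0N juv nyv nyv1 cv1.
have hy s : s \in [:: v0; v0.-1] -> [/\ s <= N, ~~ yo s & ~~ yi s].
  by rewrite !inE => /orP[]/eqP->; split=> //; try alia; apply: (yo_ge yc); alia.
have hx s : s \in ([::] : seq nat) -> [/\ s <= N, ~~ xo s & ~~ xi s] by [].
have u2 : uniq [:: v0; v0.-1] by rewrite /= inE; alia.
have exh s := exhaust (isT : uniq [::]) u2 (erefl 2) hx hy (s := s).
have xin s : s <= c -> xo s.
  move=> sc; have [/(_ isT)/orP[//|xs] _] := exh s ltac:(have := xo_lt cf xc; alia).
  by move: (xi_ge xc sc); rewrite xs.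
have [g gmin] : exists g, [/\ yi g, g <= c.+1 & forall s, yi s -> g <= s].
  have [|g yg ming] := @ex_minnP yi; first by exists c.+1.
  by exists g; split=> //; apply: ming.
case: gmin => yg gc gmin; have g0 : 0 < g by have := yi_gt cf yg; alia.
have [f0 fN] := @crossing_bounds g.-1 (xin g.-1 ltac:(alia)) ltac:(by rewrite prednK).
have [u [v [u_0 uf fv vN jmp_uv]]] := cut_jump cf f0 fN.
have xu : xo u by apply: xin; alia.
have yv : ~~ yi v.
  by apply/negP=> yv; apply: (@cross u v) => //; alia.
have gv : g < v by have : g != v by [apply: contraNneq yv => <-]; alia.
have nyo_v : ~~ yo v by apply: yo_ge yg _; alia.
have yv1 : ~~ yi v.-1.
  by apply/negP=> yv1; apply: (@cross_high u v) => //; alia.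
have gv1 : g < v.-1 by have : g != v.-1 by [apply: contraNneq yv1 => <-]; alia.
have nyo_v1 : ~~ yo v.-1 by apply: yo_ge yg _; alia.
have ev : v = v0.
  have [_ h] := exh v ltac:(alia); have [_ h1] := exh v.-1 ltac:(alia).
  have : v \in [:: v0; v0.-1].
    by apply/negPn/negP=> /h; rewrite (negPf yv) (negPf nyo_v).
  have : v.-1 \in [:: v0; v0.-1].
    by apply/negPn/negP=> /h1; rewrite (negPf yv1) (negPf nyo_v1).
  by rewrite !inE; alia.
rewrite ev {v ev yv nyo_v yv1 nyo_v1} in fv vN jmp_uv gv gv1 *.
have you : yo u.
  have [_ h] := exh u ltac:(alia); have /orP[//|/gmin] : yo u || yi u; last by alia.
  by apply: h; rewrite !inE; alia.
have [/(_ isT)/orP[xov|xiv] _] := exh v0 ltac:(alia); last first.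
  by apply: (@cross' u v0) => //; alia.
have [t xt tN] := xi2 cf; have tv0 := x_switch cf xt xov.
have [||u' [v' [u'0 u'v0 v0v' v'N jmp']]] := cut_jump cf (c := v0); try alia.
have yv' : yi v'.
  have [_ h] := exh v' ltac:(alia); have /orP[yov'|//] : yo v' || yi v'.
    by apply: h; rewrite !inE; alia.
  by have := y_switch cf yg yov'; alia.
have xu' : xo u'.
  have [/(_ isT)/orP[//|xu'] _] := exh u' ltac:(alia).
  by have := x_switch cf xu' xov; alia.
by apply: (@cross u' v') => //; alia.
Qed.

(** For a jump over [c] from [u0] to [v0], the slots from [u0] to the next out-slot of [x] are blank
    for [x], and those from the preceding in-slot of [y] to [v0] are blank for [y]. One blank at
    either end is tolerated by [cross_xy]; two at the same end were excluded above. *)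
Lemma no_crossing c : xo c -> yi c.+1 -> False.
Proof.
move=> xc yc; have [c0 cN] := crossing_bounds xc yc.
have [u0 [v0 [u00 u0c cv0 v0N juv]]] := cut_jump cf c0 cN.
have [u [/andP[u0u uc] xu ltu]] := first_out u0c xc.
have [v [/andP[cv vv0] yv ltv]] := last_in cv0 yc.
have bu s : u0 <= s < u -> ~~ xo s && ~~ xi s.
  by move=> h; rewrite ltu // (xi_ge xu) //; alia.
have bv s : v < s <= v0 -> ~~ yo s && ~~ yi s.
  by move=> h; rewrite ltv // (yo_ge yv) //; alia.
have bnd : (u - u0) + (v0 - v) <= 2.
  have := @blank2 _ _ _ _ _ _ cf (iota u0 (u - u0)) (iota v.+1 (v0 - v)).
  rewrite !iota_uniq !size_iota; apply=> // s; rewrite mem_iota => h.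
    by have /andP[] := bu s ltac:(alia); split=> //; alia.
  by have /andP[] := bv s ltac:(alia); split=> //; alia.
have [le1|gt1] := leqP u u0.+1; last first.
  apply: (@two_low_blanks c u0 v0) => //; try alia; apply: ltu; alia.
have [le2|gt2] := leqP v0 v.+1; last first.
  apply: (@two_high_blanks c u0 v0) => //; try alia; apply: ltv; alia.
apply: (cross_xy cf (u0 := u0) (u := u) (v := v) (v0 := v0)) => //; try alia.
- by move=> h; apply: bu; alia.
- by move=> h; apply: bv; alia.
Qed.

Lemma max_out : exists2 f, xo f & forall s, xo s -> s <= f.
Proof.
have [||f xf maxf] := @ex_maxnP xo N; first by exists 0; apply: xo0 cf.
  by move=> s /(xo_lt cf) /ltnW.
by exists f.
Qed.

Lemma min_in : exists2 g, yi g & forall s, yi s -> g <= s.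
Proof.
have [|g yg ming] := @ex_minnP yi; first by exists N; apply: yiN cf.
by exists g.
Qed.

(** Without crossings, [g.-1] is blank for [x] and [f.+1] for [y]; this determines all other slots
    and forces [f = g]. The jumps over [f.-1] and [f] can then only be those to the next slot, and a
    jump on either side chains with one of them into a [twin] splicing. Only [f = 2], [N = 4] leaves
    no room for it, which [blank_size] excludes. *)
Lemma far_blanks f g : xo f -> (forall s, xo s -> s <= f) ->
  yi g -> (forall s, yi s -> g <= s) -> g <= f ->
  (forall c, xo c -> ~~ yi c.+1) -> False.
Proof.
move=> xf fmax yg gmin gf nocr.
have g0 : 0 < g by have := yi_gt cf yg; alia.
have fN : f < N := xo_lt cf xf.
have nxg : ~~ xo g.-1 by apply/negP=> /nocr; rewrite prednK // yg.
have hx s : s \in [:: g.-1] -> [/\ s <= N, ~~ xo s & ~~ xi s].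
  by rewrite inE => /eqP->; split=> //; [alia|apply: (xi_ge xf); alia].
have hy s : s \in [:: f.+1] -> [/\ s <= N, ~~ yo s & ~~ yi s].
  by rewrite inE => /eqP->; split=> //; [apply: (yo_ge yg); alia|apply: nocr].
have exh s := exhaust (isT : uniq [:: g.-1]) (isT : uniq [:: f.+1]) (erefl 2) hx hy (s := s).
have egf : g = f.
  apply/eqP; rewrite eqn_leq gf leqNgt; apply/negP=> lt.
  have xg : xo g.
    have [h _] := exh g ltac:(alia); have /orP[//|xig] : xo g || xi g.
      by apply: h; rewrite inE; alia.
    by move: (xi_ge xf gf); rewrite xig.
  have := nocr _ xg; have [_ h] := exh g.+1 ltac:(alia).
  have : yo g.+1 || yi g.+1 by apply: h; rewrite inE; alia.
  by rewrite (negPf (yo_ge yg (leqnSn g))) /= => ->.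
rewrite {g}egf in yg gmin g0 nxg gf hx hy exh *.
have f1 : 1 < f.
  have : f.-1 != 0 by apply: contraNneq nxg => ->; apply: xo0 cf.
  by alia.
have fN1 : f.+1 < N.
  have [_ _ nyf] := hy f.+1 (mem_head _ _).
  have : f.+1 != N by apply: contraNneq nyf => ->; apply: yiN cf.
  by alia.
have xlow s : s < f.-1 -> xo s.
  move=> sf; have [h _] := exh s ltac:(alia); have /orP[//|xis] : xo s || xi s.
    by apply: h; rewrite inE; alia.
  by move: (xi_ge xf (ltac:(alia) : s <= f)); rewrite xis.
have xhigh s : f < s -> s <= N -> xi s.
  move=> sf sN; have [h _] := exh s sN; have /orP[/fmax|//] : xo s || xi s.
    by apply: h; rewrite inE; alia.
  by alia.
have ylow s : s < f -> yo s.
  move=> sf; have [_ h] := exh s ltac:(alia); have /orP[//|/gmin] : yo s || yi s.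
    by apply: h; rewrite inE; alia.
  by alia.
have yhigh s : f.+1 < s -> s <= N -> yi s.
  move=> sf sN; have [_ h] := exh s sN; have /orP[yos|//] : yo s || yi s.
    by apply: h; rewrite inE; alia.
  by move: (yo_ge yg (ltac:(alia) : f <= s)); rewrite yos.
have [_ nyo1 nyi1] := hy f.+1 (mem_head _ _).
have [_ nxo1 nxi1] := hx f.-1 (mem_head _ _).
have over1 u v : 0 < u -> u <= f.-1 -> f.-1 < v -> v < N -> jmp u v -> u = f.-1 /\ v = f.
  move=> u0 uf fv vN j.
  have [lt_u|ge_u] := ltnP u f.-1.
    have [ev|nv] := eqVneq v f.+1.
      have [] := @cross_high u v => //; rewrite ?ev //; try alia; exact: xlow.
    have [] := @cross u v => //; first by alia.
      exact: xlow.
    by have [->|nvf] := eqVneq v f; rewrite ?yg //; apply: yhigh; alia.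
  have eu : u = f.-1 by alia.
  split=> //; apply/eqP/negPn/negP=> nvf.
  have [ev|nv] := eqVneq v f.+1.
    have [] := @cross' u v => //; try alia; first by apply: ylow; alia.
    by apply: xhigh; alia.
  have [] := @cross_low u v => //; rewrite ?eu ?prednK //; try alia.
  by apply: yhigh; alia.
have [||u1 [v1 [u10 u1f fv1 v1N j1]]] := cut_jump cf (c := f.-1); try alia.
have [eu1 ev1] := over1 _ _ u10 u1f fv1 v1N j1; rewrite eu1 ev1 in j1.
have over2 u v : 0 < u -> u <= f -> f < v -> v < N -> jmp u v -> u = f /\ v = f.+1.
  move=> u0 uf fv vN j; have [lt_u|ge_u] := leqP u f.-1.
    by have [_] := over1 u v u0 lt_u ltac:(alia) vN j; alia.
  have eu : u = f by alia.
  split=> //; apply/eqP/negPn/negP=> nv.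
  by have [] := @cross u v => //; rewrite ?eu //; try alia; apply: yhigh; alia.
have [||u2 [v2 [u20 u2f fv2 v2N j2]]] := cut_jump cf (c := f); try alia.
have [eu2 ev2] := over2 _ _ u20 u2f fv2 v2N j2; rewrite eu2 ev2 in j2.
have [ltf|gef] := ltnP f.+2 N.
  have [||u3 [v3 [u30 u3f fv3 v3N j3]]] := cut_jump cf (c := f.+1); try alia.
  have [le|gt] := leqP u3 f; first by have [] := over2 u3 v3 u30 le ltac:(alia) v3N j3; alia.
  have eu3 : u3 = f.+1 by alia.
  rewrite eu3 in j3; apply: (twin_x cf _ _ fv3 v3N j2 j3 xf); try alia.
  by apply: xhigh; alia.
have [gtf|lef] := ltnP 2 f.
  have [||u3 [v3 [u30 u3f fv3 v3N j3]]] := cut_jump cf (c := f.-2); try alia.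
  have [lt|le] := ltnP f.-1 v3.
    by have [] := over1 u3 v3 u30 ltac:(alia) lt v3N j3; alia.
  have ev3 : v3 = f.-1 by alia.
  rewrite ev3 in j3; apply: (twin_y cf u30 _ _ _ j3 j1 _ yg); try alia.
  by apply: ylow; alia.
have := @blank_size _ _ _ _ _ _ cf f.-1 f; rewrite prednK // nxo1 nyi1.
rewrite (xi_ge xf (leqnn f)) (yo_ge yg (leqnn f)).
by move=> /(_ ltac:(alia) fN isT isT isT isT); alia.
Qed.

End Crossing.

(** If [q < f], both blanks are [f] and [f.+1] for [y]; the only jump over [f] goes to [f.+1], and
    it forms with its neighbours on both sides the pattern of [triple_xy]. If [q = f], slot [f.+1]
    is blank for both, every jump over [f] ends there, and the next one completes [twin_x]. *)
Lemma near_blanks N xo xi yo yi jmp f f' q q' : crossing_free N xo xi yo yi jmp ->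
  xo f -> (forall s, xo s -> s <= f) -> xi f' -> (forall s, xi s -> f' <= s) ->
  yo q -> (forall s, yo s -> s <= q) -> yi q' -> (forall s, yi s -> q' <= s) ->
  (forall c, xo c -> ~~ yi c.+1) -> (forall c, yo c -> ~~ xi c.+1) ->
  q <= f -> f < q' -> q < f' -> False.
Proof.
move=> cf xf fmax xf' fmin yq qmax yq' qmin nocr nocr' qf fq' qf'.
have ff' : f < f' := x_switch cf xf' xf.
have f'N := xi_gt cf xf'; have q'N := yi_gt cf yq'.
have nyo s : q < s -> ~~ yo s by move=> h; apply/negP=> /qmax; alia.
have nyi s : s < q' -> ~~ yi s by move=> h; apply/negP=> /qmin; alia.
have nxo s : f < s -> ~~ xo s by move=> h; apply/negP=> /fmax; alia.
have nxi s : s < f' -> ~~ xi s by move=> h; apply/negP=> /fmin; alia.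
have [t xt t0] := xo2 cf; have f0 : 0 < f by have := fmax _ xt; alia.
have [t1 yt1 t10] := yo2 cf; have q0 : 0 < q by have := qmax _ yt1; alia.
have [t2 xt2 t2N] := xi2 cf; have f'1 : f' < N by have := fmin _ xt2; alia.
have [t3 yt3 t3N] := yi2 cf; have q'1 : q' < N by have := qmin _ yt3; alia.
have [ltqf|geqf] := ltnP q f.
  have hy s : s \in [:: f; f.+1] -> [/\ s <= N, ~~ yo s & ~~ yi s].
    rewrite !inE => /orP[]/eqP->; split=> //; try alia.
    - by apply: nyo.
    - by apply: nyi.
    - by apply: nyo; alia.
    - exact: nocr.
  have hx s : s \in ([::] : seq nat) -> [/\ s <= N, ~~ xo s & ~~ xi s] by [].
  have u2 : uniq [:: f; f.+1] by rewrite /= inE; alia.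
  have exh s := exhaust cf (isT : uniq [::]) u2 (erefl 2) hx hy (s := s).
  have xlow s : s <= f -> xo s.
    move=> sf; have [/(_ isT)/orP[//|xis] _] := exh s ltac:(alia).
    by move: (nxi s ltac:(alia)); rewrite xis.
  have xhigh s : f < s -> s <= N -> xi s.
    move=> sf sN; have [/(_ isT)/orP[xos|//] _] := exh s sN.
    by move: (nxo s sf); rewrite xos.
  have ylow s : s < f -> yo s.
    move=> sf; have [_ h] := exh s ltac:(alia); have /orP[//|yis] : yo s || yi s.
      by apply: h; rewrite !inE; alia.
    by move: (nyi s ltac:(alia)); rewrite yis.
  have yhigh s : f.+1 < s -> s <= N -> yi s.
    move=> sf sN; have [_ h] := exh s sN; have /orP[yos|//] : yo s || yi s.
      by apply: h; rewrite !inE; alia.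
    by move: (nyo s ltac:(alia)); rewrite yos.
  have over u v : 0 < u -> u <= f -> f < v -> v < N -> jmp u v -> u = f /\ v = f.+1.
    move=> u0 uf fv vN j; have [ltv|gev] := ltnP f.+1 v.
      have [] := @cross _ _ _ _ _ _ cf u v => //; try alia; first exact: xlow.
      by apply: yhigh; alia.
    split; last by alia.
    apply/eqP/negPn/negP=> nu; have [] := @cross' _ _ _ _ _ _ cf u v => //; try alia.
      by apply: ylow; alia.
    by apply: xhigh; alia.
  have [||u1 [v1 [u10 u1f fv1 v1N j1]]] := cut_jump cf (c := f); try alia.
  have [e1 e2] := over _ _ u10 u1f fv1 v1N j1; rewrite e1 e2 in j1.
  have [||u2' [v2 [u20 u2f fv2 v2N j2]]] := cut_jump cf (c := f.-1); try alia.
  have [gt|le] := ltnP f v2; first by have [] := over u2' v2 u20 ltac:(alia) gt v2N j2; alia.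
  have e3 : v2 = f by alia.
  have [||u3 [v3 [u30 u3f fv3 v3N j3]]] := cut_jump cf (c := f.+1).
  - by [].
  - by have := yi_gt cf yq'; have := nocr f xf; have : q' != f.+1
      by [apply: contraTneq yq' => ->; apply: nocr]; alia.
  have [le3|gt3] := leqP u3 f; first by have [] := over u3 v3 u30 le3 ltac:(alia) v3N j3; alia.
  have e4 : u3 = f.+1 by alia.
  rewrite e3 in j2; rewrite e4 in j3.
  apply: (triple_xy cf u20 _ fv3 v3N j1 j2 j3); first by alia.
    by apply: xlow; alia.
  by apply: yhigh; alia.
have eq : q = f by alia.
rewrite eq in yq qmax qf' nyo q0 *.
have hy s : s \in [:: f.+1] -> [/\ s <= N, ~~ yo s & ~~ yi s].
  rewrite inE => /eqP->; split=> //; try alia; first exact: nyo.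
  exact: nocr.
have hx s : s \in [:: f.+1] -> [/\ s <= N, ~~ xo s & ~~ xi s].
  rewrite inE => /eqP->; split=> //; try alia; first exact: nxo.
  exact: nocr'.
have exh s := exhaust cf (isT : uniq [:: f.+1]) (isT : uniq [:: f.+1]) (erefl 2) hx hy (s := s).
have xlow s : s <= f -> xo s.
  move=> sf; have [h _] := exh s ltac:(alia); have /orP[//|xis] : xo s || xi s.
    by apply: h; rewrite inE; alia.
  by move: (nxi s ltac:(alia)); rewrite xis.
have xhigh s : f.+1 < s -> s <= N -> xi s.
  move=> sf sN; have [h _] := exh s sN; have /orP[xos|//] : xo s || xi s.
    by apply: h; rewrite inE; alia.
  by move: (nxo s ltac:(alia)); rewrite xos.
have yhigh s : f.+1 < s -> s <= N -> yi s.
  move=> sf sN; have [_ h] := exh s sN; have /orP[yos|//] : yo s || yi s.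
    by apply: h; rewrite inE; alia.
  by move: (nyo s ltac:(alia)); rewrite yos.
have over u v : 0 < u -> u <= f -> f < v -> v < N -> jmp u v -> v = f.+1.
  move=> u0 uf fv vN j; apply/eqP/negPn/negP=> nv.
  have [] := @cross _ _ _ _ _ _ cf u v => //; try alia; first exact: xlow.
  by apply: yhigh; alia.
have f'2 : f' != f.+1 by apply: contraTneq xf' => ->; apply: nocr'.
have [||u1 [v1 [u10 u1f fv1 v1N j1]]] := cut_jump cf (c := f); try alia.
have e1 := over _ _ u10 u1f fv1 v1N j1.
have [||u2 [v2 [u20 u2f fv2 v2N j2]]] := cut_jump cf (c := f.+1); try alia.
have [le|gt] := leqP u2 f; first by have := over u2 v2 u20 le ltac:(alia) v2N j2; alia.
have e2 : u2 = f.+1 by alia.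
rewrite e1 in j1; rewrite e2 in j2.
apply: (twin_x cf u10 _ fv2 v2N j1 j2); first by alia.
  exact: xlow.
by apply: xhigh; alia.
Qed.

Theorem crossing_free_false N xo xi yo yi jmp : crossing_free N xo xi yo yi jmp -> False.
Proof.
move=> cf; have cf' := crossing_free_swap cf.
have nocr c : xo c -> ~~ yi c.+1 by move=> xc; apply/negP; apply: no_crossing cf _ xc.
have nocr' c : yo c -> ~~ xi c.+1 by move=> xc; apply/negP; apply: no_crossing cf' _ xc.
have [f xf fmax] := max_out cf; have [q yq qmax] := max_out cf'.
have [q' yq' qmin] := min_in cf; have [f' xf' fmin] := min_in cf'.
have [q'f|fq'] := leqP q' f; first exact: (far_blanks cf xf fmax yq' qmin).
have [f'q|qf'] := leqP f' q; first exact: (far_blanks cf' yq qmax xf' fmin).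
have [qf|fq] := leqP q f.
  exact: (near_blanks cf xf fmax xf' fmin yq qmax yq' qmin).
exact: (near_blanks cf' yq qmax yq' qmin xf fmax xf' fmin nocr' nocr (ltnW fq)).
Qed.

(** * Splicing [z] and the gap along jumping arcs *)

Section Config.

Variables (V : finType) (e : rel V) (z : V) (k : nat) (P R : seq V).
Hypothesis ce : counterexample e z k.
Hypothesis cf : config e z P R.

Let irr := ce_irr ce.
Notation N := (size P).
Notation p := (nth z P).
Notation S := (seg P).
Let R_large := R_large ce cf.
Let R_small := R_small ce cf.
Let bseg := bseg ce cf.
Let cnt := count_config cf.
Let cseg := @count_seg V P.

Hypothesis conn : forall w w', w \in R -> w' \in R -> w != w' -> R_path e z R w w'.

Definition Rout s := has (fun y => outs e z P y s) R.
Definition Rin s := has (fun y => ins e z P y s) R.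

Lemma Rout_mem y s : y \in R -> outs e z P y s -> Rout s.
Proof. by move=> yR o; apply/hasP; exists y. Qed.

Lemma Rin_mem y s : y \in R -> ins e z P y s -> Rin s.
Proof. by move=> yR i; apply/hasP; exists y. Qed.

Lemma Rexcl s : Rout s -> ~~ Rin s.
Proof.
move=> /hasP[b bR' ob]; apply/negP=> /hasP[a aR ia].
have [eab|ab] := eqVneq a b; first by move: (R_excl ce cf bR' ob); rewrite -eab ia.
have [Q [T [bQ pQ hQ lQ _]]] := conn aR bR' ab.
by apply: (no_insertion ce cf bQ pQ (s := s)); rewrite ?hQ ?lQ.
Qed.

Definition linked s t := exists Q T,
  [/\ block e Q, perm_eq (Q ++ T) R, ins e z P (head z Q) s, outs e z P (last z Q) t
    & 2 <= size Q].

(* All links between the slots [s] and [t] go through the same vertex, so no path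
   with two vertices serves. *)
Definition singly_linked s t w := [/\ w \in R, ins e z P w s, outs e z P w t
  & forall y, y \in R -> y != w -> ~~ ins e z P y s /\ ~~ outs e z P y t].

Lemma linked_or_single s t : Rin s -> Rout t -> linked s t \/ exists w, singly_linked s t w.
Proof.
have link a b : a \in R -> b \in R -> a != b -> ins e z P a s -> outs e z P b t -> linked s t.
  move=> aR bR' ab ia ob; have [Q [T [bQ pQ hQ lQ szQ]]] := conn aR bR' ab.
  by exists Q, T; rewrite hQ lQ.
move=> /hasP[a aR ia] /hasP[b bR' ob].
have [eab|ab] := eqVneq a b; last by left; apply: link ab ia ob.
rewrite -{b}eab in bR' ob.
have [/hasP[y yR /andP[ya /orP[iy|oy]]]|/hasPn none] :=
  boolP (has (fun y => (y != a) && (ins e z P y s || outs e z P y t)) R).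
- by left; apply: link ya iy ob.
- by left; apply: link ia oy; rewrite // eq_sym.
right; exists a; split=> // y yR ya; apply/andP; rewrite -negb_or.
by have := none y yR; rewrite ya.
Qed.

(** By [Rexcl] the other vertices of [R] are blank at [s] and [t]. [R_budget] allows two blanks only
    if [size R = k + 4], and then nothing else is missing at these vertices. *)
Lemma single_exact s t w : s != t -> singly_linked s t w ->
  size R = k + 4 /\ forall y, y \in R -> y != w ->
  (forall y', y' \in R -> y != y' -> e y y' && e y' y) /\
  forall u, u <= N -> u != s -> u != t -> outs e z P y u || ins e z P y u.
Proof.
move=> st [wR iw ow other].
have bl y u : y \in R -> y != w -> u \in [:: s; t] ->
    [/\ u <= N, ~~ outs e z P y u & ~~ ins e z P y u].
  move=> yR yw; have [ny1 ny2] := other y yR yw.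
  rewrite !inE => /orP[]/eqP->; split=> //.
  - by have /andP[] := ins_gt iw.
  - by apply: contraL (Rin_mem wR iw) => /(Rout_mem yR)/Rexcl.
  - exact: ltnW (outs_lt ow).
  - by apply: contra (Rexcl (Rout_mem wR ow)) => /(Rin_mem yR).
have [y0 y0R y0w] : exists2 y, y \in R & y != w.
  have : has (predC1 w) R.
    apply/negPn/negP=> /hasPn all_w.
    have : size R <= size [:: w].
      by apply: uniq_leq_size (uniq_R cf) _ => y /all_w /negPn; rewrite inE.
    by move: R_large => /=; clia.
  by case/hasP=> y yR yw; exists y.
have u2 : uniq [:: s; t] by rewrite /= inE st.
have bud y : y \in R -> y != w -> 2 + size R + k <= degin e y R.
  by move=> yR yw; apply: (@R_budget V e z k P R ce cf y [:: s; t]) => // u; apply: bl.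
have szR : size R = k + 4.
  have := bud _ y0R y0w; have := degin_irr irr y0R; move: R_small; clia.
split=> // y yR yw; split=> [y' y'R yy'|u uN us ut].
  have := degin_missing irr yR y'R yy'; move: (bud y yR yw); rewrite szR; clear.
  by case: (e y y'); case: (e y' y) => //= *; lia.
apply/negPn/negP; rewrite negb_or => /andP[no ni].
have : size [:: u; s; t] + size R + k <= degin e y R.
  apply: (R_budget ce cf yR); first by rewrite /= !inE negb_or us ut st.
  by move=> v; rewrite inE => /orP[/eqP->|/bl]; [|apply].
by have := degin_irr irr yR; rewrite szR /=; clia.
Qed.

Lemma single_blank s t w u : s != t -> singly_linked s t w -> u <= N ->
  Rout u || Rin u.
Proof.
move=> st sl uN; have [szR ex] := single_exact st sl; case: (sl) => wR iw ow _.
have [->|us] := eqVneq u s; first by rewrite (Rin_mem wR iw) orbT.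
have [->|ut] := eqVneq u t; first by rewrite (Rout_mem wR ow).
have [y0 y0R y0w] : exists2 y, y \in R & y != w.
  have : has (predC1 w) R.
    apply/negPn/negP=> /hasPn all_w.
    have : size R <= size [:: w].
      by apply: uniq_leq_size (uniq_R cf) _ => y /all_w /negPn; rewrite inE.
    by move: R_large => /=; clia.
  by case/hasP=> y yR yw; exists y.
have [_ h] := ex y0 y0R y0w.
by have /orP[/(Rout_mem y0R)->|/(Rin_mem y0R)->] := h u uN us ut; rewrite ?orbT.
Qed.

(* Contradicts [cf_min]: the vertices of [R] other than [w] would be a shorter gap. *)
Lemma single_close s t w B bs : s != t -> singly_linked s t w ->
  block e B -> all (block e) bs -> chain e z z (B :: bs) z ->
  (forall R2, perm_eq (w :: R2) R -> perm_eq (z :: B ++ flatten bs ++ R2) (enum V)) ->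
  (forall y, y \in R -> y != w -> e (last z (B ++ flatten bs)) y /\ e y (head z B)) -> False.
Proof.
move=> st sl bB bbs ch pV links; have [szR ex] := single_exact st sl; case: (sl) => wR _ _ _.
have pR : perm_eq (w :: rem w R) R by rewrite perm_sym perm_to_rem.
have uR : uniq (w :: rem w R) by rewrite (perm_uniq pR) (uniq_R cf).
have mem2 y : y \in rem w R -> (y \in R) && (y != w).
  move=> yr; rewrite (mem_rem yr) /=; apply: contraTneq uR => yw.
  by rewrite /= -{1}yw yr.
have R20 : rem w R != [::].
  by rewrite -size_eq0 size_remV // szR addn4.
have b2 : block e (rem w R).
  apply: complete_block => //; first by case/andP: uR.
  move=> y y' /mem2/andP[yR yw] /mem2/andP[y'R _] yy'.
  by have [h _] := ex y yR yw; have /andP[] := h y' y'R yy'.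
have : size R <= size (flatten [:: rem w R]).
  apply: (@chain_minimal V e z P R cf B bs [:: rem w R]) => //.
  - by rewrite all_cat bbs /= b2.
  - have := mem2 _ (head_mem z R20); have := mem2 _ (last_mem z R20).
    move=> /andP[lR lw] /andP[hR hw]; have [_ l1] := links _ lR lw.
    have [h1 _] := links _ hR hw.
    have gen x A : chain e z x A (head z (rem w R)) -> chain e z x (A ++ [:: rem w R]) (head z B).
      by elim: A x => [|A0 A IHA] x /=; [move=> ->; rewrite l1|case/andP=> -> /IHA].
    apply: gen; have gen2 x A u v : chain e z x A u -> e (last x (flatten A)) v ->
        all (block e) A -> chain e z x A v.
      elim: A x => [|A0 A IHA] x //=; case/andP=> -> hA lA /andP[bA0 bA] /=.
      apply: IHA => //; rewrite last_cat in lA.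
      by case: (A0) bA0 lA.
    apply: (gen2 _ _ z) => //.
      by move: ch => /= /andP[].
    by move: h1; rewrite last_cat.
  - by rewrite flatten_cat /= cats0; apply: pV.
by rewrite /= cats0 size_remV // szR; clia.
Qed.

(** [K1] returns to the cycle by [free_skip], and [K2] may stay off since it is not adjacent to [z].
    As [Q] takes two vertices out of [R], too few are missed for [cycle_missing]; when
    [size R = k + 4], the count has no room for a vertex in [K2]. *)
Lemma template Q T W K1 K2 : block e Q -> perm_eq (Q ++ T) R -> 2 <= size Q ->
  cycle e (Q ++ W) -> z \in W -> perm_eq (W ++ K1 ++ K2) (z :: P) ->
  (forall t y, t \in K1 -> y \in R -> ~~ e t y /\ ~~ e y t) ->
  (forall t, t \in K2 -> ~~ e z t /\ ~~ e t z) ->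
  size K1 + size K2 <= size R + k -> size K2 <= 1 -> (size R = k + 4 -> K2 = [::]) ->
  False.
Proof.
move=> bQ pQ szQ cyc zW pW n1 n2 sz sz2 K20.
have [W' [cyc' zW' pW']] := free_skip ce cf bQ pQ cyc zW pW n1 sz.
have pV : perm_eq ((Q ++ W') ++ (K2 ++ T)) (enum V).
  apply: perm_trans (cf_perm cf); apply/permP=> q.
  have := permP pW' q; have := permP pQ q.
  by rewrite /= !count_cat; clia.
have TR : {subset T <= R}.
  by move=> y yT; rewrite -(perm_mem pQ) mem_cat yT orbT.
have : k + 2 + (k + 2 < size R) <= size (K2 ++ T).
  apply: (cycle_missing ce cf cyc' _ pV); first by rewrite mem_cat zW' orbT.
  move=> t; rewrite mem_cat => /orP[/n2//|tT].
  exact: (nonadj_R ce cf TR).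
have : size Q + size T = size R by rewrite -size_cat (perm_sizeV pQ).
have [szR|] := eqVneq (size R) (k + 4).
  by rewrite (K20 szR) szR /=; move: szQ; case: ltnP; clia.
rewrite size_cat; move: szQ sz2 R_large R_small; case: ltnP; clia.
Qed.

Lemma count_P (q : pred V) : count q P = count q (S 0 N).
Proof. by rewrite seg_full. Qed.

Lemma mem_segP i j t : t \in S i j -> j <= N -> exists2 s, i <= s < j & t = p s.
Proof.
move=> tS jN; have := tS; rewrite -index_mem size_seg // => lt.
exists (i + index t (S i j)); first by alia.
by rewrite -(@nth_seg V z P i j) // nth_index.
Qed.

Lemma z_nonadj_p i : i < N -> ~~ outs e z P z i -> ~~ ins e z P z i.+1 ->
  ~~ e z (p i) /\ ~~ e (p i) z.
Proof. by move=> iN; rewrite /outs /ins iN. Qed.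

Lemma R_nonadj_p i : i < N -> ~~ Rout i -> ~~ Rin i.+1 ->
  forall y, y \in R -> ~~ e (p i) y /\ ~~ e y (p i).
Proof.
move=> iN /hasPn no /hasPn ni y yR; have := no y yR; have := ni y yR.
by rewrite /outs /ins iN.
Qed.

Lemma R_blanks (l : seq nat) : uniq l ->
  (forall s, s \in l -> [/\ s <= N, ~~ Rout s & ~~ Rin s]) -> size l + k + 2 <= size R.
Proof.
move=> ul bl; have hR := head_mem z (R_neq0 ce cf).
have : size l + size R + k <= degin e (head z R) R.
  apply: (R_budget ce cf hR ul) => s /bl[sN no ni]; split=> //.
    by apply: contra no; apply: Rout_mem.
  by apply: contra ni; apply: Rin_mem.
by have := degin_irr irr hR; clia.
Qed.

Lemma z_links : e z (p 0) /\ e (p N.-1) z. Proof. exact: (zP0 ce cf). Qed.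

(** A closest in-slot [c] and later out-slot [d] bound a segment without arcs to [R]. If a path of
    two or more vertices links them, it replaces the segment, which is reinserted. If only a single
    [w] does, the segment is [p c] alone: [w] takes its place, [p c] is inserted by degree, and the
    rest of [R] becomes a shorter gap. *)
Lemma Rswitch s t : Rin s -> Rout t -> t < s.
Proof.
move=> Rs Rt; rewrite ltnNge; apply/negP=> st.
have ne : s != t by apply: contraTneq Rs => ->; apply: Rexcl.
have [|c [d [sc cd dt Rc [Rd bl]]]] := closest_switch Rs Rt _ (fun w _ => @Rexcl w).
  by alia.
have cdb : c < d <= N by case/hasP: Rd => y _ /outs_lt; alia.
have c0 : 0 < c by case/hasP: Rc => y _ /ins_gt; alia.
have dN : d < N by case/hasP: Rd => y _ /outs_lt.
have [zp pz] := z_links.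
have nadj u : c <= u < d -> forall y, y \in R -> ~~ e (p u) y /\ ~~ e y (p u).
  move=> ucd; apply: R_nonadj_p; first by alia.
    have [->|uc] := eqVneq u c; first by apply: contraL Rc; apply: Rexcl.
    by have [] := bl u _; first by alia.
  have [->|ud] := eqVneq u.+1 d; first exact: Rexcl.
  by have [] := bl u.+1 _; first by alia.
have bnd : (d - c).-1 + k + 2 <= size R.
  rewrite -(size_iota c.+1 (d - c).-1); apply: R_blanks; rewrite ?iota_uniq // => u.
  by rewrite mem_iota => h; have [] := bl u; [alia|split=> //; alia].
have [[Q [T [bQ pQ hQ lQ szQ]]]|[w sl]] := linked_or_single Rc Rd.
  have [_ hQ'] := andP hQ; have [_ lQ'] := andP lQ.
  apply: (@template Q T (S d N ++ z :: S 0 c) (S c d) [::] bQ pQ szQ) => //.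
  - have := @cycle_chain V e z Q [:: S d N; [:: z]; S 0 c] bQ.
    rewrite /= cats0 => ->; first by rewrite !head_seg ?last_seg //; try alia; rewrite lQ' pz zp hQ'.
    by rewrite !bseg //; alia.
  - by rewrite mem_cat mem_head orbT.
  - apply/permP=> q; rewrite cats0 /= !count_cat /= count_P -(@cseg q 0 c N) -?(@cseg q c d N) //; try alia.
  - by move=> t' y /mem_segP h; have [|u ucd ->] := h; [alia|apply: nadj].
  - by rewrite addn0 size_seg; alia.
have ncd : c != d by alia.
have ed : d = c.+1.
  apply/eqP/negPn/negP=> ne1; have [|nb1 nb2] := bl c.+1; first by alia.
  have cN1 : c.+1 <= N by alia.
  by have := single_blank ncd sl cN1; rewrite (negPf nb1) (negPf nb2).
have [szR ex] := single_exact ncd sl; case: (sl) => wR iw ow other.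
have [_ iw'] := andP iw; have [_ ow'] := andP ow.
have b2 : block e (w :: S d N).
  by rewrite /block /= (path_block0 z) ?bseg // head_seg.
have b1 : block e (S 0 c ++ w :: S d N).
  by rewrite (block_cat z) ?bseg ?last_seg //; alia.
have cN : c < N by alia.
have ePc : perm_eq (S 0 c ++ p c :: S d N) P.
  apply/permP=> q; rewrite count_P -(@cseg q 0 c N) -?(@cseg q c d N) //; try alia.
  by rewrite ed (seg1 z) // !count_cat /=; clia.
have szP : size (S 0 c ++ w :: S d N) = N.
  by rewrite size_cat /= !size_seg //; alia.
have dv : N + 2 * k + 3 <= degin e (p c) (S 0 c ++ w :: S d N).
  have := degin_p ce cf cN; rewrite -(degin_perm e (p c) ePc) szR.
  have hc : c <= c < d by alia.
  rewrite (@degin_nonadj V e (p c) R) ?addn0; last by move=> y yR; apply: nadj.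
  rewrite !degin_cat !degin_cons irr; have [/negPf-> /negPf->] := nadj c hc w wR.
  by have := leq_b1 (e (p c) z); have := leq_b1 (e z (p c)); clia.
have [|B [bB hB lB pB]] := @insert_block_deg V e z (p c) _ b1.
  by rewrite szP; move: dv; clia.
have hB0 : head z B = p 0.
  rewrite hB; have := @head_seg V z P 0 c c0 (ltnW cN).
  by case: (S 0 c) (@seg_neq0 V P 0 c c0 (ltnW cN)).
have lBN : last z B = p N.-1.
  rewrite lB last_cat /=; have := @last_seg V z P d N dN (leqnn N).
  by case: (S d N) (@seg_neq0 V P d N dN (leqnn N)).
apply: (@single_close c d w B [::] ncd sl bB) => //.
- by rewrite /= hB0 lBN zp pz.
- move=> R2 pR2; apply/permP=> q; rewrite cnt -count_P.
  have := permP pR2 q; have := permP ePc q; have := permP pB q.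
  by rewrite /= !count_cat /=; clia.
- move=> y yR yw; rewrite cats0 lBN hB0; have [_ nbl] := ex y yR yw; split.
    have /orP[/outs_lt|/andP[]//] := nbl N (leqnn N) ltac:(alia) ltac:(alia).
    by rewrite ltnn.
  by have /orP[/andP[]//|/ins_gt] := nbl 0 (leq0n N) ltac:(alia) ltac:(alia).
Qed.

End Config.

Section Config.

Variables (V : finType) (e : rel V) (z : V) (k : nat) (P R : seq V).
Hypothesis ce : counterexample e z k.
Hypothesis cf : config e z P R.

Let irr := ce_irr ce.
Notation N := (size P).
Notation p := (nth z P).
Notation S := (seg P).
Notation Rout := (Rout e z P R).
Notation Rin := (Rin e z P R).
Let R_large := R_large ce cf.
Let R_small := R_small ce cf.
Let N_gt0 := N_gt0 ce cf.
Let bseg := bseg ce cf.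
Let cnt := count_config cf.
Let cseg := @count_seg V P.

Lemma z_out2 : exists2 t, outs e z P z t & 0 < t.
Proof.
have [t it tN] := z_in2 (counterexample_rev ce) (config_rev cf).
rewrite size_rev in tN; exists (N - t); last by alia.
by rewrite -ins_rev // ltnW.
Qed.

Lemma mem_config x : [\/ x = z, x \in R | exists2 i, i < N & x = p i].
Proof.
have : x \in z :: P ++ R by rewrite (perm_mem (cf_perm cf)) mem_enum.
rewrite inE mem_cat => /or3P[/eqP->|xP|xR]; [exact: Or31| |exact: Or32].
by apply: Or33; exists (index x P); rewrite ?index_mem ?nth_index.
Qed.

Lemma p_notin_R i : i < N -> p i \notin R.
Proof. by move=> iN; apply/negP=> /(PR_disj cf); rewrite mem_nth. Qed.

Lemma R_out2 : exists2 t, Rout t & 0 < t.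
Proof.
have hR := head_mem z (R_neq0 ce cf).
have hp : head z R != p 0 by apply: contraTneq hR => ->; apply: p_notin_R.
have zp : z != p 0 by rewrite eq_sym; apply: (p_neq_z cf).
have [x [y [xR yR _ yp exy]]] := ce_cut ce (X := mem R) (ex_intro2 _ _ (head z R) hR hp)
  (ex_intro2 _ _ z (z_notin_R cf) zp).
have [ey|yR'|[i iN ei]] := mem_config y.
- by case/negP: (proj2 (z_nonadjacent ce cf xR)); rewrite -ey.
- by case/negP: yR.
exists i; last by rewrite lt0n; apply: contra yp => /eqP i0; rewrite ei i0.
by apply: (Rout_mem xR); rewrite /outs iN -ei.
Qed.

Lemma R_in2 : exists2 t, Rin t & t < N.
Proof.
have hR := head_mem z (R_neq0 ce cf).
have pN : N.-1 < N by rewrite prednK.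
have hp : head z R != p N.-1 by apply: contraTneq hR => ->; apply: p_notin_R.
have zp : z != p N.-1 by rewrite eq_sym; apply: (p_neq_z cf).
have [|x [y [xR yR xp _ exy]]] := ce_cut ce (X := predC (mem R)) (ex_intro2 _ _ z (z_notin_R cf) zp).
  by exists (head z R); rewrite //= hR.
have {}yR : y \in R by apply/negPn.
have [ex|xR'|[i iN ei]] := mem_config x.
- by case/negP: (proj1 (z_nonadjacent ce cf yR)); rewrite -ex.
- by case/negP: xR.
have iN1 : i != N.-1 by apply: contra xp => /eqP i0; rewrite ei i0.
exists i.+1; last by alia.
by apply: (Rin_mem yR); rewrite /ins /= iN -ei.
Qed.

Definition jump u v := e (p u.-1) (p v).

(** After deleting [p c], let [X] consist of the vertices of [P] before it, of [z] if it has an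
    in-slot up to [c], and of the vertices of [R] in [Q]. The hypotheses exclude every arc leaving
    [X] that begins or ends at [z] or in [R], so 2-strongness yields an arc of [P] over [p c]. *)
Lemma cut_jump_gen c (Q : pred V) : 0 < c -> c.+1 < N ->
  (forall s t, s <= c -> ins e z P z s -> outs e z P z t -> t <= c) ->
  (forall a s, a \in R -> s <= c -> ins e z P a s -> Q a) ->
  (forall a t, a \in R -> Q a -> outs e z P a t -> t <= c) ->
  (forall a b, a \in R -> b \in R -> e a b -> Q a -> Q b) ->
  exists u v, [/\ 0 < u, u <= c, c < v, v < N & jump u v].
Proof.
move=> c0 cN zc insQ outQ arcQ; have cN' : c < N by alia.
pose X x := [|| x \in take c P, (x == z) && has (ins e z P z) (iota 0 c.+1)
  | (x \in R) && Q x].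
have pz i : i < N -> (p i == z) = false by move=> iN; apply/negbTE/(p_neq_z cf).
have pR i : i < N -> (p i \in R) = false by move=> iN; apply/negbTE/p_notin_R.
have ptk i : i < N -> (p i \in take c P) = (i < c).
  move=> iN; rewrite in_take ?mem_nth // index_uniq ?(uniq_P cf) //; exact: mem_nth.
have Xp i : i < N -> X (p i) = (i < c) by move=> iN; rewrite /X ptk // pz // pR // !orbF.
have ztk : (z \in take c P) = false.
  by apply/negbTE; apply: contra (z_notin_P cf); apply: mem_take.
have Xz : X z = has (ins e z P z) (iota 0 c.+1).
  by rewrite /X ztk eqxx (negPf (z_notin_R cf)) orbF.
have XR y : y \in R -> X y = Q y.
  move=> yR; rewrite /X yR (negPf (R_neq_z cf yR)) /=; case: (boolP (y \in take c P)) => // /mem_take.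
  by rewrite (negPf (PR_disj cf yR)).
have neq i j : i < N -> j < N -> i != j -> p i != p j by move=> iN jN; rewrite nth_uniq ?(uniq_P cf).
have pne j : p j != p c -> j != c by apply: contra => /eqP->.
have [||x [y [Xx Xy xc yc exy]]] := ce_cut ce (a := p c) (X := X).
- by exists (p 0); rewrite ?Xp ?neq //; alia.
- by exists (p N.-1); rewrite ?Xp ?neq //; alia.
have noz s : s <= c -> ins e z P z s -> has (ins e z P z) (iota 0 c.+1).
  by move=> sc zs; apply/hasP; exists s; rewrite // mem_iota; alia.
have [ex|xR|[i iN ei]] := mem_config x; have [ey|yR|[j jN ej]] := mem_config y.
- by move: exy; rewrite ex ey irr.
- by case/negP: (proj1 (z_nonadjacent ce cf yR)); rewrite -ex.
- move: Xy yc; rewrite ej Xp // -leqNgt => jc /pne jc'; move: Xx; rewrite ex Xz => /hasP[s].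
  rewrite mem_iota => sc zs; have : j <= c by apply: (zc s) => //; move: exy; rewrite ex ej /outs jN.
  by alia.
- by case/negP: (proj2 (z_nonadjacent ce cf xR)); rewrite -ey.
- by case/negP: Xy; rewrite XR //; apply: (arcQ x) => //; rewrite -XR.
- move: Xy yc; rewrite ej Xp // -leqNgt => jc /pne jc'; move: Xx; rewrite XR // => Qx.
  have : j <= c by apply: (outQ x) => //; move: exy; rewrite ej /outs jN.
  by alia.
- move: Xx; rewrite ei Xp // => ic; move: Xy; rewrite ey Xz => /negP[].
  by apply: (noz i.+1) => //; move: exy; rewrite ei ey /ins /= iN.
- move: Xx; rewrite ei Xp // => ic; move: Xy; rewrite XR // => /negP[].
  by apply: (insQ y i.+1) => //; move: exy; rewrite ei /ins /= iN.
move: Xx xc Xy yc exy; rewrite ei ej !Xp // -leqNgt => ic _ jc pjc exy.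
have ejc := pne _ pjc.
by exists i.+1, j; rewrite /jump /=; split=> //; alia.
Qed.

Hypothesis zsw : forall s t, ins e z P z s -> outs e z P z t -> t < s.

Hypothesis conn : forall w w', w \in R -> w' \in R -> w != w' -> R_path e z R w w'.
Let Rsw := Rswitch ce cf conn.

Lemma cut_jump_P c : 0 < c -> c.+1 < N ->
  exists u v, [/\ 0 < u, u <= c, c < v, v < N & jump u v].
Proof.
(* All of [R] goes to the lower side if [R] has an in-slot up to [c], and none of it otherwise. *)
move=> c0 cN; apply: (@cut_jump_gen c (fun _ => has Rin (iota 0 c.+1))) => //.
- by move=> s t sc zs /(zsw zs); alia.
- move=> a s aR sc ia; apply/hasP; exists s; first by rewrite mem_iota; alia.
  exact: Rin_mem ia.
- move=> a t aR /hasP[s]; rewrite mem_iota => sc Rs oa.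
  by have := Rsw Rs (Rout_mem aR oa); alia.
Qed.

Lemma R0 : Rout 0.
Proof.
have [_ RP] := PR_links ce cf.
by apply: (Rout_mem (last_mem z (R_neq0 ce cf))); rewrite /outs N_gt0.
Qed.

Lemma RN : Rin N.
Proof.
have [PR _] := PR_links ce cf.
by apply: (Rin_mem (head_mem z (R_neq0 ce cf))); rewrite /ins N_gt0 leqnn.
Qed.

Lemma template_chain s t bs K1 K2 : linked e z P R s t -> all (block e) bs ->
  (forall h l, e (p s.-1) h -> e l (p t) -> chain e z l bs h) ->
  perm_eq (flatten bs ++ K1 ++ K2) (z :: P) -> z \in flatten bs ->
  (forall t y, t \in K1 -> y \in R -> ~~ e t y /\ ~~ e y t) ->
  (forall t, t \in K2 -> ~~ e z t /\ ~~ e t z) ->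
  size K1 <= 1 -> size K2 <= 1 -> (size R = k + 4 -> K2 = [::]) -> False.
Proof.
move=> [Q [T [bQ pQ hQ lQ szQ]]] bbs ch pW zW n1 n2 s1 s2 K20.
apply: (template ce cf bQ pQ szQ _ zW pW n1 n2) => //; last by alia.
rewrite (cycle_chain z) //; apply: ch; first by case/andP: hQ.
by case/andP: lQ.
Qed.

Lemma last_segx x i j : i < j -> j <= N -> last x (S i j) = p j.-1.
Proof.
move=> ij jN; rewrite -(@last_seg V z P i j) //.
by case: (S i j) (@seg_neq0 V P i j ij jN).
Qed.

Lemma count_cuts4 (q : pred V) a b c d : a <= b -> b <= c -> c <= d -> d <= N ->
  count q P = count q (S 0 a) + count q (S a b) + count q (S b c) + count q (S c d)
              + count q (S d N).
Proof.
move=> ab bc cd dN; rewrite -{1}(seg_full P) !cseg //; by alia.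
Qed.

Lemma count_cuts3 (q : pred V) a b c : a <= b -> b <= c -> c <= N ->
  count q P = count q (S 0 a) + count q (S a b) + count q (S b c) + count q (S c N).
Proof.
move=> ab bc cN; rewrite -{1}(seg_full P) !cseg //; by alia.
Qed.

Lemma z_gap i j t : i <= j <= i.+1 -> j <= N ->
  (i < j -> ~~ outs e z P z i && ~~ ins e z P z j) -> t \in S i j -> ~~ e z t /\ ~~ e t z.
Proof.
move=> ij jN h tS; have [s sij ->] := mem_segP ce cf tS jN.
have es : s = i by alia.
have ej : j = i.+1 by alia.
have [|no ni] := andP (h _); first by alia.
by rewrite es; apply: (z_nonadj_p _ no); [alia|rewrite -ej].
Qed.

Lemma R_gap i j t y : i <= j <= i.+1 -> j <= N ->
  (i < j -> ~~ Rout i && ~~ Rin j) -> t \in S i j -> y \in R -> ~~ e t y /\ ~~ e y t.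
Proof.
move=> ij jN h tS; have [s sij ->] := mem_segP ce cf tS jN.
have es : s = i by alia.
have ej : j = i.+1 by alia.
have [|no ni] := andP (h _); first by alia.
by rewrite es; apply: (R_nonadj_p _ no); [alia|rewrite -ej].
Qed.

Lemma z_blank_R s : s <= N -> ~~ outs e z P z s -> ~~ ins e z P z s -> size R != k + 4.
Proof.
move=> sN no ni; apply/eqP=> sR.
have := @blanks_z V e z k P R ce cf [:: s] isT; rewrite /= sR => /(_ _) h.
suff : 1 + (k + 4) <= k + 4 by alia.
by apply: h => u; rewrite inE => /eqP->.
Qed.

Lemma z_gap_nil i j : i <= j <= i.+1 -> j <= N ->
  (i < j -> exists s, [/\ s <= N, ~~ outs e z P z s & ~~ ins e z P z s]) ->
  size R = k + 4 -> S i j = [::].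
Proof.
move=> ij jN h sR; apply/nilP; rewrite /nilp size_seg // subn_eq0 leqNgt.
apply/negP=> /h[s [sN no ni]]; by move: (z_blank_R sN no ni); rewrite sR eqxx.
Qed.

(** The cycle is a path in [R], then [S 0 u0], [S v0 N], [z], [S u v]. It skips [S u0 u], not
    adjacent to [z], and [S v v0], not adjacent to [R]. *)
Lemma cross_zR u0 u v v0 : 0 < u0 -> u0 <= u <= u0.+1 -> u < v ->
    v <= v0 <= v.+1 -> v0 < N -> jump u0 v0 -> outs e z P z u -> linked e z P R v 0 ->
    (u0 < u -> ~~ outs e z P z u0 && ~~ ins e z P z u0) ->
    (v < v0 -> ~~ Rout v0 && ~~ Rin v0) -> False.
Proof.
move=> u00 u0u uv vv0 v0N j zu lk zb Rb.
have [zp pz] := zP0 ce cf.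
have [_ zu'] := andP zu.
have Rv : Rin v.
  case: lk => Q [T [/andP[Q0 _] pQ iQ _ _]]; apply: (Rin_mem _ iQ).
  by rewrite -(perm_mem pQ) mem_cat head_mem.
apply: (template_chain (bs := [:: S 0 u0; S v0 N; [:: z]; S u v]) (K1 := S v v0) (K2 := S u0 u) lk).
- by rewrite /= !bseg //; alia.
- move=> h l ph lp; rewrite /= !head_seg ?last_seg //; try alia.
  by rewrite lp [e _ _]j pz zu' ph.
- apply/permP=> q; rewrite /= (@count_cuts4 q u0 u v v0); try alia.
  by rewrite ?cats0 !count_cat /= ?count_cat /= ?count_cat; clia.
- by rewrite /= !mem_cat mem_head !orbT.
- move=> t y; apply: R_gap; [alia|alia|] => vv; have /andP[_ ->] := Rb vv; rewrite andbT.
  by apply: contraL Rv; apply: (Rexcl ce cf conn).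
- move=> t; apply: z_gap; [alia|alia|] => uu; have /andP[-> _] := zb uu => /=.
  exact: (z_excl ce cf zu).
- by rewrite size_seg; alia.
- by rewrite size_seg; alia.
apply: z_gap_nil; [alia|alia|] => uu; exists u0; have /andP[-> ->] := zb uu; split=> //; alia.
Qed.

(** The roles are exchanged: a path in [R], then [S u v], [z], [S 0 u0], [S v0 N]. *)
Lemma cross_Rz u0 u v v0 : 0 < u0 -> u0 <= u <= u0.+1 -> u < v ->
    v <= v0 <= v.+1 -> v0 < N -> jump u0 v0 -> linked e z P R N u -> ins e z P z v ->
    (u0 < u -> ~~ Rout u0 && ~~ Rin u0) ->
    (v < v0 -> ~~ outs e z P z v0 && ~~ ins e z P z v0) -> False.
Proof.
move=> u00 u0u uv vv0 v0N j lk zv Rb zb.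
have [zp pz] := zP0 ce cf.
have [_ zv'] := andP zv.
have Ru : Rout u.
  case: lk => Q [T [/andP[Q0 _] pQ _ oQ _]]; apply: (Rout_mem _ oQ).
  by rewrite -(perm_mem pQ) mem_cat last_mem.
apply: (template_chain (bs := [:: S u v; [:: z]; S 0 u0; S v0 N]) (K1 := S u0 u) (K2 := S v v0) lk).
- by rewrite /= !bseg //; alia.
- move=> h l ph lp; rewrite /= !head_seg ?last_seg //; try alia.
  by rewrite lp [e _ (p v0)]j zp zv' ph.
- apply/permP=> q; rewrite /= (@count_cuts4 q u0 u v v0); try alia.
  by rewrite ?cats0 !count_cat /= ?count_cat /= ?count_cat; clia.
- by rewrite /= !mem_cat mem_head !orbT.
- move=> t y; apply: R_gap; [alia|alia|] => uu; have /andP[-> _] := Rb uu => /=.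
  by have := Rexcl ce cf conn Ru.
- move=> t; apply: z_gap; [alia|alia|] => vv; have /andP[_ ->] := zb vv; rewrite andbT.
  by apply: contraL zv => /(z_excl ce cf).
- by rewrite size_seg; alia.
- by rewrite size_seg; alia.
apply: z_gap_nil; [alia|alia|] => vv; exists v0; have /andP[-> ->] := zb vv; split=> //; alia.
Qed.

(** Two jumps sharing the slot [c] permit the order [S 0 u], [S c v], [z], [S u c], [S v N], which
    uses all of [P]. *)
Lemma twin_z u c v : 0 < u -> u < c -> c < v -> v < N ->
  jump u c -> jump c v -> outs e z P z u -> ins e z P z v -> linked e z P R N 0 -> False.
Proof.
move=> u0 uc cv vN j1 j2 zu zv lk; have [_ zu'] := andP zu; have [_ zv'] := andP zv.
apply: (template_chain (bs := [:: S 0 u; S c v; [:: z]; S u c; S v N]) (K1 := [::]) (K2 := [::]) lk) => //.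
- by rewrite /= !bseg //; alia.
- move=> h l ph lp; rewrite /= !head_seg ?last_seg //; try alia.
  by rewrite lp [e _ (p c)]j1 [e _ (p v)]j2 zu' zv' ph.
- apply/permP=> q; rewrite /= (@count_cuts3 q u c v); try alia.
  by rewrite ?cats0 !count_cat /= ?count_cat /= ?count_cat; clia.
by rewrite /= !mem_cat mem_head !orbT.
Qed.

Lemma twin_R u c v : 0 < u -> u < c -> c < v -> v < N ->
  jump u c -> jump c v -> linked e z P R v u -> False.
Proof.
move=> u0 uc cv vN j1 j2 lk; have [zp pz] := zP0 ce cf.
apply: (template_chain (bs := [:: S u c; S v N; [:: z]; S 0 u; S c v]) (K1 := [::]) (K2 := [::]) lk) => //.
- by rewrite /= !bseg //; alia.
- move=> h l ph lp; rewrite /= !head_seg ?last_seg //; try alia.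
  by rewrite lp [e _ (p c)]j1 [e _ (p v)]j2 zp pz ph.
- apply/permP=> q; rewrite /= (@count_cuts3 q u c v); try alia.
  by rewrite ?cats0 !count_cat /= ?count_cat /= ?count_cat; clia.
by rewrite /= !mem_cat mem_head !orbT.
Qed.

Lemma triple_zR u m v : 0 < u -> u < m -> m.+1 < v -> v < N ->
  jump m m.+1 -> jump u m -> jump m.+1 v -> outs e z P z u -> linked e z P R v 0 -> False.
Proof.
move=> u0 um mv vN j1 j2 j3 zu lk; have [zp pz] := zP0 ce cf; have [_ zu'] := andP zu.
apply: (template_chain (bs := [:: S 0 u; S m m.+1; S v N; [:: z]; S u m; S m.+1 v])
  (K1 := [::]) (K2 := [::]) lk) => //.
- by rewrite /= !bseg //; alia.
- move=> h l ph lp; rewrite /= !head_seg ?last_seg //; try alia.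
  by rewrite lp [e _ (p m)]j2 [e _ (p v)]j3 [e _ (p m.+1)]j1 zu' pz ph.
- apply/permP=> q; rewrite /= (@count_cuts4 q u m m.+1 v); try alia.
  by rewrite ?cats0 !count_cat /= ?count_cat /= ?count_cat; clia.
by rewrite /= !mem_cat mem_head !orbT.
Qed.

Lemma triple_Rz u m v : 0 < u -> u < m -> m.+1 < v -> v < N ->
  jump m m.+1 -> jump u m -> jump m.+1 v -> ins e z P z v -> linked e z P R N u -> False.
Proof.
move=> u0 um mv vN j1 j2 j3 zv lk; have [zp pz] := zP0 ce cf; have [_ zv'] := andP zv.
apply: (template_chain (bs := [:: S u m; S m.+1 v; [:: z]; S 0 u; S m m.+1; S v N])
  (K1 := [::]) (K2 := [::]) lk) => //.
- by rewrite /= !bseg //; alia.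
- move=> h l ph lp; rewrite /= !head_seg ?last_seg //; try alia.
  by rewrite lp [e _ (p m)]j2 [e _ (p v)]j3 [e _ (p m.+1)]j1 zp zv' ph.
- apply/permP=> q; rewrite /= (@count_cuts4 q u m m.+1 v); try alia.
  by rewrite ?cats0 !count_cat /= ?count_cat /= ?count_cat; clia.
by rewrite /= !mem_cat mem_head !orbT.
Qed.

Lemma blanks_zR (lx ly : seq nat) : uniq lx -> uniq ly ->
    (forall s, s \in lx -> [/\ s <= N, ~~ outs e z P z s & ~~ ins e z P z s]) ->
    (forall s, s \in ly -> [/\ s <= N, ~~ Rout s & ~~ Rin s]) ->
  size lx + size ly <= 2.
Proof.
move=> ux uy bx by'; have := blanks_z ce cf ux bx; have := R_blanks ce cf uy by'.
by clia.
Qed.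

(** An in-slot excludes later out-slots, so one of [a], [a.+1] is blank for [z] and one of [b],
    [b.+1] for [R]; hence [size R = k + 3]. If [N = 4], then [p b], having no arcs with [R], has
    degree at most [8], so [k = 0] and there are only [8] vertices. The bound on the order enters
    here. *)
Lemma blank_sizeP a b : a < N -> b < N -> ~~ outs e z P z a -> ~~ ins e z P z a.+1 ->
    ~~ Rout b -> ~~ Rin b.+1 -> N != 4.
Proof.
move=> aN bN za za' Rb Rb'; apply/eqP=> N4.
have [la [sla no ni]] : exists s, [/\ s <= N, ~~ outs e z P z s & ~~ ins e z P z s].
  have [h|h] := boolP (ins e z P z a); last by exists a; split=> //; apply: ltnW.
  exists a.+1; split=> //; apply: contraL h => o.
  by apply/negP=> i; have := zsw i o; alia.
have [lb [slb nb nb']] : exists s, [/\ s <= N, ~~ Rout s & ~~ Rin s].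
  have [h|h] := boolP (Rin b); last by exists b; split=> //; apply: ltnW.
  exists b.+1; split=> //; apply: contraL h => o.
  by apply/negP=> i; have := Rsw i o; alia.
have sR := z_blank_R sla no ni.
have := @R_blanks V e z k P R ce cf [:: lb] isT => /(_ _) hR.
have : 1 + k + 2 <= size R by apply: hR => u; rewrite inE => /eqP->.
move=> R1; have := size_config cf; have := ce_size ce.
have nR := R_nonadj_p bN Rb Rb'.
have := degin_p ce cf bN; rewrite (@degin_nonadj V e (p b) R) ?addn0 //.
have := degin_irr irr (mem_P z bN).
have := leq_b1 (e (p b) z); have := leq_b1 (e z (p b)).
by move: sR R1 R_small; rewrite N4; clia.
Qed.

Lemma not_linked s t : Rin s -> Rout t -> ~ linked e z P R s t ->
  size R = k + 4 /\ forall u, u <= N -> Rout u || Rin u.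
Proof.
move=> Rs Rt nl; have [//|[w sl]] := linked_or_single conn Rs Rt.
have st : s != t by apply: contraTneq Rs => ->; apply: (Rexcl ce cf conn).
have [szR _] := single_exact ce cf conn st sl; split=> // u uN.
exact: (single_blank ce cf conn st sl uN).
Qed.

Lemma crossing_instance : (forall s t, Rin s -> Rout t -> linked e z P R s t) ->
  crossing_free N (outs e z P z) (ins e z P z) Rout Rin jump.
Proof.
move=> lnk; have [zp pz] := zP0 ce cf; have r0 := R0; have rN := RN.
split=> //.
- by rewrite /outs N_gt0.
- by rewrite /ins N_gt0 leqnn.
- by move=> s /outs_lt.
- by move=> s /hasP[y _ /outs_lt].
- by move=> s /ins_gt.
- by move=> s /hasP[y _ /ins_gt].
- exact: z_out2.
- exact: R_out2.
- exact: z_in2 ce cf.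
- exact: R_in2.
- exact: blanks_zR.
- exact: cut_jump_P.
- exact: blank_sizeP.
- by move=> u0 u v v0 *; apply: (@cross_zR u0 u v v0) => //; apply: lnk.
- by move=> u0 u v v0 *; apply: (@cross_Rz u0 u v v0) => //; apply: lnk.
- by move=> u c v *; apply: (@twin_z u c v) => //; apply: lnk.
- by move=> u c v *; apply: (@twin_R u c v) => //; apply: lnk.
- by move=> u m v *; apply: (@triple_zR u m v) => //; apply: lnk.
- by move=> u m v *; apply: (@triple_Rz u m v) => //; apply: lnk.
Qed.

Lemma last_out (o : pred nat) : o 0 -> (forall s, o s -> s < N) ->
  exists2 q, o q & forall s, o s -> s <= q.
Proof.
move=> o0 oN; have [|s /oN/ltnW//|q oq mq] := @ex_maxnP o N; first by exists 0.
by exists q.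
Qed.

(** A jump over the last out-slot [q] of [R] meets no blank. If [q <= f], it starts at an out-slot
    of [z] and ends at an in-slot of [R]; otherwise it starts at an out-slot of [R] and ends at an
    in-slot of [z]. It splices as in [cross_zR] or [cross_Rz], or, with a single linking vertex,
    leaves the rest of [R] as a shorter gap. *)
Lemma exact_false : size R = k + 4 -> (forall u, u <= N -> Rout u || Rin u) -> False.
Proof.
move=> szR bR'; have [zp pz] := zP0 ce cf.
have [q Rq maxq] : exists2 q, Rout q & forall s, Rout s -> s <= q.
  by apply: last_out R0 _ => s /hasP[y _ /outs_lt].
have [f zf maxf] : exists2 f, outs e z P z f & forall s, outs e z P z s -> s <= f.
  by apply: last_out => [|s /outs_lt //]; rewrite /outs N_gt0.
have Rlo u : u <= q -> Rout u && ~~ Rin u.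
  move=> uq; have uN : u <= N by have /hasP[y _ /outs_lt] := Rq; alia.
  have /negP ni : ~ Rin u by move=> i; have := Rsw i Rq; alia.
  by have := bR' u uN; rewrite (negPf ni) orbF => ->.
have Rhi u : q < u <= N -> Rin u && ~~ Rout u.
  move=> /andP[qu uN].
  have /negP no : ~ Rout u by move=> /maxq; alia.
  by have := bR' u uN; rewrite (negPf no) /= => ->.
have zlo u : u <= f -> outs e z P z u.
  move=> uf; have uN : u <= N by have := outs_lt zf; alia.
  apply/negPn/negP=> no; suff ni : ~~ ins e z P z u.
    by have := z_blank_R uN no ni; rewrite szR eqxx.
  by apply/negP=> i; have := zsw i zf; alia.
have zhi u : f < u <= N -> ins e z P z u.
  move=> /andP[fu uN]; apply/negPn/negP=> ni; suff no : ~~ outs e z P z u.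
    by have := z_blank_R uN no ni; rewrite szR eqxx.
  by apply/negP=> /maxf; alia.
have q0 : 0 < q by have [t /maxq] := R_out2; alia.
have qN : q.+1 < N by have [t Rt tN] := R_in2; have := Rsw Rt Rq; alia.
have [u [v [u0 uq qv vN j]]] := cut_jump_P q0 qN.
have uv : u < v by alia.
have /andP[Ru nRu] := Rlo u uq.
have [Rv nRv] : Rin v /\ ~~ Rout v by apply/andP/Rhi; rewrite qv ltnW.
have cuts (x : pred V) := @count_cuts4 x u v v v (ltnW uv) (leqnn v) (leqnn v) (ltnW vN).
have svv : S v v = [::] by apply/nilP; rewrite /nilp size_seg ?subnn // ltnW.
have [qf|fq] := leqP q f.
  have zu : outs e z P z u by apply: zlo; alia.
  have [lk|[w sl]] := linked_or_single conn Rv R0.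
    by apply: (@cross_zR u u v v); rewrite ?ltnn ?leqnn ?leqnSn.
  have v0 : v != 0 by alia.
  have [wR iw ow _] := sl; have [_ iw'] := andP iw; have [_ ow'] := andP ow; have [_ zu'] := andP zu.
  have [_ ex] := single_exact ce cf conn v0 sl.
  apply: (@single_close V e z k P R ce cf conn v 0 w (S u v) [:: [:: w]; S 0 u; S v N] v0 sl) => //.
  - by apply: bseg => //; apply: ltnW.
  - by rewrite /= !bseg //; alia.
  - rewrite /= !head_seg ?last_seg //; try alia.
    by rewrite zu' iw' ow' [e _ (p v)]j pz.
  - move=> R2 pR2; apply/permP=> x; have := permP pR2 x; rewrite cnt seg_full (cuts x) svv.
    by rewrite /= cats0 !count_cat /= ?count_cat; clia.
  move=> y yR yw; have [_ nbl] := ex y yR yw.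
  have lst : last z (S u v ++ flatten [:: [:: w]; S 0 u; S v N]) = p N.-1.
    by rewrite /= cats0 last_cat /= last_cat; apply: last_segx.
  rewrite lst head_seg //; last exact: ltnW.
  split.
    have yN : outs e z P y N || ins e z P y N by apply: nbl => //; alia.
    by move: yN; rewrite /outs ltnn /= => /andP[].
  have yu : outs e z P y u || ins e z P y u by apply: nbl => //; alia.
  by move: yu; rewrite (negPf (contra (Rin_mem yR) nRu)) orbF => /andP[].
have zv : ins e z P z v by apply: zhi; alia.
have [lk|[w sl]] := linked_or_single conn RN Ru.
  by apply: (@cross_Rz u u v v); rewrite ?ltnn ?leqnn ?leqnSn.
have Nu : N != u by alia.
have [wR iw ow _] := sl; have [_ iw'] := andP iw; have [_ ow'] := andP ow; have [_ zv'] := andP zv.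
have [_ ex] := single_exact ce cf conn Nu sl.
apply: (@single_close V e z k P R ce cf conn N u w (S 0 u) [:: S v N; [:: w]; S u v] Nu sl) => //.
- by apply: bseg => //; alia.
- by rewrite /= !bseg //; alia.
- rewrite /= !head_seg ?last_seg //; try alia.
  by rewrite zp iw' ow' [e _ (p v)]j zv'.
- move=> R2 pR2; apply/permP=> x; have := permP pR2 x; rewrite cnt seg_full (cuts x) svv.
  by rewrite /= cats0 !count_cat /= ?count_cat; clia.
move=> y yR yw; have [_ nbl] := ex y yR yw.
have lst : last z (S 0 u ++ flatten [:: S v N; [:: w]; S u v]) = p v.-1.
  by rewrite /= cats0 !last_cat /=; apply: last_segx => //; apply: ltnW.
rewrite lst head_seg //; last by alia.
split.
  have yv : outs e z P y v || ins e z P y v by apply: nbl; alia.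
  by move: yv; rewrite (negPf (contra (Rout_mem yR) nRv)) => /andP[].
have y0 : outs e z P y 0 || ins e z P y 0 by apply: nbl => //; alia.
by move: y0; rewrite /ins orbF => /andP[].
Qed.

Lemma single_switch_false : False.
Proof.
have [ex|nex] := classic (size R = k + 4 /\ forall u, u <= N -> Rout u || Rin u).
  by apply: exact_false; case: ex.
apply: (crossing_free_false (crossing_instance _)) => s t Rs Rt.
by apply: NNPP => /(not_linked Rs Rt).
Qed.

End Config.

(** * A gap that splits into two pairs *)

Section Split.

Variables (V : finType) (e : rel V) (z : V) (k : nat) (P R : seq V).
Hypothesis ce : counterexample e z k.
Hypothesis cf : config e z P R.

Let irr := ce_irr ce.
Notation N := (size P).
Notation p := (nth z P).
Notation S := (seg P).
Notation outs := (outs e z P).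
Notation ins := (ins e z P).
Let N_gt0 := N_gt0 ce cf.
Let bseg := bseg ce cf.
Let cseg := @count_seg V P.

Lemma no_insertion2 a b s : a \in R -> b \in R -> a != b -> e a b -> ins a s -> ~~ outs b s.
Proof.
move=> aR bR ab eab ia; apply/negP=> ob.
have [Q [T [bQ pQ hQ lQ _]]] : R_path e z R a b by apply: R_path2.
by apply: (no_insertion ce cf bQ pQ (s := s)); rewrite ?hQ ?lQ.
Qed.

Hypotheses (k0 : k = 0) (R4 : size R = 4).

(** The pair [a], [a'] replaces [p c], which then has at least [N + 3] arcs to a cycle of [N + 2]
    vertices and is inserted; only [b] and [b'] are missed, while three vertices must be. *)
Lemma twin_switch a a' b b' c : perm_eq [:: a; a'; b; b'] R -> e a a' ->
  ins a c -> outs a' c.+1 ->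
  (forall t, t \in [:: a; a'] -> ~~ e (p c) t /\ ~~ e t (p c)) ->
  degin e (p c) [:: b; b'] <= 2 -> False.
Proof.
move=> pR aa' /andP[/andP[c0 cN] ia] /andP[cN' oa'] nadj two.
have [zp pz] := zP0 ce cf.
pose C := z :: S 0 c ++ [:: a; a'] ++ S c.+1 N.
have cyc : cycle e C.
  have := @cycle_chain V e z [:: z] [:: S 0 c; [:: a; a']; S c.+1 N] isT.
  rewrite /= cats0 => ->; last by rewrite /= !bseg // {1}/block /= aa'.
  by rewrite !head_seg ?last_seg //= ?zp ?ia ?oa' ?pz.
have cuts (q : pred V) : count q P = count q (S 0 c) + q (p c) + count q (S c.+1 N).
  rewrite -{1}(seg_full P) -(cseg q (leq0n c) cN (leqnn N)).
  rewrite -(cseg q (leqnSn c) (ltnW cN') (leqnn N)) (seg1 z) /=; last exact: ltnW.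
  by clia.
have szC : size C = N + 2.
  by have := cuts predT; rewrite /C !count_predT /= !size_cat /=; clia.
have dv : size C < degin e (p c) C.
  have := @degin_p V e z k P R ce cf c (ltnW cN').
  have -> : degin e (p c) P = degin e (p c) (S 0 c) + degin e (p c) (S c.+1 N).
    rewrite /degin !cuts irr; clia.
  rewrite -(degin_perm e (p c) pR) -[[:: a; a'; b; b']]/([:: a; a'] ++ [:: b; b']) degin_cat.
  rewrite (degin_nonadj nadj) /C degin_cons !degin_cat (degin_nonadj nadj) szC R4 k0.
  by move: two; clia.
have [C' [cyc' pC']] := insert_cycle cyc dv.
have : k + 2 + (k + 2 < size R) <= size [:: b; b'].
  apply: (cycle_missing ce cf cyc').
  - by rewrite (perm_mem pC') /C !inE eqxx orbT.
  - apply: perm_trans (cf_perm cf); apply/permP=> q.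
    have := permP pC' q; have := permP pR q; have := cuts q.
    by rewrite /C /= !count_cat /= ?count_cat; clia.
  apply: (nonadj_R ce cf) => t tb; rewrite -(perm_mem pR).
  by move: tb; rewrite !inE => ->; rewrite !orbT.
by rewrite k0 R4.
Qed.

Lemma ins_mono a b s : (forall a s, a \in R -> s <= N -> outs a s || ins a s) ->
  a \in R -> b \in R -> a != b -> e a b -> ins a s -> ins b s.
Proof.
move=> exact aR bR ab eab ia; have /andP[_ sN] := ins_gt ia.
by have := exact b s bR sN; rewrite (negPf (no_insertion2 aR bR ab eab ia)).
Qed.

Lemma outs_mono a b s : (forall a s, a \in R -> s <= N -> outs a s || ins a s) ->
  a \in R -> b \in R -> a != b -> e a b -> outs b s -> outs a s.
Proof.
move=> exact aR bR ab eab ob; have /orP[//|ia] := exact a s aR (ltnW (outs_lt ob)).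
by have := no_insertion2 aR bR ab eab ia; rewrite ob.
Qed.

Lemma no_in a s : a \in R -> s < N -> outs a s.+1 || ~~ ins a s.+1 -> ~~ e (p s) a.
Proof.
move=> aR sN /orP[/(R_excl ce cf aR)|]; by rewrite /ins /= sN.
Qed.

Lemma no_out a s : a \in R -> s < N -> ins a s -> ~~ e a (p s).
Proof. by move=> aR sN; apply: contraL => ea; apply: (R_excl ce cf aR); rewrite /outs sN. Qed.

(** The slots of [x] and [x'] agree, so do those of [y] and [y'], and in-slots of [x] are in-slots
    of [y]. Take a jump from [u] to [v] over the last out-slot of [z]. If [q < v] or [u <= q2], all
    of [R], in the order [x], [x'], [y], [y'], enters a Hamiltonian cycle. Otherwise [y], [y'] can
    join the cycle through [z], and [x], [x'] alone form a gap. *)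
Lemma split_false : R_split e z k P R -> False.
Proof.
case=> x [x' [y [y' [pR _ arcE exact]]]].
have [zp pz] := zP0 ce cf.
have : uniq [:: x; x'; y; y'] by rewrite (perm_uniq pR) (uniq_R cf).
rewrite /= !inE !negb_or andbT => /and3P[/and3P[xx' xy xy'] /andP[x'y x'y'] yy'].
have xR : x \in R by rewrite -(perm_mem pR) !inE eqxx.
have x'R : x' \in R by rewrite -(perm_mem pR) !inE eqxx !orbT.
have yR : y \in R by rewrite -(perm_mem pR) !inE eqxx !orbT.
have y'R : y' \in R by rewrite -(perm_mem pR) !inE eqxx !orbT.
have exx' : e x x' by rewrite arcE // !inE (negPf xy) (negPf xy').
have ex'x : e x' x by rewrite arcE // ?inE ?(negPf x'y) ?(negPf x'y') // eq_sym.
have x'x : x' != x by rewrite eq_sym.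
have y'y : y' != y by rewrite eq_sym.
have exy : e x y by rewrite arcE // !inE (negPf xy) (negPf xy').
have exy' : e x y' by rewrite arcE // !inE (negPf xy) (negPf xy').
have ex'y : e x' y by rewrite arcE // !inE (negPf x'y) (negPf x'y').
have ex'y' : e x' y' by rewrite arcE // !inE (negPf x'y) (negPf x'y').
have eyy' : e y y'.
  by rewrite arcE // !inE (eq_sym y') (negPf xy') (eq_sym y') (negPf x'y') andbF.
have ey'y : e y' y.
  by rewrite arcE // !inE (eq_sym y x) (negPf xy) (eq_sym y x') (negPf x'y) andbF.
have switch a s t : a \in R -> ins a s -> outs a t ->
    (forall c, ins a c -> outs a c.+1 -> False) -> t < s.
  move=> aR ia oa no1; rewrite ltnNge; apply/negP=> st.
  have ne : s != t by apply: contraTneq ia => ->; apply: (R_excl ce cf aR).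
  have [|c [d [sc cd dt ic [od bl]]]] := closest_switch ia oa _ (fun w _ => @R_excl _ _ _ _ _ _ ce cf a w aR).
    by alia.
  have dN := outs_lt od.
  have [dc|dc] := eqVneq d c.+1; first by apply: (no1 c) => //; rewrite -dc.
  have [|nb1 nb2] := bl c.+1; first by alia.
  by have := exact a c.+1 aR; rewrite (negPf nb1) (negPf nb2) => h; suff : false by []; apply: h; alia.
have insM := ins_mono exact; have outsM := outs_mono exact.
have xsw s t : ins x s -> outs x t -> t < s.
  move=> ix ox; apply: (switch x) => // c ic oc.
  have cN := outs_lt oc; have cN' := ltnW cN.
  have ic' := insM x x' c xR x'R xx' exx' ic; have oc' := outsM x' x _ x'R xR x'x ex'x oc.
  apply: (twin_switch pR exx' ic oc') => [t'|].
    by rewrite !inE => /orP[]/eqP->; rewrite no_in ?no_out ?oc ?oc'.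
  have /negPf n1 := no_out yR cN' (insM x y c xR yR xy exy ic).
  have /negPf n2 := no_out y'R cN' (insM x y' c xR y'R xy' exy' ic).
  by rewrite !degin_cons n1 n2 /degin /=; do 2 case: (e _ _).
have ysw s t : ins y s -> outs y t -> t < s.
  move=> iy oy; apply: (switch y) => // c ic oc.
  have cN := outs_lt oc; have cN' := ltnW cN.
  have ic' := insM y y' c yR y'R yy' eyy' ic; have oc' := outsM y' y _ y'R yR y'y ey'y oc.
  have pR' : perm_eq [:: y; y'; x; x'] R.
    by apply: perm_trans pR; apply/permP=> q /=; clia.
  apply: (twin_switch pR' eyy' ic oc') => [t'|].
    by rewrite !inE => /orP[]/eqP->; rewrite no_in ?no_out ?oc ?oc'.
  have nx : ~~ e (p c) x by apply: no_in; rewrite // (outsM x y).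
  have nx' : ~~ e (p c) x' by apply: no_in; rewrite // (outsM x' y).
  by rewrite !degin_cons (negPf nx) (negPf nx') /degin /=; do 2 case: (e _ _).
have zsw : forall s t, ins z s -> outs z t -> t < s.
  by move=> s t; apply: (z_switch ce cf); rewrite k0 R4.
have zex s : s <= N -> outs z s || ins z s.
  move=> sN; apply/negPn/negP; rewrite negb_or => /andP[no ni].
  by have := z_blank_R ce cf sN no ni; rewrite k0 R4.
have [f zf maxf] : exists2 f, outs z f & forall s, outs z s -> s <= f.
  by apply: (@last_out V P) => [|s /outs_lt //]; rewrite /outs N_gt0.
have [q xq maxq] : exists2 f, outs x f & forall s, outs x s -> s <= f.
  apply: (@last_out V P) => [|s /outs_lt //].
  by have := exact x 0 xR (leq0n N); rewrite /ins orbF.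
have [q2 yq2 maxq2] : exists2 f, outs y f & forall s, outs y s -> s <= f.
  apply: (@last_out V P) => [|s /outs_lt //].
  by have := exact y 0 yR (leq0n N); rewrite /ins orbF.
have f0 : 0 < f by have [t /maxf] := z_out2 ce cf; alia.
have fN : f.+1 < N by have [t zt tN] := z_in2 ce cf; have := zsw _ _ zt zf; alia.
have asw a s t : a \in R -> ins a s -> outs a t -> t < s.
  rewrite -(perm_mem pR) !inE => /or4P[]/eqP->.
  - exact: xsw.
  - by move=> /(insM x' x s x'R xR x'x ex'x) ix /(outsM x x' t xR x'R xx' exx'); apply: xsw.
  - exact: ysw.
  - by move=> /(insM y' y s y'R yR y'y ey'y) iy /(outsM y y' t yR y'R yy' eyy'); apply: ysw.
have lo a r s : a \in R -> outs a r -> s <= r -> outs a s.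
  move=> aR oa sr; have sN : s <= N by have := outs_lt oa; alia.
  by have /orP[//|ia] := exact a s aR sN; have := asw a s r aR ia oa; alia.
have hi a r s : a \in R -> (forall t, outs a t -> t <= r) -> r < s <= N -> ins a s.
  move=> aR mx /andP[rs sN]; have /orP[/mx|//] := exact a s aR sN; alia.
have [u [v [u0 uf fv vN j]]] : exists u v, [/\ 0 < u, u <= f, f < v, v < N & jump e z P u v].
  apply: (@cut_jump_gen _ _ _ _ _ _ ce cf f (fun a => has (ins a) (iota 0 f.+1))) => //.
  - by move=> s t sf zs /(zsw _ _ zs); alia.
  - by move=> a s aR sf ia; apply/hasP; exists s; rewrite // mem_iota; alia.
  - move=> a t aR /hasP[s]; rewrite mem_iota => sf ia oa; have := asw a s t aR ia oa; alia.
  - move=> a b aR bR eab /hasP[s sf ia]; apply/hasP; exists s => //.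
    by apply: insM ia => //; apply: contraTneq eab => ->; rewrite irr.
have uv : u < v by alia.
have uN : u <= N by alia.
have vN' : v <= N by alia.
have /andP[_ zu] : outs z u.
  apply/negPn/negP=> no.
  by have := zex u uN; rewrite (negPf no) => zi; have := zsw _ _ zi zf; alia.
have /andP[_ zv] : ins z v.
  apply/negPn/negP=> no.
  by have := zex v (ltnW vN); rewrite (negPf no) orbF => /maxf; alia.
have cuts (r : pred V) : count r P = count r (S 0 u) + count r (S u v) + count r (S v N).
  by rewrite -{1}(seg_full P) !cseg // ltnW.
have bl4 : block e [:: x; x'; y; y'] by rewrite /block /= exx' ex'y eyy'.
have /andP[_ y'0] : outs y' 0.
  by have := exact y' 0 y'R (leq0n N); rewrite /ins orbF.
have /andP[_ xN] : ins x N.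
  by have := exact x N xR (leqnn N); rewrite {1}/outs ltnn.
have y'q2 s : s <= q2 -> outs y' s by move=> sq; apply: (outsM y' y) => //; apply: lo sq.
have ham bs : all (block e) bs -> chain e z z bs z ->
    perm_eq (flatten bs) (S 0 u ++ S u v ++ S v N ++ [:: x; x'; y; y']) -> False.
  move=> bbs ch pbs; apply: (ce_nonham ce (c := z :: flatten bs)).
    by rewrite /= (path_chain z).
  apply: perm_trans (cf_perm cf); apply/permP=> r; have := permP pbs r; have := permP pR r.
  by rewrite /= !count_cat /= (cuts r) ; clia.
have [vq|qv] := leqP v q; last first.
  have /andP[_ xv] : ins x v by apply: (hi x q v xR maxq); rewrite qv ltnW.
  apply: (ham [:: S u v; [:: x; x'; y; y']; S 0 u; S v N]).
  - by rewrite /= !bseg // ?bl4.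
  - rewrite /= !head_seg ?last_seg //.
    by rewrite zu xv y'0 [e _ (p v)]j pz.
  - by apply/permP=> r; rewrite /= cats0 !count_cat /= ?count_cat; clia.
have [uq2|q2u] := leqP u q2.
  have /andP[_ y'u] := y'q2 u uq2.
  apply: (ham [:: S 0 u; S v N; [:: x; x'; y; y']; S u v]).
  - by rewrite /= !bseg // ?bl4.
  - rewrite /= !head_seg ?last_seg //.
    by rewrite zp [e _ (p v)]j xN y'u zv.
  - by apply/permP=> r; rewrite /= cats0 !count_cat /= ?count_cat; clia.
have /andP[_ yv] : ins y v by apply: (hi y q2 v yR maxq2); alia.
have /andP[_ x'u] : outs x' u by apply: (outsM x' x u) => //; apply: (lo x q u xR xq); alia.
have : size R <= size (flatten [:: [:: x; x']]).
  apply: (@chain_minimal V e z P R cf (S u v) [:: [:: y; y']; S 0 u; S v N]).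
  - exact: bseg.
  - by rewrite /= !bseg // /block /= ?exx' ?eyy'.
  - rewrite /= !head_seg ?last_seg //.
    by rewrite zu yv y'0 [e _ (p v)]j pz.
  - rewrite /= !head_seg ?last_seg //.
    by rewrite yv y'0 [e _ (p v)]j xN x'u.
  - apply: perm_trans (cf_perm cf); apply/permP=> r; have := permP pR r.
    by rewrite /= !count_cat /= !count_cat /= (cuts r); clia.
by rewrite R4.
Qed.

End Split.

(** * Gaps of minimal size *)

Section Tight.

Variables (V : finType) (e : rel V) (z : V) (k : nat) (P R : seq V).
Hypothesis ce : counterexample e z k.
Hypothesis cf : config e z P R.
Hypothesis r2 : size R = k + 2.

Let irr := ce_irr ce.
Notation N := (size P).
Notation p := (nth z P).
Notation S := (seg P).
Notation outs := (outs e z P).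
Notation ins := (ins e z P).
Let N_gt0 := N_gt0 ce cf.
Let bseg := bseg ce cf.
Let bR := block_R ce cf.
Let cseg := @count_seg V P.

(** For [size R = k + 2] the budget [size R + k] equals the maximum [2 * size R - 2]. *)
Lemma tight_complete y y' : y \in R -> y' \in R -> y != y' -> e y y'.
Proof.
move=> yR y'R yy'; have := degin_missing irr yR y'R yy'; have := R_budget0 ce cf yR.
by rewrite r2; clear; case: (e y y'); case: (e y' y) => //= *; lia.
Qed.

Lemma tight_exact y s : y \in R -> s <= N -> outs y s || ins y s.
Proof.
move=> yR sN; apply/negPn/negP; rewrite negb_or => /andP[no ni].
have : size [:: s] + size R + k <= degin e y R.
  by apply: (R_budget ce cf yR) => // u; rewrite inE => /eqP->.
by have := degin_irr irr yR; rewrite r2 /=; clia.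
Qed.

Lemma tight_conn w w' : w \in R -> w' \in R -> w != w' -> R_path e z R w w'.
Proof. by move=> wR w'R ww'; apply: R_path2 => //; apply: tight_complete. Qed.

(** Here [q] is the last out-slot of [R]; as [R] has no blank slot, [p q] is the one vertex of [P]
    joined to all of [R] in both directions. *)
Definition is_pivot q := [/\ 0 < q, q.+1 < N,
  forall y s, y \in R -> s <= q -> e y (p s),
  forall y s, y \in R -> q <= s < N -> e (p s) y
  & forall y s, y \in R -> s < N -> (q < s -> ~~ e y (p s)) /\ (s < q -> ~~ e (p s) y)].

Lemma pivot : exists q, is_pivot q.
Proof.
have Rex := Rexcl ce cf tight_conn; have Rsw := Rswitch ce cf tight_conn.
have [q Rq maxq] : exists2 q, Rout e z P R q & forall s, Rout e z P R s -> s <= q.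
  by apply: (@last_out V P _ (R0 ce cf)) => s /hasP[y _ /outs_lt].
have oy y s : y \in R -> s <= q -> outs y s.
  move=> yR sq; have qN : q < N by case/hasP: Rq => w _ /outs_lt.
  have /orP[//|iy] := tight_exact yR (s := s) ltac:(alia).
  by have := Rsw s q (Rin_mem yR iy) Rq; alia.
have iy y s : y \in R -> q < s <= N -> ins y s.
  move=> yR /andP[qs sN]; have /orP[/(Rout_mem yR)/maxq|//] := tight_exact yR sN.
  by alia.
exists q; split.
- by have [t /maxq] := R_out2 ce cf; alia.
- by have [t Rt tN] := R_in2 ce cf; have := Rsw _ _ Rt Rq; alia.
- by move=> y s yR sq; have /andP[] := oy y s yR sq.
- by move=> y s yR /andP[qs sN]; have /andP[] := iy y s.+1 yR ltac:(alia).
move=> y s yR sN; split=> [qs|sq].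
  apply/negP=> ey; have /(Rout_mem yR)/maxq : outs y s by rewrite /outs sN.
  by alia.
by apply: (no_in ce cf) => //; rewrite oy.
Qed.

Lemma ham bs : all (block e) bs -> chain e z z bs z ->
  (forall x, count x (flatten bs) = count x P + count x R) -> False.
Proof.
move=> bbs ch pbs; apply: (ce_nonham ce (c := z :: flatten bs)).
  by rewrite /= (path_chain z).
by apply: perm_trans (cf_perm cf); apply/permP=> x; rewrite /= count_cat pbs.
Qed.

Lemma missing bs M : all (block e) bs -> chain e z z bs z ->
  (forall x, count x (flatten bs) + count x M = count x P + count x R) -> k + 2 <= size M.
Proof.
move=> bbs ch pbs; apply: (chain_missing ce bbs ch).
apply: perm_trans (cf_perm cf); apply/permP=> x; have := pbs x.
by rewrite /= !count_cat; clia.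
Qed.

Variables (a b : nat).
Hypotheses (za : ins z a) (zb : outs z b) (ab : a < b).
Hypothesis gap : forall s, a < s < b -> ~~ ins z s /\ ~~ outs z s.

Let a0 : 0 < a. Proof. by have := ins_gt za; alia. Qed.
Let aN : a <= N. Proof. by have := ins_gt za; alia. Qed.
Let bN : b < N. Proof. exact: outs_lt zb. Qed.
Let bN' : b <= N. Proof. exact: ltnW. Qed.

Let cuts (x : pred V) : count x P = count x (S 0 a) + count x (S a b) + count x (S b N).
Proof. by rewrite -{1}(seg_full P) !cseg // ltnW. Qed.

Let pstep i : 0 < i -> i < N -> e (p i.-1) (p i).
Proof. by case: i => // i _ iN; apply: (path_P ce cf). Qed.

Lemma gap_ge : k + 2 <= b - a.
Proof.
have [PR RP] := PR_links ce cf; have [zp pz] := zP0 ce cf.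
have [_ za'] := andP za; have [_ zb'] := andP zb.
have : size R <= size (flatten [:: S a b]).
  apply: (@chain_minimal V e z P R cf (S b N) [:: R; S 0 a]).
  - exact: bseg.
  - by rewrite /= bR !bseg.
  - by rewrite /= !head_seg ?last_seg // zb' PR RP za'.
  - rewrite /= !head_seg ?last_seg // PR RP.
    by rewrite !pstep //; alia.
  - apply: perm_trans (cf_perm cf); apply/permP=> x; have := cuts x.
    by rewrite /= cats0 !count_cat /= ?count_cat; clia.
by rewrite /= cats0 size_seg // r2.
Qed.

(** The [b - a - 1] inner slots are blank for [z], which has at most two blanks when
    [size R = k + 2]. *)
Lemma gap_blanks (l : seq nat) : uniq l -> (forall s, s \in l ->
    [/\ s <= N, ~~ outs z s, ~~ ins z s & (s <= a) || (b <= s)]) ->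
  b - a + size l <= 3.
Proof.
move=> ul bl; have := @blanks_z V e z k P R ce cf (l ++ iota a.+1 (b - a).-1).
rewrite size_cat size_iota r2 => h.
suff : size l + (b - a).-1 + (k + 2) <= k + 4 by move: ab; clia.
apply: h.
  rewrite cat_uniq ul iota_uniq andbT /=; apply/hasPn=> s; rewrite mem_iota => sab.
  by apply/negP=> /bl[_ _ _]; alia.
move=> s; rewrite mem_cat mem_iota => /orP[/bl[]//|sab].
by have [|ni no] := gap (s := s); [alia|split=> //; alia].
Qed.

Lemma gap_nonadjacent t : t \in S a b -> ~~ e z t /\ ~~ e t z.
Proof.
move=> tS; have [s sab ->] := mem_segP ce cf tS bN'.
apply: z_nonadj_p; first by alia.
  have [->|sa] := eqVneq s a; first by apply: contraL za => /(z_excl ce cf).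
  by have [] := gap (s := s); first by alia.
have [->|sb] := eqVneq s.+1 b; first exact: (z_excl ce cf zb).
by have [] := gap (s := s.+1); first by alia.
Qed.

Let G_le3 : b - a <= 3.
Proof. by have := @gap_blanks [::] isT; rewrite addn0; apply. Qed.

Lemma split_at bs1 bs2 M t : all (block e) (bs1 ++ bs2) -> chain e z z (bs1 ++ bs2) z ->
  (forall x, count x (flatten (bs1 ++ bs2)) + count x M = count x P + count x R) ->
  flatten bs1 != [::] -> flatten bs2 != [::] -> size M = k + 2 -> {subset M <= S a b} -> t \in M ->
  e (last z (flatten bs1)) t || e t (head z (flatten bs2)).
Proof.
move=> bbs ch pbs n1 n2 szM MG tM.
apply: (@perfect_split V e z k ce (flatten (bs1 ++ bs2)) M) => //.
- by rewrite /= (path_chain z).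
- apply: perm_trans (cf_perm cf); apply/permP=> x; have := pbs x.
  by rewrite /= !count_cat; clia.
- by move=> w /MG; apply: gap_nonadjacent.
exact: flatten_cat.
Qed.

(** A pivot inside the segment can be visited between two vertices of [R], and the cycle misses only
    the rest of the segment. This forces [k = 0] and two missed vertices, so [split_at] applies to
    an end of the segment other than [p q]; the arc it yields closes a Hamiltonian cycle. *)
Lemma pivot_outside_gap q : is_pivot q -> (q < a) || (b <= q).
Proof.
case=> q0 qN Ro Ri nR; apply/negPn/negP; rewrite negb_or -leqNgt -ltnNge => /andP[aq qb].
have [zp pz] := zP0 ce cf; have [_ za'] := andP za; have [_ zb'] := andP zb.
have hR := head_mem z (R_neq0 ce cf); have lR := last_mem z (R_neq0 ce cf).
have b0 : 0 < b by alia.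
have pN : N.-1 < N by rewrite prednK.
have qlN : q <= N.-1 by alia.
have b1N : b.-1 < N by alia.
have [y0 [R' [eR R'0]]] : exists y0 R', R = y0 :: R' /\ R' != [::].
  case eR: R r2 => [|y0 [|y1 R']]; [by rewrite addn2|by rewrite addn2|].
  by exists y0, (y1 :: R').
have y0R : y0 \in R by rewrite eR mem_head.
have inR t : t \in R' -> t \in R by rewrite eR inE => ->; rewrite orbT.
have bR' : block e R' by apply: (@block_suffix _ _ [:: y0] R') => //; move: (bR); rewrite eR.
have hR' := inR _ (head_mem z R'0); have lR' := inR _ (last_mem z R'0).
have qNl : q < N by exact: ltnW.
have qb' : q < b by [].
pose M := S a q ++ S q.+1 b.
have countM x : count x (S a b) = count x M + x (p q).
  rewrite -(@cseg x a q b) // ?(ltnW qb) // -(@cseg x q q.+1 b) // (seg1 z) // /M count_cat /=.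
  by clia.
have MG : {subset M <= S a b}.
  move=> t; rewrite -!has_pred1 !has_count countM => h; exact: leq_trans h (leq_addr _ _).
have szM : size M = b - a - 1.
  by have := countM predT; rewrite !count_predT size_seg //=; clia.
pose bs1 := [:: S b N]; pose bs2 := [:: [:: y0]; [:: p q]; R'; S 0 a].
have bbs : all (block e) (bs1 ++ bs2) by rewrite /= bR' !bseg.
have ch : chain e z z (bs1 ++ bs2) z.
  by rewrite /= !head_seg ?last_seg // zb' za' !Ro ?Ri ?leqnn ?qlN.
have pbs x : count x (flatten (bs1 ++ bs2)) + count x M = count x P + count x R.
  by have := cuts x; have := countM x; rewrite eR /= cats0 !count_cat /= ?count_cat; clia.
have g1 := missing bbs ch pbs; have g3 := G_le3; rewrite szM in g1.
have k0 : k = 0 by alia.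
have ge3 : b - a = 3 by alia.
have szM2 : size M = k + 2 by rewrite szM ge3 k0.
have Sba := @seg_neq0 V P b N bN (leqnn N); have S0a := @seg_neq0 V P 0 a a0 aN.
have memS s : a <= s < b -> s != q -> p s \in M.
  move=> sab sq; rewrite /M mem_cat; apply/orP.
  have [lt|gt|e0] := ltngtP s q; last by rewrite e0 eqxx in sq.
    by left; apply: mem_seg => //; alia.
  by right; apply: mem_seg => //; alia.
have [q1|q1] := ltnP q.+1 b.
  have tM : p b.-1 \in M by apply: memS; alia.
  have tS : e (last z (S b N ++ [:: y0] ++ [:: p q] ++ R')) (p b.-1)
      || e (p b.-1) (head z (S 0 a)).
    have := @split_at [:: S b N; [:: y0]; [:: p q]; R'] [:: S 0 a] M (p b.-1) bbs ch pbs.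
    by rewrite /= !cats0; apply => //; case: (S b N) Sba.
  have {}tS : e (p b.-1) (p 0).
    move: tS; rewrite !last_cat /= head_seg //.
    by rewrite (negPf (proj1 (nR _ b.-1 (inR _ (last_mem (p q) R'0)) b1N) _)) //; alia.
  apply: (ham (bs := [:: S b N; R; S a b; S 0 a])).
  - by rewrite /= bR !bseg.
  - by rewrite /= !head_seg ?last_seg // zb' za' tS Ro ?Ri ?qlN.
  - by move=> x; rewrite (cuts x) /= cats0 !count_cat /= ?count_cat; clia.
have tM : p a \in M by apply: memS; alia.
have tS : e (last z (S b N)) (p a) || e (p a) (head z ([:: y0] ++ [:: p q] ++ R' ++ S 0 a)).
  have := @split_at [:: S b N] [:: [:: y0]; [:: p q]; R'; S 0 a] M (p a) bbs ch pbs.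
  by rewrite /= !cats0; apply.
have aN' : a < N by alia.
have aq' : a < q by alia.
rewrite last_seg // /= (negPf (proj2 (nR y0 a y0R aN') aq')) orbF in tS.
apply: (ham (bs := [:: S b N; S a b; R; S 0 a])).
- by rewrite /= bR !bseg.
- by rewrite /= !head_seg ?last_seg // zb' za' tS Ro ?Ri //; alia.
- by move=> x; rewrite (cuts x) /= cats0 !count_cat /= ?count_cat; clia.
Qed.

Let countP (x : pred V) : count x P = count x (S 0 N).
Proof. by rewrite seg_full. Qed.

(** The arc would close the Hamiltonian cycle [z], [S b N], [R], [S s b], [S 0 s]. *)
Lemma low_arc q s : is_pivot q -> q < a -> ins z s -> s <= q -> ~~ e (p b.-1) (p 0).
Proof.
case=> q0 qN Ro Ri nR qa zs sq; apply/negP=> j.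
have [/andP[s0 _] zs'] := andP zs; have [zp pz] := zP0 ce cf; have [_ zb'] := andP zb.
have hR := head_mem z (R_neq0 ce cf); have lR := last_mem z (R_neq0 ce cf).
have sb : s < b by alia.
have sN : s <= N by alia.
have qN1 : q <= N.-1 < N by alia.
apply: (ham (bs := [:: S b N; R; S s b; S 0 s])).
- by rewrite /= bR !bseg.
- by rewrite /= !head_seg ?last_seg // zb' Ro // Ri // j zs'.
- move=> x; rewrite (countP x) -(cseg x (leq0n b) bN' (leqnn N)) -(cseg x (leq0n s) (ltnW sb) bN').
  by rewrite /= cats0 !count_cat /= ?count_cat; clia.
Qed.

(** The cycle [z], [S b N], [R], [S 0 a] misses exactly the segment. At the junction of [R] and
    [p 0], the vertex [p b.-1] has neither arc: it lies above the pivot, and [low_arc] applies. This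
    contradicts [split_at]. *)
Lemma tight_gap_false q s : is_pivot q -> q < a -> ins z s -> s <= q -> b - a = k + 2 -> False.
Proof.
move=> pq qa zs sq g2; have /negPf nj := low_arc pq qa zs sq; case: pq => q0 qN Ro Ri nR.
have [zp pz] := zP0 ce cf; have [_ za'] := andP za; have [_ zb'] := andP zb.
have hR := head_mem z (R_neq0 ce cf); have lR := last_mem z (R_neq0 ce cf).
have qN1 : q <= N.-1 < N by alia.
have b1N : b.-1 < N by alia.
have qb1 : q < b.-1 by alia.
have bbs : all (block e) ([:: S b N; R] ++ [:: S 0 a]) by rewrite /= bR !bseg.
have := @split_at [:: S b N; R] [:: S 0 a] (S a b) (p b.-1) bbs.
rewrite /= !cats0 last_cat !head_seg ?last_seg // zb' Ro // Ri // za' nj orbF.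
have -> : last (p N.-1) R = last z R by case: (R) (R_neq0 ce cf).
rewrite (negPf (proj1 (nR _ b.-1 lR b1N) qb1)) => h; suff : false by [].
apply: h => //.
- by move=> x; rewrite (cuts x) !count_cat; clia.
- by case: (S b N) (@seg_neq0 V P b N bN (leqnn N)).
- by have := @seg_neq0 V P 0 a a0 aN.
- by rewrite size_seg.
- by apply: mem_seg => //; alia.
Qed.

(** A jump over [p q] from slot [u] cannot start at an out-slot of [z], or [S u v], [R], [S 0 u],
    [S v N] would complete a Hamiltonian cycle. So [u] is blank and the segment has only two
    vertices. If [u] were below [q], then [u.+1] would be an out-slot, and the same splicing would
    miss [p u] alone. *)
Lemma no_low_in q : is_pivot q -> q < a -> (forall s, s <= q -> ~~ ins z s) ->
  [/\ k = 0, b = a.+2, ~~ outs z q & ~~ ins z q].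
Proof.
case=> q0 qN Ro Ri nR qa nin.
have [zp pz] := zP0 ce cf.
have hR := head_mem z (R_neq0 ce cf); have lR := last_mem z (R_neq0 ce cf).
have [u [v [u0 uq qv vN j]]] : exists u v, [/\ 0 < u, u <= q, q < v, v < N & jump e z P u v].
  apply: (@cut_jump_gen _ _ _ _ _ _ ce cf q (fun _ => false)) => //.
  - by move=> s t sq zs; have := nin s sq; rewrite zs.
  - move=> y s yR sq /andP[/andP[s0 sN] ey].
    have s1N : s.-1 < N by alia.
    have s1q : s.-1 < q by alia.
    by have := proj2 (nR y s.-1 yR s1N) s1q; rewrite ey.
have uv : u < v by alia.
have uN : u <= N by alia.
have vN' : v <= N by alia.
have qv1 : q <= v.-1 < N by alia.
have nzu : ~~ outs z u.
  apply/negP=> /andP[_ zu]; apply: (ham (bs := [:: S u v; R; S 0 u; S v N])).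
  - by rewrite /= bR !bseg.
  - by rewrite /= !head_seg ?last_seg // zu Ri // Ro // [e _ (p v)]j pz.
  - move=> x; rewrite (countP x) -(cseg x (leq0n u) uN (leqnn N)) -(cseg x (ltnW uv) vN' (leqnn N)).
    by rewrite /= cats0 !count_cat /= ?count_cat; clia.
have niu := nin u uq.
have b1 := @gap_blanks [:: u] isT; have g2 := gap_ge.
have {}b1 : b - a + 1 <= 3 by apply: b1 => w; rewrite inE => /eqP->; split=> //; alia.
have k0 : k = 0 by alia.
have eb : b = a.+2 by alia.
have [<-//|uq'] := eqVneq u q.
have zu1 : outs z u.+1.
  apply/negPn/negP=> no; have := @gap_blanks [:: u; u.+1].
  rewrite /= inE; have -> : u == u.+1 = false by apply/negbTE; alia.
  move=> /(_ isT) h; suff : b - a + 2 <= 3 by alia.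
  apply: h => w; rewrite !inE => /orP[]/eqP->; split=> //; try alia.
  by apply: nin; alia.
have [_ zu1'] := andP zu1; have u1v : u.+1 < v by alia.
have uNl : u < N by alia.
have : k + 2 <= size [:: p u].
  apply: (missing (bs := [:: S u.+1 v; R; S 0 u; S v N])).
  - by rewrite /= bR !bseg.
  - by rewrite /= !head_seg ?last_seg // zu1' Ri // Ro // [e _ (p v)]j pz.
  - move=> x; rewrite (countP x) -(cseg x (leq0n u) uN (leqnn N)) -(cseg x (ltnW uv) vN' (leqnn N)).
    rewrite -(cseg x (leqnSn u) (ltnW u1v) vN') (seg1 z) //.
    by rewrite /= cats0 !count_cat /= ?count_cat; clia.
by rewrite k0.
Qed.

End Tight.

(** * A segment of three vertices when [k = 0] *)

Section Gap3.

Variables (V : finType) (e : rel V) (z : V) (k : nat) (P R : seq V).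
Hypothesis ce : counterexample e z k.
Hypothesis cf : config e z P R.
Hypothesis r2 : size R = k + 2.

Let irr := ce_irr ce.
Notation N := (size P).
Notation p := (nth z P).
Notation S := (seg P).
Notation outs := (outs e z P).
Notation ins := (ins e z P).
Let N_gt0 := N_gt0 ce cf.
Let bseg := bseg ce cf.
Let bR := block_R ce cf.
Let cseg := @count_seg V P.

Variables (a b q s : nat).
Hypotheses (za : ins z a) (zb : outs z b) (ab : a < b).
Hypothesis gap : forall s, a < s < b -> ~~ ins z s /\ ~~ outs z s.
Hypotheses (pq : is_pivot e z P R q) (qa : q < a) (zs : ins z s) (sq : s <= q).
Hypotheses (k0 : k = 0) (eb : b = a.+3).

Let q0 : 0 < q. Proof. by case: pq. Qed.
Let Ro y i : y \in R -> i <= q -> e y (p i). Proof. by case: pq => _ _ h _ _; apply: h. Qed.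
Let Ri y i : y \in R -> q <= i < N -> e (p i) y. Proof. by case: pq => _ _ _ h _; apply: h. Qed.
Let nRo y i : y \in R -> q < i < N -> ~~ e y (p i).
Proof. by move=> yR /andP[qi iN]; case: pq => _ _ _ _ h; apply: (proj1 (h y i yR iN)). Qed.
Let nRi y i : y \in R -> i < q -> i < N -> ~~ e (p i) y.
Proof. by move=> yR qi iN; case: pq => _ _ _ _ h; apply: (proj2 (h y i yR iN)). Qed.

Let a0 : 0 < a. Proof. by have := ins_gt za; alia. Qed.
Let bN : b < N. Proof. exact: outs_lt zb. Qed.
Let bN' : b <= N. Proof. exact: ltnW. Qed.
Let aN : a <= N. Proof. by alia. Qed.
Let s0 : 0 < s. Proof. by have := ins_gt zs; alia. Qed.
Let sa : s < a. Proof. by alia. Qed.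
Let qN1 : q <= N.-1 < N. Proof. by alia. Qed.
Let a1 : 1 < a. Proof. by alia. Qed.
Let a1N : a.+1 < N. Proof. by alia. Qed.
Let a2N : a.+2 < N. Proof. by alia. Qed.
Let b1N : b.-1 < N. Proof. by alia. Qed.
Let hR := head_mem z (R_neq0 ce cf).
Let lR := last_mem z (R_neq0 ce cf).
Let zp : e z (p 0). Proof. by have [] := zP0 ce cf. Qed.
Let pz : e (p N.-1) z. Proof. by have [] := zP0 ce cf. Qed.
Let za' : e (p a.-1) z. Proof. by case/andP: za. Qed.
Let zs' : e (p s.-1) z. Proof. by case/andP: zs. Qed.
Let zb' : e z (p b). Proof. by case/andP: zb. Qed.
Let pstep i : 0 < i -> i < N -> e (p i.-1) (p i).
Proof. by case: i => // i _ iN; apply: (path_P ce cf). Qed.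

Let cuts (x : pred V) : count x P = count x (S 0 a) + count x (S a b) + count x (S b N).
Proof. by rewrite -{1}(seg_full P) !cseg // ltnW. Qed.
Let countP (x : pred V) : count x P = count x (S 0 N).
Proof. by rewrite seg_full. Qed.
Let ham := ham ce cf.
Let missing := missing ce cf.

Lemma gap3E : S a b = [:: p a; p a.+1; p a.+2].
Proof.
apply: (@eq_from_nth _ z); rewrite size_seg // eb; first by rewrite /=; clia.
move=> i i3; rewrite -eb nth_seg // ?eb //.
have : i < 3 by alia.
by case: i {i3} => [|[|[|]]] //= _; rewrite ?addn0 ?addn1 ?addn2.
Qed.

(** For [p a.+2] this is [low_arc]; for [p a.+1], the same splicing misses [p a.+2] only. *)
Lemma gap3_no_out t : t \in [:: p a.+1; p a.+2] -> ~~ e t (p 0).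
Proof.
rewrite !inE => /orP[]/eqP->; last first.
  by have := low_arc ce cf r2 za zb ab gap pq qa zs sq; rewrite eb.
apply/negP=> j; have sN : s <= N by alia.
have sa2 : s < a.+2 by alia.
have : k + 2 <= size [:: p a.+2].
  apply: (missing (bs := [:: S b N; R; S s a.+2; S 0 s])).
  - by rewrite /= bR !bseg // ltnW.
  - by rewrite /= !head_seg ?last_seg // ?(ltnW a2N) // zb' Ri // Ro // j zs'.
  - move=> x; rewrite (countP x) -(cseg x (leq0n b) bN' (leqnn N)).
    rewrite -(cseg x (leq0n s) (ltnW (ltn_trans sa ab)) bN').
    have a2b : a.+2 <= b by rewrite eb.
    rewrite -(cseg x (ltnW sa2) a2b bN') [X in seg P a.+2 X]eb (seg1 z) //.
    by rewrite /= cats0 !count_cat /= ?count_cat; clia.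
by rewrite k0.
Qed.

(** Once [t] is inserted into one half, the other two vertices are a missed set of size [k + 2]. One
    of them is [p a.+1] or [p a.+2], and it has no arc at the junction from [R] to [p 0], against
    [split_at]. *)
Lemma gap3_insert_false t M B1 B2 : perm_eq (t :: M) (S a b) ->
  block e B1 -> head z B1 = p b -> last z B1 = last z R ->
  block e B2 -> head z B2 = p 0 -> last z B2 = p a.-1 ->
  (forall x : pred V, count x B1 + count x B2 =
     count x (S b N) + count x R + count x (S 0 a) + x t) -> False.
Proof.
move=> pM b1 h1 l1 b2 h2 l2 cnt.
have MG : {subset M <= S a b} by move=> w wM; rewrite -(perm_mem pM) inE wM orbT.
have szM : size M = 2 by have := perm_sizeV pM; rewrite gap3E /=; clia.
have [t' t'M t'0] : exists2 t', t' \in M & t' \in [:: p a.+1; p a.+2].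
  have ne : p a.+1 != p a.+2 by rewrite nth_uniq ?(uniq_P cf) ?neq_ltn ?ltnSn.
  have [tt|tt] := eqVneq t (p a.+1).
    exists (p a.+2); last by rewrite !inE eqxx orbT.
    have : p a.+2 \in t :: M by rewrite (perm_mem pM) gap3E !inE eqxx !orbT.
    rewrite inE => /orP[/eqP e2|//]; by rewrite e2 tt eqxx in ne.
  exists (p a.+1); last by rewrite !inE eqxx.
  have : p a.+1 \in t :: M by rewrite (perm_mem pM) gap3E !inE eqxx !orbT.
  by rewrite inE eq_sym (negPf tt).
have B10 : B1 != [::] by case/andP: b1.
have B20 : B2 != [::] by case/andP: b2.
have := @split_at V e z k P R ce cf r2 a b za zb ab gap [:: B1] [:: B2] M t'.
rewrite /= !cats0 b1 b2 h1 l1 h2 l2 zb' za' Ro // szM k0.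
have [i iab et'] := mem_segP ce cf (MG t' t'M) bN'.
have /negPf -> : ~~ e (last z R) t' by rewrite et' nRo //; alia.
rewrite (negPf (gap3_no_out t'0)) => h; suff : false by [].
apply: h => // x; have := permP pM x.
by rewrite count_cat /= (cuts x) cnt; clia.
Qed.

Let bSR : block e (S b N ++ R).
Proof.
have [PR _] := PR_links ce cf.
by rewrite (block_cat z) ?bseg ?bR //= last_seg.
Qed.

Let headSR : head z (S b N ++ R) = p b.
Proof.
have := @head_seg V z P b N bN (leqnn N).
by case: (S b N) (@seg_neq0 V P b N bN (leqnn N)).
Qed.

Let lastSR : last z (S b N ++ R) = last z R.
Proof. by rewrite last_cat; case: (R) (R_neq0 ce cf). Qed.

Let perm_gap t : t \in S a b -> perm_eq (t :: rem t (S a b)) (S a b).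
Proof. by move=> tG; rewrite perm_sym perm_to_rem. Qed.

Let R_to_gap y t : y \in R -> t \in S a b -> ~~ e y t.
Proof. by move=> yR tG; have [i iab ->] := mem_segP ce cf tG bN'; rewrite nRo //; alia. Qed.

Lemma gap3_upper t : t \in S a b ->
  degin e t (S b N ++ R) + 1 <= size (S b N ++ R) + e t (p b).
Proof.
move=> tG; rewrite leqNgt; apply/negP=> lt.
have [|W' [bW' hW' lW' pW']] := @insert_block V e z t (S b N ++ R) bSR.
  by rewrite headSR lastSR (negPf (R_to_gap lR tG)) addn0.
apply: (gap3_insert_false (perm_gap tG) bW' (B2 := S 0 a)).
- by rewrite hW'.
- by rewrite lW'.
- exact: bseg.
- by rewrite head_seg.
- by rewrite last_seg.
by move=> x; rewrite (permP pW') /= count_cat; clia.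
Qed.

Lemma gap3_degree t : t \in S a b ->
  N + 3 <= degin e t (S a b) + degin e t (S 0 a) + degin e t (S b N ++ R).
Proof.
move=> tG; have [nzt ntz] := gap_nonadjacent ce cf r2 za zb ab gap tG.
have [i iab ei] := mem_segP ce cf tG bN'.
have := @degin_p V e z k P R ce cf i ltac:(alia); rewrite -ei (negPf nzt) (negPf ntz).
by rewrite degin_cat {1}/degin !cuts r2 k0 /degin; clia.
Qed.

Lemma gap3_arcs t : t \in S a b ->
  6 <= degin e t (S a b) + e t (p b) + e t (p 0) + e (p a.-1) t.
Proof.
move=> tG; have u := gap3_upper tG; have d := gap3_degree tG.
have l : degin e t (S 0 a) + 1 <= a + e t (p 0) + e (p a.-1) t.
  rewrite leqNgt; apply/negP=> lt.
  have [||W' [bW' hW' lW' pW']] := @insert_block V e z t (S 0 a); first exact: bseg.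
    by rewrite head_seg ?last_seg // size_seg // subn0.
  apply: (gap3_insert_false (perm_gap tG) bSR headSR lastSR bW').
  - by rewrite hW' head_seg.
  - by rewrite lW' last_seg.
  by move=> x; rewrite (permP pW') /= count_cat; clia.
move: u d l bN; rewrite size_cat size_seg // r2 k0 eb; clia.
Qed.

Let gin i : a <= i < b -> p i \in S a b.
Proof. by move=> /andP[ai ib]; apply: mem_seg. Qed.

Let g1 : p a \in S a b. Proof. by apply: gin; alia. Qed.
Let g2 : p a.+1 \in S a b. Proof. by apply: gin; alia. Qed.
Let g3 : p a.+2 \in S a b. Proof. by apply: gin; alia. Qed.
Let n2 : ~~ e (p a.+1) (p 0). Proof. by apply: gap3_no_out; rewrite !inE eqxx. Qed.
Let n3 : ~~ e (p a.+2) (p 0). Proof. by apply: gap3_no_out; rewrite !inE eqxx orbT. Qed.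

(** As [p a.+1] and [p a.+2] have no arc to [p 0], they need all the other arcs counted in
    [gap3_arcs]. An arc from [p a] to [p 0] would then close a Hamiltonian cycle that visits the
    segment in the order [p a.+1], [p a.+2], [p a], so [p a] needs all the others too. *)
Lemma gap3_complete :
  (forall t t', t \in S a b -> t' \in S a b -> t != t' -> e t t') /\
  forall t, t \in S a b -> [/\ e (p a.-1) t, e t (p b) & ~~ e t (p 0)].
Proof.
have := gap3_arcs g1; have := gap3_arcs g2; have := gap3_arcs g3.
rewrite (negPf n2) (negPf n3) gap3E !degin_cons /degin /= !irr.
have s12 := path_P ce cf a1N; have s23 := path_P ce cf a2N.
have sa1 : e (p a.-1) (p a) by apply: pstep => //; apply: ltnW.
rewrite s12 s23 sa1.
have nosw : e (p a.+1) (p a.+2) -> e (p a.+2) (p a) -> e (p a.-1) (p a.+1) -> ~~ e (p a) (p 0).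
  move=> j1 j2 j3; apply/negP=> j4.
  apply: (ham (bs := [:: S b N; R; S s a; [:: p a.+1; p a.+2; p a]; S 0 s])).
  - by rewrite /= bR !bseg ?(ltnW sa) ?(leq_trans (ltnW sa)) // /block /= j1 j2.
  - by rewrite /= !head_seg ?last_seg ?(leq_trans (ltnW sa)) // zb' Ri // Ro // j3 j4 zs'.
  - move=> x; rewrite (cuts x) gap3E -(cseg x (leq0n s) (ltnW sa) aN).
    by rewrite /= cats0 !count_cat /= ?count_cat; clia.
move=> h3; have [c31 c13 c32 d3 h3'] : [/\ e (p a.+2) (p a), e (p a) (p a.+2),
    e (p a.+2) (p a.+1), e (p a.+2) (p b) & e (p a.-1) (p a.+2)].
  by move: h3; clear; do 5 case: (e _ _).
rewrite c32 => h2; have [c21 d2 h2'] : [/\ e (p a.+1) (p a), e (p a.+1) (p b) & e (p a.-1) (p a.+1)].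
  by move: h2; clear; do 3 case: (e _ _).
have n1 := nosw s23 c31 h2'.
rewrite c21 c13 c31 (negPf n1) => h1; have d1 : e (p a) (p b).
  by move: h1; clear; case: (e _ _).
split=> [t t'|t]; rewrite !inE; last by move=> /or3P[]/eqP->.
by move=> /or3P[]/eqP-> /or3P[]/eqP-> //; rewrite eqxx.
Qed.

Let countL (x : pred V) : count x (S 0 a) = x (p 0) + count x (S 1 a).
Proof. by rewrite -(cseg x (leq0n 1) a0 aN) (seg1 z) //= addn0. Qed.

(** The segment is complete, so it can be traversed starting at [t]; an arc from [p 0] to [t] would
    give the Hamiltonian cycle [z], [p 0], segment, [S b N], [R], [S 1 a]. *)
Lemma gap3_p0 t : t \in S a b -> ~~ e t (p 0) /\ ~~ e (p 0) t.
Proof.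
move=> tG; have [full arcs] := gap3_complete; have [_ _ nt0] := arcs t tG.
split=> //; apply/negP=> j.
have [B [bB hB lB pB]] : exists B, [/\ block e B, head z B = t, e (last z B) (p b)
    & perm_eq B (S a b)].
  have pB : perm_eq (t :: rem t (S a b)) (S a b) by rewrite perm_sym perm_to_rem.
  exists (t :: rem t (S a b)); split=> //.
    apply: complete_block => //; first by rewrite (perm_uniq pB) /seg drop_uniq ?take_uniq ?(uniq_P cf).
    by move=> w w'; rewrite !(perm_mem pB); apply: full.
  by have [] := arcs (last t (rem t (S a b))); rewrite // -(perm_mem pB) mem_last.
apply: (ham (bs := [:: [:: p 0]; B; S b N; R; S 1 a])).
- by rewrite /= bB bR !bseg.
- by rewrite /= !head_seg ?last_seg // zp hB j lB Ri // Ro // za'.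
- move=> x; rewrite (cuts x) -(permP pB x) countL.
  by rewrite /= cats0 !count_cat; clia.
Qed.

Let lastG : p a.+2 = p b.-1. Proof. by rewrite eb. Qed.

(** Since [p 0] is not adjacent to [p b.-1], the count of [gap3_arcs] is repeated with the shorter
    path [S 1 a], and it needs an arc to the head of that path. *)
Lemma gap3_p1 : e (p b.-1) (p 1).
Proof.
rewrite -lastG; have u := gap3_upper g3; have d := gap3_degree g3.
have [n30 n03] := gap3_p0 g3.
have [full arcs] := gap3_complete; have [la _ _] := arcs _ g3.
have m : degin e (p a.+2) (S a b) <= 4 by have := degin_irr irr g3; rewrite gap3E /=; clia.
have l0 : degin e (p a.+2) (S 0 a) = degin e (p a.+2) (S 1 a).
  by rewrite /degin !countL (negPf n30) (negPf n03).
have s01 : e (p 0) (p 1) by apply: (path_P ce cf); alia.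
have l : degin e (p a.+2) (S 1 a) + 1 <= a.-1 + e (p a.+2) (p 1) + e (p a.-1) (p a.+2).
  rewrite leqNgt; apply/negP=> lt.
  have [||W' [bW' hW' lW' pW']] := @insert_block V e z (p a.+2) (S 1 a); first exact: bseg.
    by rewrite head_seg ?last_seg // size_seg // subn1.
  have W'0 : W' != [::] by case/andP: bW'.
  apply: (gap3_insert_false (perm_gap g3) bSR headSR lastSR (B2 := p 0 :: W')) => //.
  - by rewrite /block /= (path_block0 z) // hW' head_seg // s01.
  - have : last z W' = p a.-1 by rewrite lW' last_seg.
    by case: (W') W'0.
  by move=> x; rewrite countL /= (permP pW') /= count_cat; clia.
move: u d l bN m; rewrite size_cat size_seg // r2 k0 l0 eb.
by move: la a1; case: (e (p a.+2) (p 1)) => //; clia.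
Qed.

(** For [1 < i], the arc of [gap3_p1] closes [z], [S b N], [R], [S i b], [S 1 i], which misses [p 0]
    alone. *)
Lemma low_in_one i : ins z i -> i <= q -> i = 1.
Proof.
move=> zi iq; have [/andP[i0 iN] zi'] := andP zi; apply/eqP; rewrite eqn_leq i0 andbT leqNgt.
apply/negP=> i1; have ia : i < a by alia.
have ib : i < b by alia.
have : k + 2 <= size [:: p 0].
  apply: (missing (bs := [:: S b N; R; S i b; S 1 i])).
  - by rewrite /= bR !bseg.
  - by rewrite /= !head_seg ?last_seg // zb' Ri // Ro // gap3_p1 zi'.
  - move=> x; rewrite (cuts x) countL -(cseg x (ltnW i1) (ltnW ia) aN).
    have := cseg x (ltnW ia) (ltnW ab) bN'.
    by rewrite /= cats0 !count_cat /= ?count_cat; clia.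
by rewrite k0.
Qed.

(** The segment uses up both blanks of [z], and an out-slot directly after an in-slot would bound a
    gap of one vertex. *)
Lemma low_all_in i : 0 < i -> i <= a -> ins z i.
Proof.
elim: i => // i IHi _ ia; have [->|i0] := posnP i; first by rewrite -(low_in_one zs sq).
have zi := IHi i0 (ltnW ia); apply/negPn/negP=> ni.
have [zo|no] := boolP (outs z i.+1).
  by have := gap_ge ce cf r2 zi zo (ltnSn i); rewrite subSnn k0.
have := @gap_blanks V e z k P R ce cf r2 a b za zb ab gap [:: i.+1] isT => h.
suff : b - a + 1 <= 3 by rewrite eb; alia.
by apply: h => w; rewrite inE => /eqP->; split=> //; alia.
Qed.

Lemma gap3_pivot : q = 1.
Proof.
apply/eqP; rewrite eqn_leq q0 andbT leqNgt; apply/negP=> q1.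
by have := low_in_one (low_all_in (i := 2) isT (ltnW (leq_ltn_trans q1 qa))) q1.
Qed.

Lemma p0_low c : 1 < c -> c < a -> ~~ e (p 0) (p c).
Proof.
move=> c1 ca; apply/negP=> j; have cb : c < b by alia.
have /andP[_ zc] := low_all_in (ltnW c1) (ltnW ca).
have cN : c <= N by alia.
apply: (ham (bs := [:: S b N; R; [:: p 0]; S c b; S 1 c])).
- by rewrite /= bR !bseg.
- by rewrite /= !head_seg ?last_seg // zb' Ri // Ro // j gap3_p1 zc.
- move=> x; rewrite (cuts x) countL -(cseg x (ltnW c1) (ltnW ca) aN).
  have := cseg x (ltnW ca) (ltnW ab) bN'.
  by rewrite /= cats0 !count_cat /= ?count_cat; clia.
Qed.

Lemma p0_high c : b < c -> c < N -> ~~ e (p 0) (p c).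
Proof.
move=> bc cN; apply/negP=> j; have q1 := gap3_pivot.
have [y [y' eR]] : exists y y', R = [:: y; y'].
  by move: r2; rewrite k0; case: (R) => [|y [|y' []]] // _; exists y, y'.
have yR : y \in R by rewrite eR mem_head.
have y'R : y' \in R by rewrite eR !inE eqxx orbT.
have cN' : c <= N by exact: ltnW.
have qc : q <= c.-1 < N by rewrite q1; alia.
have qb : q <= b.-1 < N by rewrite q1; alia.
have b1 : 1 < b by alia.
apply: (ham (bs := [:: S b c; [:: y]; S 1 b; [:: y']; [:: p 0]; S c N])).
- by rewrite /= !bseg.
- by rewrite /= !head_seg ?last_seg // zb' j pz !Ri // !Ro ?q1.
- move=> x; rewrite (cuts x) countL eR -(cseg x (ltnW bc) cN' (leqnn N)).
  have := cseg x (ltnW a1) (ltnW ab) bN'.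
  by rewrite /= cats0 !count_cat /= !count_cat /=; clia.
Qed.

(** The out-arcs of [p 0] on [P] end at [p 1] or [p b], it is not adjacent to the segment, and it
    has no arc to [R] because the pivot is [1]. Its degree is thus at most [N + 2], one less than
    required. *)
Lemma gap3_false : False.
Proof.
have q1 := gap3_pivot.
have := @degin_p V e z k P R ce cf 0 N_gt0.
have dR : degin e (p 0) R <= size R.
  rewrite /degin (@eq_in_count _ (e (p 0)) pred0) ?count_pred0 ?count_size //.
  by move=> y yR /=; apply/negbTE/nRi; rewrite ?q1.
have cN' : b.+1 <= N by [].
have parts (x : pred V) : count x P =
    x (p 0) + x (p 1) + count x (S 2 a) + count x (S a b) + x (p b) + count x (S b.+1 N).
  rewrite (cuts x) countL -(cseg x (isT : 1 <= 2) a1 aN) (seg1 z); last by alia.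
  by rewrite -(cseg x (leqnSn b) bN (leqnn N)) (seg1 z) //=; clia.
have none i j : j <= N -> (forall c, i <= c < j -> ~~ e (p 0) (p c)) -> count (e (p 0)) (S i j) = 0.
  move=> jN nj; apply/eqP; rewrite -leqn0 leqNgt -has_count; apply/hasPn=> t tS.
  by have [c cij ->] := mem_segP ce cf tS jN; apply: nj.
have noG : count (e (p 0)) (S a b) = 0.
  apply/eqP; rewrite -leqn0 leqNgt -has_count; apply/hasPn=> t tS.
  by have [] := gap3_p0 tS.
have noG' : count (e^~ (p 0)) (S a b) = 0.
  apply/eqP; rewrite -leqn0 leqNgt -has_count; apply/hasPn=> t tS.
  by have [] := gap3_p0 tS.
have dP : degin e (p 0) P <= N - 2.
  rewrite /degin !parts noG noG' irr (none 2 a) // ?(none b.+1 N) //; last first.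
  - by move=> c /andP[c1 ca]; apply: p0_low.
  - by move=> c /andP[bc cN]; apply: p0_high.
  have := count_size (e^~ (p 0)) (S 2 a); have := count_size (e^~ (p 0)) (S b.+1 N).
  rewrite !size_seg //.
  have := leq_b1 (e (p 0) (p 1)); have := leq_b1 (e (p 1) (p 0)).
  have := leq_b1 (e (p 0) (p b)); have := leq_b1 (e (p b) (p 0)).
  by move: a1 bN; rewrite eb; clia.
have := leq_b1 (e (p 0) z); have := leq_b1 (e z (p 0)).
by move: dP dR bN; rewrite r2 k0 eb; clia.
Qed.

End Gap3.

Definition z_gap_at (V : finType) (e : rel V) (z : V) (P : seq V) (a b : nat) : Prop :=
  [/\ ins e z P z a, outs e z P z b, a < b &
    forall s, a < s < b -> ~~ ins e z P z s /\ ~~ outs e z P z s].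

Lemma z_gap_rev (V : finType) (e : rel V) (z : V) (P : seq V) (a b : nat) :
  z_gap_at e z P a b -> z_gap_at (fun x y => e y x) z (rev P) (size P - b) (size P - a).
Proof.
case=> za zb ab gap; have [a0 aN] : 0 < a /\ a <= size P by apply/andP/(ins_gt za).
have bN := outs_lt zb.
split.
- by rewrite ins_rev ?leq_subr // subKn // ltnW.
- by rewrite outs_rev ?leq_subr // subKn.
- by alia.
move=> s sab; have sN : s <= size P by alia.
by rewrite ins_rev ?outs_rev //; have [|-> ->] := gap (size P - s); first by alia.
Qed.

(** * Exchanging the gap with a segment of [P] *)

Section Final.

Variables (V : finType) (z : V) (k : nat).

Lemma blank_below (e : rel V) (P R : seq V) a b q : counterexample e z k -> config e z P R ->
  size R = k + 2 -> z_gap_at e z P a b -> is_pivot e z P R q -> q < a ->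
  [/\ k = 0, b = a.+2, ~~ outs e z P z q & ~~ ins e z P z q].
Proof.
move=> ce cf r2 [za zb ab gap] pq qa.
have [[s [zs sq]]|none] := classic (exists s, ins e z P z s /\ s <= q).
  have g2 := gap_ge ce cf r2 za zb ab.
  have g3 := @gap_blanks V e z k P R ce cf r2 a b za zb ab gap [::] isT.
  have {}g3 : b - a + 0 <= 3 by apply: g3.
  have [eg|ng] := eqVneq (b - a) (k + 2).
    by case: (tight_gap_false ce cf r2 za zb ab gap pq qa zs sq eg).
  have k0 : k = 0 by alia.
  have eb : b = a.+3 by alia.
  by case: (gap3_false ce cf r2 za zb ab gap pq qa zs sq k0 eb).
apply: (no_low_in ce cf r2 za zb ab gap pq qa) => s sq.
by apply/negP=> zs; apply: none; exists s.
Qed.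

(** A pivot above the segment is treated in the reversed configuration, whose pivot is then below
    it; reading slot and vertex backwards turns the vertex after the blank into the one before it,
    hence [s.-1]. *)
Lemma tight_blank (e : rel V) (P R : seq V) a b : counterexample e z k -> config e z P R ->
  size R = k + 2 -> z_gap_at e z P a b ->
  [/\ k = 0, b = a.+2 & exists s, [/\ ~~ outs e z P z s, ~~ ins e z P z s &
    (0 < s < a /\ forall y, y \in R -> e (nth z P s) y && e y (nth z P s)) \/
    (b < s < size P /\ forall y, y \in R -> e (nth z P s.-1) y && e y (nth z P s.-1))]].
Proof.
move=> ce cf r2 gp; have [za zb ab gap] := gp; have [q pq] := pivot ce cf r2.
have [a0 aN] : 0 < a /\ a <= size P by apply/andP/(ins_gt za).
have bN := outs_lt zb.
have [qa|bq] := orP (pivot_outside_gap ce cf r2 za zb ab gap pq).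
  have [k0 eb no ni] := blank_below ce cf r2 gp pq qa; split=> //; exists q; split=> //; left.
  case: pq => q0 qN Ro Ri _; split; first by rewrite q0.
  by move=> y yR; rewrite Ri ?Ro //; alia.
have ce' := counterexample_rev ce; have cf' := config_rev cf.
have r2' : size (rev R) = k + 2 by rewrite size_rev.
have gp' := z_gap_rev gp; have [za' zb' ab' gap'] := gp'.
have [q' pq'] := pivot ce' cf' r2'.
have [q0' qN' Ro' Ri' _] := pq'; rewrite size_rev in qN' Ri'.
have qa' : q' < size P - b.
  have /orP[//|bq'] := pivot_outside_gap ce' cf' r2' za' zb' ab' gap' pq'.
  have hR := head_mem z (R_neq0 ce cf).
  have := Ro' (head z R) (size P - a); rewrite mem_rev hR => /(_ isT bq').
  rewrite nth_rev; last by alia.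
  have -> : size P - (size P - a).+1 = a.-1 by alia.
  case: pq => _ _ _ _ nR; have [|_ h] := nR (head z R) a.-1 hR; first by alia.
  have aq : a.-1 < q by alia.
  by move=> h'; move: (h aq); rewrite h'.
have [k0 eb no ni] := blank_below ce' cf' r2' gp' pq' qa'.
rewrite outs_rev in no; last by alia.
rewrite ins_rev in ni; last by alia.
split=> //; first by alia.
exists (size P - q'); split=> //; right; split; first by alia.
move=> y yR; have yR' : y \in rev R by rewrite mem_rev.
have := Ro' y q' yR' (leqnn q'); have := Ri' y q' yR'; rewrite nth_rev ?subnS; last by alia.
by move=> -> ; [move=> ->|alia].
Qed.

(* The segment between slots [a] and [b] is a gap too: it and [R] are exchanged, and
   the pivot of the new configuration gives one blank slot too many. *)
Lemma tight_low_false (e : rel V) (P R : seq V) a b s : counterexample e z k -> config e z P R ->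
  size R = k + 2 -> z_gap_at e z P a b -> ~~ outs e z P z s -> ~~ ins e z P z s ->
  0 < s < a -> (forall y, y \in R -> e (nth z P s) y && e y (nth z P s)) -> False.
Proof.
move=> ce cf r2 gp no ni /andP[s0 sa] adj; have [za zb ab gap] := gp.
have [k0 eb _] := tight_blank ce cf r2 gp.
have [_ za'] := andP za; have [_ zb'] := andP zb.
have [zp pz] := zP0 ce cf; have [PR RP] := PR_links ce cf.
have [a0 aN] : 0 < a /\ a <= size P by apply/andP/(ins_gt za).
have bN := outs_lt zb; have bN' := ltnW bN.
have bR := block_R ce cf; have bseg := bseg ce cf.
have szR : size R = 2 by rewrite r2 k0.
have cseg := @count_seg V P.
have cuts (x : pred V) : count x P = count x (seg P 0 a) + count x (seg P a b) + count x (seg P b (size P)).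
  by rewrite -{1}(seg_full P) !cseg // ltnW.
have pstep i : 0 < i -> i < size P -> e (nth z P i.-1) (nth z P i).
  by case: i => // i _ iN; apply: (path_P ce cf).
have b0 : 0 < b by alia.
have aNl : a < size P by alia.
pose P2 := seg P b (size P) ++ R ++ seg P 0 a; pose R2 := seg P a b.
have size2 : size P2 = size P by rewrite /P2 !size_cat !size_seg // szR; alia.
have cf2 : config e z P2 R2.
  split.
  - apply: perm_trans (cf_perm cf); apply/permP=> x; have := cuts x.
    by rewrite /P2 /R2 /= !count_cat; clia.
  - have := @cycle_chain V e z (seg P b (size P)) [:: R; seg P 0 a; seg P a b].
    rewrite /= cats0 /P2 /R2 -!catA => ->; rewrite ?bR ?bseg //.
    by rewrite !head_seg ?last_seg // PR RP !pstep.
  - have := @cycle_chain V e z [:: z] [:: seg P b (size P); R; seg P 0 a].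
    rewrite /= cats0 /P2 -?catA => ->; rewrite ?bR ?bseg //.
    by rewrite !head_seg ?last_seg // zb' PR RP za'.
  move=> W G pWG c1 c2; rewrite /R2 size_seg //.
  by have := cf_min cf pWG c1 c2; rewrite szR eb; alia.
have r22 : size R2 = k + 2 by rewrite /R2 size_seg // eb k0; clia.
have nthU j : j < size P - b -> nth z P2 j = nth z P (b + j).
  by move=> j1; rewrite /P2 nth_cat size_seg // j1 nth_seg.
have nthR j : j < 2 -> nth z P2 (size P - b + j) = nth z R j.
  by move=> j1; rewrite /P2 nth_cat size_seg // ltnNge leq_addr addKn nth_cat szR j1.
have nthL j : j < a -> nth z P2 (size P - b + 2 + j) = nth z P j.
  move=> j1; rewrite /P2 -addnA nth_cat size_seg // ltnNge leq_addr addKn nth_cat szR.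
  have -> : (2 + j < 2) = false by apply/negbTE; rewrite -leqNgt leq_addr.
  by rewrite addKn /= nth_seg ?subn0.
have gp2 : z_gap_at e z P2 (size P - b) (size P - b + 2).
  split.
  - rewrite /ins size2 nthU; last by alia.
    by have -> : b + (size P - b).-1 = (size P).-1; [alia|rewrite pz andbT; alia].
  - rewrite /outs size2 -[X in nth z P2 X]addn0 nthL // zp andbT; alia.
  - by alia.
  move=> t tab; have -> : t = size P - b + 1 by alia.
  have r1 : nth z R 1 \in R by rewrite mem_nth // szR.
  have r0 : nth z R 0 \in R by rewrite mem_nth // szR.
  have [n1 _] := z_nonadjacent ce cf r1; have [_ n0] := z_nonadjacent ce cf r0.
  rewrite /ins /outs nthR // (negPf n1) andbF addn1 /= -[X in nth z P2 X]addn0 nthR // (negPf n0).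
  by rewrite andbF.
have [_ _ [s2 [no2 ni2 pos2]]] := tight_blank ce cf2 r22 gp2.
(* The inner slot of the segment and [s] are already two blanks of [z], so the new configuration may
   supply no third. *)
have two i : i <= size P -> i != s -> ~~ outs e z P z i -> ~~ ins e z P z i ->
    (i <= a) || (b <= i) -> False.
  move=> iN is' noi nii iab.
  have := @gap_blanks V e z k P R ce cf r2 a b za zb ab gap [:: s; i].
  rewrite /= inE eq_sym is' => /(_ isT) h; suff : b - a + 2 <= 3 by rewrite eb; alia.
  apply: h => w; rewrite !inE => /orP[]/eqP->; split=> //; alia.
case: pos2 => [[s2a _]|[s2b adj2]].
  have [s20 s2N] : 0 < s2 /\ s2 < size P - b by apply/andP.
  have l1 : s2 < size P by alia.
  have l2 : s2 <= size P by alia.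
  have l3 : b + s2 < size P by alia.
  have l4 : b + s2 <= size P by alia.
  have l5 : 0 < b + s2 by alia.
  have l6 : b + s2.-1 = (b + s2).-1 by alia.
  have l7 : s2.-1 < size P - b by alia.
  apply: (two (b + s2)) => //; last by rewrite leq_addr orbT.
  - by alia.
  - by move: no2; rewrite /outs size2 nthU // l1 l3.
  by move: ni2; rewrite /ins size2 nthU // l6 s20 l2 l4 l5.
rewrite size2 in s2b; pose i := s2 - (size P - b + 2).
have i0 : 0 < i by rewrite /i; alia.
have ia : i < a by rewrite /i; alia.
have es2 : s2 = size P - b + 2 + i by rewrite /i; alia.
have es2' : s2.-1 = size P - b + 2 + i.-1 by rewrite /i; alia.
have [eis|nis] := eqVneq i s; last first.
  have iN : i < size P by alia.
  have l1 : 0 < s2 <= size P by alia.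
  have l2 : s2 < size P by alia.
  have l3 : i.-1 < a by alia.
  apply: (two i _ nis); rewrite ?(ltnW ia) // ?(ltnW iN) //.
    by move: no2; rewrite /outs size2 l2 iN es2 nthL.
  by move: ni2; rewrite /ins size2 l1 es2' nthL // i0 (ltnW iN).
have paR2 : nth z P a \in R2 by apply: mem_seg.
have := adj2 _ paR2; rewrite es2' nthL; last by alia.
rewrite eis => /andP[j _].
have lR := last_mem z (R_neq0 ce cf); have /andP[_ ls] := adj _ lR.
have sN : s <= size P by alia.
(* The new blank slot is [s] again: the vertex before it has an arc to the segment, and [R] has one
   to the vertex after it. *)
apply: (ham ce cf (bs := [:: seg P 0 s; seg P a b; seg P b (size P); R; seg P s a])).
- by rewrite /= bR !bseg.
- by rewrite /= !head_seg ?last_seg // zp j pstep // PR ls za'.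
- move=> x; rewrite (cuts x) -(cseg x _ _ _ (leq0n s) (ltnW sa) aN).
  by rewrite /= cats0 !count_cat; clia.
Qed.

Lemma tight_false (e : rel V) (P R : seq V) a b : counterexample e z k -> config e z P R ->
  size R = k + 2 -> z_gap_at e z P a b -> False.
Proof.
move=> ce cf r2 gp; have [k0 eb [s [no ni [[sa adj]|[sb adj]]]]] := tight_blank ce cf r2 gp.
  exact: tight_low_false ce cf r2 gp no ni sa adj.
have sN : size P - s <= size P by apply: leq_subr.
have sN' : s <= size P by alia.
have r2' : size (rev R) = k + 2 by rewrite size_rev.
apply: (tight_low_false (counterexample_rev ce) (config_rev cf) r2' (z_gap_rev gp) (s := size P - s)).
- by rewrite outs_rev // subKn.
- by rewrite ins_rev // subKn.
- by alia.
move=> y; rewrite mem_rev => yR; rewrite nth_rev; last by alia.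
have -> : size P - (size P - s).+1 = s.-1 by alia.
by have /andP[-> ->] := adj y yR.
Qed.

End Final.

(** * Contraction *)

Lemma no_counterexample (V : finType) (e : rel V) (z : V) (k : nat) :
  counterexample e z k -> False.
Proof.
move=> ce; have [P [R cf]] := config_exists ce.
have [lt|le] := ltnP (k + 2) (size R).
  have zsw := fun s t => @z_switch V e z k P R ce cf s t lt.
  have [conn|nconn] := classic (forall w w', w \in R -> w' \in R -> w != w' -> R_path e z R w w').
    exact: single_switch_false ce cf zsw conn.
  apply: nconn => w w' wR w'R ww'; have [//|sp] := R_path_or_split ce cf wR w'R ww'.
  have [x [x' [y [y' [pR k0 _ _]]]]] := sp.
  by case: (split_false ce cf k0 _ sp); rewrite -(perm_sizeV pR).
have r2 : size R = k + 2 by apply/eqP; rewrite eqn_leq le (R_large ce cf).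
have [zsw|nzsw] := classic (forall s t, ins e z P z s -> outs e z P z t -> t < s).
  exact: single_switch_false ce cf zsw (tight_conn ce cf r2).
apply: nzsw => s t zs zt; rewrite ltnNge; apply/negP=> st.
have ne : s != t by apply: contraTneq zs => ->; apply: (z_excl ce cf).
have [|a [b [_ ab _ za [zb bl]]]] := closest_switch zs zt _ (fun w _ => @z_excl _ _ _ _ _ _ ce cf w).
  by alia.
by apply: (tight_false ce cf r2 (a := a) (b := b)).
Qed.

Section Contraction.

Variables (V : finType) (arc : rel V) (u v : V).
Hypothesis irr : irreflexive arc.
Hypothesis uv : u != v.

Notation W := {x : V | x != v}.

(** The vertex [v] is dropped and [u] stands for the contracted vertex, its in-arcs being replaced
    by those of [v]. The test [x != y] removes the loop that an arc from [u] to [v] would become. *)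
Definition contraction : rel W := fun x y =>
  (x != y) && (if val y == u then arc (val x) v else arc (val x) (val y)).

Definition contracted : W := exist _ u uv.

Lemma val_contracted (x : W) : (val x == u) = (x == contracted).
Proof. by rewrite -val_eqE. Qed.

Lemma count_contraction (f : pred V) :
  count (fun y : W => f (val y)) (enum {: W}) = #|[pred y | (y != v) && f y]|.
Proof.
have -> : count (fun y : W => f (val y)) (enum {: W}) = #|[pred w : W | f (val w)]|.
  by rewrite cardE -size_filter enumT /enum_mem.
rewrite -(card_image val_inj); apply: eq_card => y; rewrite inE.
apply/imageP/andP => [[w fw ->]|[yv fy]]; first by split; [exact: (valP w)|].
by exists (exist _ y yv).
Qed.

Lemma card_but2 (f : pred V) :
  #|f| = f u + f v + #|[pred y | [&& y != u, y != v & f y]]|.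
Proof.
rewrite (cardD1 u) (cardD1 v [predD1 f & u]) !inE (eq_sym v) uv /= addnA.
congr (_ + _); apply: eq_card => y; rewrite !inE; by case: (y == u); case: (y == v).
Qed.

Lemma nverts_contraction : nverts W + 1 = #|V|.
Proof.
rewrite /nverts card_sig (@eq_card _ _ (predC1 v)) // cardC1 addn1 prednK //.
by rewrite (cardD1 v).
Qed.

(** Only the arcs from [val x] to [u] and from [v] to [val x] are lost. *)
Lemma degin_contraction (x : W) : x != contracted ->
  deg arc (val x) <= degin contraction x (enum {: W}) + 2.
Proof.
move=> xz; have xu : val x != u by rewrite val_contracted.
have xv : val x != v := valP x.
rewrite /degin; pose fo y := (val x != y) && (if y == u then arc (val x) v else arc (val x) y).
pose fi y := (y != val x) && arc y (val x).
rewrite (@eq_count _ (contraction x) (fun y : W => fo (val y))); last first.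
  by move=> y; rewrite /contraction /fo -val_eqE.
rewrite (@eq_count _ (contraction^~ x) (fun y : W => fi (val y))); last first.
  by move=> y; rewrite /contraction /fi -val_eqE (negPf xu).
rewrite !count_contraction /deg /outdeg /indeg !cardsE.
rewrite (card_but2 (fun y => arc (val x) y)) (card_but2 (fun y => arc y (val x))).
rewrite (card_but2 (fun y => (y != v) && fo y)) (card_but2 (fun y => (y != v) && fi y)).
have -> : #|[pred y | [&& y != u, y != v & (y != v) && fo y]]| =
          #|[pred y | [&& y != u, y != v & arc (val x) y]]|.
  apply: eq_card => y; rewrite !inE /fo; case: eqP => //= _; case: eqP => //= _.
  by case: eqP => //= <-; rewrite irr.
have -> : #|[pred y | [&& y != u, y != v & (y != v) && fi y]]| =
          #|[pred y | [&& y != u, y != v & arc y (val x)]]|.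
  apply: eq_card => y; rewrite !inE /fi; case: eqP => //= _; case: eqP => //= _.
  by case: eqP => //= ->; rewrite irr.
rewrite /fo /fi uv !eqxx xu /= (eq_sym u) xu /=.
have := leq_b1 (arc (val x) u); have := leq_b1 (arc v (val x)); clia.
Qed.

(** An arc from [u] to [v] is counted twice on the left and lost as a loop; this is why the
    hypothesis on [u] and [v] may be weaker by two when it is absent. *)
Lemma degin_contracted :
  outdeg arc u + indeg arc v =
    degin contraction contracted (enum {: W}) + 2 * arc u v.
Proof.
rewrite /degin; pose fo y := (u != y) && (if y == u then arc u v else arc u y).
pose fi y := (y != u) && arc y v.
rewrite (@eq_count _ (contraction contracted) (fun y : W => fo (val y))); last first.
  by move=> y; rewrite /contraction /fo -val_eqE.
rewrite (@eq_count _ (contraction^~ contracted) (fun y : W => fi (val y))); last first.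
  by move=> y; rewrite /contraction /fi -val_eqE /= eqxx.
rewrite !count_contraction /outdeg /indeg !cardsE.
rewrite (card_but2 (fun y => arc u y)) (card_but2 (fun y => arc y v)).
rewrite (card_but2 (fun y => (y != v) && fo y)) (card_but2 (fun y => (y != v) && fi y)).
have -> : #|[pred y | [&& y != u, y != v & (y != v) && fo y]]| =
          #|[pred y | [&& y != u, y != v & arc u y]]|.
  apply: eq_card => y; rewrite !inE /fo; case: eqP => //= _; case: eqP => //= _.
  by case: eqP => //= <-; rewrite irr.
have -> : #|[pred y | [&& y != u, y != v & (y != v) && fi y]]| =
          #|[pred y | [&& y != u, y != v & arc y v]]|.
  by apply: eq_card => y; rewrite !inE /fi; case: eqP => //= _; case: eqP.
rewrite /fo /fi uv !eqxx /= !irr; clia.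
Qed.

Lemma crossing_arc (T : Type) (r : rel T) (Q : pred T) x s :
  path r x s -> Q x -> ~~ Q (last x s) -> exists a b, [/\ r a b, Q a & ~~ Q b].
Proof.
elim: s x => [|y s IHs] x /=; first by move=> _ ->.
case/andP=> rxy py Qx nQ; have [Qy|nQy] := boolP (Q y); first exact: IHs py Qy nQ.
by exists x, y.
Qed.

(** If [a] is the contracted vertex, both [u] and [v] are deleted. Otherwise [a] is deleted with one
    of them: with [v] if the contracted vertex is in [X], as arcs leave it from [u]; with [u] if it
    is not, as arcs enter it at [v]. *)
Lemma contraction_two_strong : m_strong arc 3 -> two_strong contraction.
Proof.
case=> _ strong3 a X [x Xx xa] [y nXy ya].
have cross (A : {set V}) (Q : pred V) x' y' : #|A| <= 2 -> x' \notin A -> y' \notin A ->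
    Q x' -> ~~ Q y' -> exists b c, [/\ b \notin A, c \notin A, Q b, ~~ Q c & arc b c].
  move=> A2 xA yA Qx nQy.
  have ne : exist _ x' xA != exist _ y' yA :> {x : V | x \notin A}.
    by rewrite -val_eqE /=; apply: contraTneq Qx => ->.
  have [s /and3P[ps /eqP ls _]] := strong3 A A2 _ _ ne.
  have [||b [c [bc Qb nQc]]] := @crossing_arc _ _ (fun w => Q (val w)) _ _ ps; rewrite ?ls //.
  by exists (val b), (val c); split=> //; [exact: (valP b)|exact: (valP c)].
(* Only at [v] does [insub] fail, so [v] counts as outside [X], as needed when the contracted vertex
   is outside. *)
pose X' w := if insub w is Some w' then X w' else false.
have X'E (w : W) : X' (val w) = X w by rewrite /X' valK.
have ne2 (b c : V) : #|[set b; c]| <= 2 by rewrite cards2; case: (_ != _).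
have lift b c : b != v -> c != v -> c != u -> b != val a -> c != val a -> X' b -> ~~ X' c -> arc b c ->
    exists x' y', [/\ X x', ~~ X y', x' != a, y' != a & contraction x' y'].
  move=> bv cv cu ba ca Xb nXc bc; exists (exist _ b bv), (exist _ c cv).
  rewrite -!X'E /= -!val_eqE /= Xb nXc ba ca; split=> //.
  rewrite /contraction -val_eqE /= (negPf cu) bc andbT.
  by apply: contraTneq Xb => ->.
have xa' : val x != val a by rewrite val_eqE.
have ya' : val y != val a by rewrite val_eqE.
have xv : val x != v := valP x.
have yv : val y != v := valP y.
have [ea|az] := eqVneq a contracted.
  have [||||b [c []]] := cross [set u; v] X' (val x) (val y) (ne2 u v); rewrite ?X'E //.
  - by rewrite !inE negb_or xv andbT; rewrite ea in xa'.
  - by rewrite !inE negb_or yv andbT; rewrite ea in ya'.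
  rewrite !inE !negb_or => /andP[bu bv] /andP[cu cv] Xb nXc bc.
  by apply: (lift b c); rewrite ?ea.
have au : u != val a by rewrite eq_sym val_contracted.
have [Xz|nXz] := boolP (X contracted).
  have [||||b [c []]] := cross [set val a; v] X' u (val y) (ne2 _ v); rewrite ?X'E //.
  - by rewrite !inE negb_or au.
  - by rewrite !inE negb_or ya'.
  - by rewrite (X'E contracted).
  rewrite !inE !negb_or => /andP[ba bv] /andP[ca cv] Xb nXc bc.
  apply: (lift b c) => //; apply: contraNneq nXc => ->; by rewrite (X'E contracted).
have X'v : X' v = false by rewrite /X' insubF // eqxx.
have [||||b [c []]] := cross [set val a; u] X' (val x) v (ne2 _ u); rewrite ?X'E ?X'v //.
- by rewrite !inE negb_or xa' /=; apply: contraNneq nXz => xu; have -> : contracted = x by apply: val_inj.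
- by rewrite !inE negb_or (eq_sym v) (valP a) eq_sym.
rewrite !inE !negb_or => /andP[ba bu] /andP[ca cu] Xb nXc bc.
have bv : b != v by apply: contraTneq Xb => ->; rewrite X'v.
have [ecv|cv] := eqVneq c v; last exact: (lift b c).
exists (exist _ b bv), contracted; rewrite -!X'E /= -!val_eqE /= (X'E contracted); split=> //.
by rewrite /contraction -val_eqE /= bu eqxx -ecv.
Qed.

Lemma contraction_path x s : contracted \notin s -> path contraction x s ->
  path arc (val x) (map val s).
Proof.
elim: s x => //= y s IHs x; rewrite inE negb_or => /andP[zy zs] /andP[/andP[_ xy] ps].
rewrite val_contracted eq_sym (negPf zy) in xy.
by rewrite xy IHs.
Qed.

(** The cycle is cut at the contracted vertex, which becomes the start [u]; its closing arc is an
    arc into [v]. *)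
Lemma contraction_hamiltonian c : cycle contraction c -> perm_eq c (enum {: W}) ->
  exists p, hamiltonian_path arc u v p.
Proof.
move=> cyc pc; have zc : contracted \in c by rewrite (perm_mem pc) mem_enum.
have [i s es] := rot_to zc.
have ps : perm_eq (contracted :: s) (enum {: W}).
  by rewrite -es perm_rot.
have cz : cycle contraction (contracted :: s) by rewrite -es rot_cycle.
have us : uniq (contracted :: s) by rewrite (perm_uniq ps) enum_uniq.
have /andP[zs us'] := us.
move: cz; rewrite /= rcons_path => /andP[pz].
rewrite /contraction eqxx => /andP[_ lv].
exists (rcons (map val s) v); split; last first.
  move=> w; rewrite inE mem_rcons inE; have [->|wv] := eqVneq w v; first by rewrite orbT.
  have : exist _ w wv \in contracted :: s by rewrite (perm_mem ps) mem_enum.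
  by rewrite inE => /orP[/eqP[->]|/(map_f val)/= ->]; rewrite ?eqxx ?orbT.
apply/and3P; split.
- rewrite rcons_path (contraction_path zs pz) /=.
  by rewrite -[u]/(val contracted) last_map.
- by rewrite last_rcons.
rewrite /= mem_rcons inE negb_or uv rcons_uniq.
have -> : v \notin map val s by apply/mapP=> -[w _ ev]; have := valP w; rewrite -ev eqxx.
have -> : uniq (map val s) by rewrite (map_inj_uniq val_inj).
rewrite !andbT; apply: contra zs => /mapP[w ws ew].
by have -> : contracted = w by apply: val_inj.
Qed.

End Contraction.

Theorem theorem1p11 (k n : nat) (V : finType) (arc : rel V)
    (loopless : irreflexive arc)
    (order_D : #|V| = n + 1) (n_large : 10 <= n + 1)
    (strong3 : m_strong arc 3)
    (u v : V) (neq_uv : u != v)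
    (* bounds n-k-2 and n-k-4 with the subtracted terms moved across: subtraction on nat truncates *)
    (cond1 : n <= outdeg arc u + indeg arc v + k + 2 \/
             (~~ arc u v /\ n <= outdeg arc u + indeg arc v + k + 4))
    (cond2 : forall x : V, x != u -> x != v -> n + k + 2 <= deg arc x) :
  exists p : seq V, hamiltonian_path arc u v p.
Proof.
have nW : nverts {x : V | x != v} = n by have := nverts_contraction v; rewrite order_D => /addIn.
apply: NNPP => noham.
suff : counterexample (@contraction V arc u v) (contracted neq_uv) k by exact: no_counterexample.
split.
- by move=> x; rewrite /contraction eqxx.
- exact: contraction_two_strong.
- move=> x xz; have := degin_contraction loopless xz.
  have := cond2 (val x); rewrite (val_contracted neq_uv) nW (valP x) => /(_ xz isT) h1 h2.
  by rewrite -(leq_add2r 2); apply: leq_trans h1 h2.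
- rewrite nW; have := degin_contracted loopless neq_uv.
  by move: cond1; case: (arc u v) => /= [[|[]]|[|[_]]] //; clia.
- by rewrite nW; move: n_large; clia.
by move=> c cyc pc; apply: noham; apply: contraction_hamiltonian cyc pc.
Qed.
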